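(* Let $d\ge2$ and let $s\ge t\ge0$ be fixed real numbers with $s>d/2$. Let $x_1,\dots,x_m\in\mathbb{S}^d$ and $w_1,\dots,w_m>0$ with $\sum_{j=1}^mw_j=|\mathbb{S}^d|$, and assume that for some $\eta\in[0,1)$ $$\left|\sum_{j=1}^m w_j\chi(x_j)^2-\int_{\mathbb{S}^d}\chi^2\,\mathrm{d}\omega_d\right|\le \eta\int_{\mathbb{S}^d}\chi^2\,\mathrm{d}\omega_d\qquad\text{for all }\chi\in\mathbb{P}_n(\mathbb{S}^d).$$ Then the unfettered hyperinterpolation operator $\mathcal{U}_n:H^s(\mathbb{S}^d)\to H^t(\mathbb{S}^d)$ satisfies, for every $f\in H^s(\mathbb{S}^d)$, $$\|\mathcal{U}_nf\|_{H^t}\le\tilde c\left[\left(\sqrt{1+\eta}\,|\mathbb{S}^d|^{1/2}+1\right)(n+1)^{d/2+t-s}\|f\|_{H^s}+(n+1)^t\sqrt{\eta^2+4\eta}\,\|f\|_{L^2}\right]+\|f\|_{H^s}$$ and $$\|\mathcal{U}_nf-f\|_{H^t}\le\tilde c\left[\left(\sqrt{1+\eta}\,|\mathbb{S}^d|^{1/2}+1\right)(n+1)^{d/2+t-s}E_n(f;H^s(\mathbb{S}^d))+(n+1)^t\sqrt{\eta^2+4\eta}\,\|f\|_{L^2}\right],$$ where $E_n(f;H^s(\mathbb{S}^d))=\inf_{\chi\in\mathbb{P}_n(\mathbb{S}^d)}\|f-\chi\|_{H^s}$ and $\tilde c>0$ is some constant, independent of $n$, $m$, $\eta$, the points, the weights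 and $f$, which may differ between the two bounds.
   Context: $\mathbb{S}^d$ is the unit sphere in $\mathbb{R}^{d+1}$, $\omega_d$ its (unnormalized) surface measure, $|\mathbb{S}^d|=\int_{\mathbb{S}^d}\mathrm{d}\omega_d$; $\|\cdot\|_{L^2}$ and $\langle\cdot,\cdot\rangle$ refer to real $L^2(\mathbb{S}^d,\omega_d)$. $\mathbb{P}_n(\mathbb{S}^d)$ is the space of restrictions to $\mathbb{S}^d$ of real polynomials of degree at most $n$. For each $\ell\ge0$, $\{Y_{\ell,k}:k=1,\dots,Z(d,\ell)\}$ is an $L^2$-orthonormal basis of the real spherical harmonics of exact degree $\ell$, $Z(d,\ell)$ being the dimension of that space. Put $\hat f_{\ell,k}=\langle f,Y_{\ell,k}\rangle$. Sobolev spaces: for $r\ge0$, with $\lambda_\ell=\ell(\ell+d-1)$, $H^r(\mathbb{S}^d)$ is the set of $f\in L^2(\mathbb{S}^d)$ with $\sum_{\ell\ge0}\sum_{k=1}^{Z(d,\ell)}(1+\lambda_\ell)^r|\hat f_{\ell,k}|^2<\infty$. It is normed by $\|f\|_{H^r}:=\big(\sum_{\ell\ge0}\sum_{k=1}^{Z(d,\ell)}\frac{1}{a_\ell^{(r)}}|\hat f_{\ell,k}|^2\big)^{1/2}$, where $(a_\ell^{(r)})_{\ell\ge0}$ is a given sequence of positive reals with $a_\ell^{(r)}\asymp(1+\lambda_\ell)^{-r}\asymp(1+\ell)^{-2r}$ (bounded above and below by positive constant multiples, uniformly in $\ell$); a different choice of the sequence merely leads to an equivalent norm. For $s>d/2$,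 $H^s(\mathbb{S}^d)$ is continuously embedded in the space of continuous functions on $\mathbb{S}^d$, so point values of $f$ make sense. Given points $x_j$ and weights $w_j$, put $\langle f,g\rangle_m=\sum_{j=1}^mw_jf(x_j)g(x_j)$; the unfettered hyperinterpolant of degree $n$ of a continuous $f$ is $\mathcal{U}_nf=\sum_{\ell=0}^n\sum_{k=1}^{Z(d,\ell)}\langle f,Y_{\ell,k}\rangle_mY_{\ell,k}$.
   Formalization: For s−t > d/2 the first bound is proved under the extra assumption a_ℓ^{(s)} ≤ a_ℓ^{(t)} for all ℓ; without it the bound is false (f = Y_{ℓ,k}, exact positive rules with η = 0, n → ∞), since the last term ‖f‖_{H^s} has constant 1. *)

(* Defs.v *)
From HB Require Import structures.
From mathcomp Require Import all_boot all_order all_algebra.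
From mathcomp Require Import all_classical all_reals all_analysis.
From mathcomp Require Import measurable_realfun.
From mathcomp Require mpoly.
Import (canonicals, coercions) mpoly.

Set Implicit Arguments.
Unset Strict Implicit.
Unset Printing Implicit Defensive.
Import Order.TTheory GRing.Theory Num.Theory.
Import numFieldNormedType.Exports.
Local Open Scope classical_set_scope.
Local Open Scope ring_scope.

(* The n-fold product m \x ... \x m on [n.-tuple T], which the library equips
   with the product sigma-algebra. *)
Section tuple_measure.
Context {d : measure_display} {T : measurableType d} {R : realType}.

Definition cons_tuple n (p : T * n.-tuple T) : n.+1.-tuple T :=
  [the n.+1.-tuple T of p.1 :: p.2].

Lemma measurable_cons_tuple n : measurable_fun setT (@cons_tuple n).
Proof. exact: measurable_cons. Qed.

HB.instance Definition _ n := isMeasurableFun.Build _ _ _ _ (@cons_tuple n)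
  (@measurable_cons_tuple n).

Variable m : {sigma_finite_measure set T -> \bar R}.

Section cons_measure.
Variables (n : nat) (mu : {sigma_finite_measure set (n.-tuple T) -> \bar R}).

Definition cons_measure : set (n.+1.-tuple T) -> \bar R :=
  pushforward (m \x mu)%E (@cons_tuple n).

Let cons_measure0 : cons_measure set0 = 0%E.
Proof. exact: measure0. Qed.

Let cons_measure_ge0 A : (0 <= cons_measure A)%E.
Proof. exact: measure_ge0. Qed.

Let cons_measure_sigma_additive : semi_sigma_additive cons_measure.
Proof. exact: measure_semi_sigma_additive. Qed.

HB.instance Definition _ := isMeasure.Build _ _ _ cons_measure
  cons_measure0 cons_measure_ge0 cons_measure_sigma_additive.

Let cons_measure_sigma_finite : sigma_finite setT cons_measure.
Proof.
have /sigma_finiteP[F [FT ndF Foo]] := sigma_finiteT m.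
have /sigma_finiteP[G [GT ndG Goo]] := sigma_finiteT mu.
pose u (v : n.+1.-tuple T) : T * n.-tuple T :=
  (thead v, [tuple of behead v]).
have mu_ : measurable_fun setT u.
  by apply: measurable_fun_pair; [exact: measurable_tnth|exact: measurable_behead].
have uK : cancel (@cons_tuple n) u by move=> [x v]; congr pair; apply/val_inj.
exists (fun i => u @^-1` (F i `*` G i)).
  apply/esym; rewrite -subTset => v _.
  have [i _ Fi] : (\bigcup_i F i) (u v).1 by rewrite -FT.
  have [j _ Gj] : (\bigcup_j G j) (u v).2 by rewrite -GT.
  exists (maxn i j) => //; split.
    by move: Fi; apply/subsetPset/ndF/leq_maxl.
  by move: Gj; apply/subsetPset/ndG/leq_maxr.
move=> i; have [mF Fi] := Foo i; have [mG Gi] := Goo i; split.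
  by rewrite -[X in measurable X]setTI; apply: mu_ => //; exact: measurableX.
rewrite /cons_measure /pushforward -comp_preimage.
rewrite (_ : u \o _ = id); last by apply/funext => p; exact: uK.
by rewrite /= product_measure1E// lte_mul_pinfty// ge0_fin_numE.
Qed.

HB.instance Definition _ := Measure_isSigmaFinite.Build _ _ _ cons_measure
  cons_measure_sigma_finite.
End cons_measure.

Fixpoint tuple_measure n : {sigma_finite_measure set (n.-tuple T) -> \bar R} :=
  match n with
  | 0 => [the {sigma_finite_measure set (0.-tuple T) -> \bar R} of
          dirac ([tuple] : 0.-tuple T)]
  | n.+1 => [the {sigma_finite_measure set (n.+1.-tuple T) -> \bar R} of
             cons_measure (tuple_measure n)]
  end.

End tuple_measure.

Section sphere.
Variable R : realType.
Local Notation RR := (measurableTypeR R).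


Definition lebesgue_tuple n : {sigma_finite_measure set (n.-tuple RR) -> \bar R} :=
  tuple_measure (@lebesgue_measure R) n.

(* The Euclidean norm; the library's norm on matrices is the sup norm. *)
Definition enorm n (x : 'rV[R]_n) : R := Num.sqrt (\sum_i x ord0 i ^+ 2).

Lemma measurable_enorm n :
  measurable_fun setT (fun t : n.-tuple RR => enorm (\row_i tnth t i) : R).
Proof.
apply: (measurableT_comp (f := @Num.sqrt R)).
  by apply: continuous_measurable_fun; exact: sqrt_continuous.
apply: measurable_sum => i; apply: measurable_funX.
rewrite (_ : (fun _ => _) = (@tnth _ RR)^~ i); first exact: measurable_tnth.
by apply/funext => t; rewrite mxE.
Qed.

Lemma enormZ n c (x : 'rV[R]_n) : enorm (c *: x) = `|c| * enorm x.
Proof.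
rewrite /enorm -sqrtr_sqr -sqrtrM ?sqr_ge0// mulr_sumr.
by congr Num.sqrt; apply: eq_bigr => i _; rewrite mxE exprMn.
Qed.

Lemma enorm_ge0 n (x : 'rV[R]_n) : 0 <= enorm x.
Proof. exact: sqrtr_ge0. Qed.

Variable d : nat.

Definition sphere : set 'rV[R]_d.+1 := [set x | enorm x = 1].

Lemma sphere_e0 : sphere (delta_mx ord0 ord0).
Proof.
rewrite /sphere /= /enorm big_ord_recl big1 ?addr0 => [|i _].
  by rewrite mxE !eqxx expr1n sqrtr1.
by rewrite mxE andbC expr0n.
Qed.

Definition e0 : sphere := SigSub (mem_set sphere_e0).

HB.instance Definition _ := isPointed.Build (set_type sphere) e0.

(* The sigma-algebra generated by the coordinate functions, i.e. the Borel
   sigma-algebra of the sphere. *)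
Let coord (i : 'I_d.+1) (x : sphere) : R := \val x ord0 i.

Let sphere_set0 : g_sigma_preimage coord set0.
Proof. exact: sigma_algebra0. Qed.

Let sphere_setC A : g_sigma_preimage coord A -> g_sigma_preimage coord (~` A).
Proof. exact: sigma_algebraC. Qed.

Let sphere_bigcup (F : (set sphere)^nat) :
  (forall i, g_sigma_preimage coord (F i)) ->
  g_sigma_preimage coord (\bigcup_i F i).
Proof. exact: sigma_algebra_bigcup. Qed.

HB.instance Definition _ := @isMeasurable.Build default_measure_display
  (set_type sphere) (g_sigma_preimage coord)
  sphere_set0 sphere_setC sphere_bigcup.

(* x / |x|; the value at the origin, a null set, is irrelevant. *)
Definition radial (t : d.+1.-tuple RR) : sphere :=
  let x := \row_i tnth t i in insubd e0 ((enorm x)^-1 *: x).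

Lemma measurable_fun_sphere d' (T : measurableType d') (f : T -> sphere) :
  (forall i, measurable_fun setT (coord i \o f)) -> measurable_fun setT f.
Proof.
move=> mf _ Y mY; rewrite setTI.
have : preimage_set_system setT f (g_sigma_preimage coord) (f @^-1` Y).
  by exists Y => //; rewrite setTI.
rewrite -g_sigma_preimage_comp; move: (f @^-1` Y).
apply: smallest_sub; first exact: sigma_algebra_measurable.
rewrite -bigcup_mkord_ord; apply: bigcup_sub => i _ A [B mB <-].
exact: mf.
Qed.

Lemma measurable_radial : measurable_fun setT radial.
Proof.
apply: measurable_fun_sphere => i.
pose r (t : d.+1.-tuple RR) := enorm (\row_j tnth t j).
rewrite (_ : _ \o _ = fun t => if r t == 0 then \val e0 ord0 i
    else r t `^ (- 1) * tnth t i).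
  apply: measurable_fun_ifT => //.
    by apply: measurable_fun_eqr => //; exact: measurable_enorm.
  apply: measurable_funM; last exact: measurable_tnth.
  by apply: (measurableT_comp (measurable_powR _)); exact: measurable_enorm.
apply/funext => t; rewrite /= /coord /radial /=.
rewrite -/(r t); case: ifPn => [/eqP r0|r0].
  rewrite /insubd insubN//; apply/negP => /set_mem.
  by rewrite /sphere /= enormZ -/(r t) r0 mulr0 => /esym/eqP; rewrite oner_eq0.
rewrite insubdK; first by rewrite 2!mxE powR_inv1// enorm_ge0.
apply/mem_set; rewrite /sphere /= enormZ -/(r t).
by rewrite ger0_norm ?mulVf// invr_ge0 enorm_ge0.
Qed.

HB.instance Definition _ := isMeasurableFun.Build _ _ _ _ radial
  measurable_radial.

Lemma measurable_unit_ball :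
  measurable [set t : d.+1.-tuple RR | enorm (\row_i tnth t i) <= 1].
Proof.
pose one : d.+1.-tuple RR -> R := cst 1.
have m1 : measurable_fun setT one by exact: measurable_cst.
have := measurable_fun_ler (@measurable_enorm d.+1) m1.
by move=> /(_ measurableT [set true] I); rewrite setTI.
Qed.

Definition ball_measure : set (d.+1.-tuple RR) -> \bar R :=
  mscale d.+1%:R%:nng (mrestr (lebesgue_tuple d.+1) measurable_unit_ball).

HB.instance Definition _ := Measure.on ball_measure.

(* The unnormalized surface measure, as the cone measure: the surface area of A
   is d + 1 times the volume of {r *: x | 0 < r <= 1, x \in A}. *)
Definition surface_measure : set sphere -> \bar R :=
  pushforward ball_measure radial.

Let surface0 : surface_measure set0 = 0%E.
Proof. exact: measure0. Qed.

Let surface_ge0 A : (0 <= surface_measure A)%E.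
Proof. exact: measure_ge0. Qed.

Let surface_sigma_additive : semi_sigma_additive surface_measure.
Proof. exact: measure_semi_sigma_additive. Qed.

HB.instance Definition _ := isMeasure.Build _ _ _ surface_measure
  surface0 surface_ge0 surface_sigma_additive.

End sphere.

Arguments sphere : clear implicits.
Arguments surface_measure : clear implicits.

Section function_spaces.
Variables (R : realType) (d : nat).
Local Notation S := (set_type (sphere R d)).
Local Notation omega := (surface_measure R d).
Implicit Types (f g : S -> R) (n m l : nat).

Definition eval_sphere (p : mpoly.mpoly d.+1 R) (x : S) : R :=
  mpoly.meval (fun i => \val x ord0 i) p.

(* [mpoly.msize] is the total degree plus one (and 0 for the zero polynomial). *)
Definition poly_space n : set (S -> R) :=
  [set eval_sphere p | p in [set p | (mpoly.msize p <= n.+1)%N]].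

Definition laplacian (p : mpoly.mpoly d.+1 R) : mpoly.mpoly d.+1 R :=
  \sum_(i < d.+1) mpoly.mderiv i (mpoly.mderiv i p).

Definition spherical_harmonics l : set (S -> R) :=
  [set eval_sphere p | p in [set p |
    p \is mpoly.ishomog1 l mpoly.mdeg /\
    laplacian p = 0]].

Definition ip f g : R := \int[omega]_x (f x * g x).

Record orthonormal_basis (V : set (S -> R)) (k : nat) (Y : 'I_k -> S -> R) :
    Prop := OrthonormalBasis {
  onb_mem : forall i, V (Y i) ;
  onb_orthonormal : forall i j, ip (Y i) (Y j) = (i == j)%:R ;
  onb_span : forall f, V f ->
    exists c : 'I_k -> R, f = fun x => \sum_(i < k) c i * Y i x }.

Definition eigenvalue_LB l : R := (l * (l + d - 1))%:R.

Definition sobolev_weight (r : R) (a : nat -> R) : Prop :=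
  exists c C : R, [/\ 0 < c, 0 < C &
    forall l, c * (1 + eigenvalue_LB l) `^ (- r) <= a l
              <= C * (1 + eigenvalue_LB l) `^ (- r)].

Variables (Z : nat -> nat) (Y : forall l, 'I_(Z l) -> S -> R).

Definition weighted_sum (b : nat -> R) f : \bar R :=
  (\sum_(0 <= l <oo) \sum_(k < Z l) (b l * `|ip f (Y k)| ^+ 2)%:E)%E.

Definition in_sobolev (r : R) f : Prop :=
  f \in Lfun omega 2%:E /\
  (weighted_sum (fun l => (1 + eigenvalue_LB l) `^ r)%R f < +oo)%E.

Definition sobolev_norm (a : nat -> R) f : \bar R :=
  (weighted_sum (fun l => (a l)^-1)%R f `^ 2^-1)%E.

(* E_n(f; H^s), the norm of H^s being given by the weights a *)
Definition best_approx (a : nat -> R) n f : \bar R :=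
  ereal_inf [set sobolev_norm a (f \- chi) | chi in poly_space n].

Definition ip_discrete m (x : 'I_m -> S) (w : 'I_m -> R) f g : R :=
  \sum_(j < m) w j * f (x j) * g (x j).

Definition hyperinterpolant m (x : 'I_m -> S) (w : 'I_m -> R) n f : S -> R :=
  fun y => \sum_(l < n.+1) \sum_(k < Z l) ip_discrete x w f (Y k) * Y k y.

(* For s > d/2 a class f of H^s has a continuous representative f0, and the point
   values of f are those of f0. *)
Definition continuous_version f f0 : Prop :=
  continuous f0 /\ {ae omega, forall x, f x = f0 x}.

End function_spaces.

(* Main.v *)
(** Let P_n f be the truncated harmonic expansion of f. Then
    U_n f - f = U_n (f - P_n f) + (U_n (P_n f) - P_n f) + (P_n f - f).
    The coefficients of U_n g are controlled by the values of g at the nodes: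
    testing the discrete inner product against U_n g itself and using
    Cauchy-Schwarz with the quadrature hypothesis gives
    |U_n g|_2^2 <= (1 + eta) |S^d| sup |g|^2. Polarizing the hypothesis gives
    |U_n p - p|_2 <= eta |p|_2 for polynomials p. The last term is a tail of the
    Sobolev series.

    It remains to bound f - P_n f uniformly. By the addition theorem
    sum_k Y_{l,k}(x)^2 = Z(d,l) / |S^d| and Z(d,l) <= 2 (l+1)^(d-1), Cauchy-Schwarz
    bounds P_M f - P_n f uniformly in M. As f - P_M f is orthogonal to all
    polynomials of degree at most M, testing it against high powers of a linear
    polynomial peaking at a point transfers the bound to the continuous version
    of f.

    The theory of spherical harmonics rests on the operators X_i d_j - X_j d_i.
    In polar coordinates a Gaussian integral of a homogeneous polynomial is a
    multiple of its integral over the sphere, so these operators are antisymmetric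
    on the sphere; their squares sum to a multiple of l (l + d - 1) on harmonics of
    degree l, hence orthogonality; and they annihilate sum_k Y_{l,k}^2, which is
    therefore constant. *)
Require Import Defs.
From HB Require Import structures.
From mathcomp Require Import all_boot all_order all_algebra.
From mathcomp Require Import reals.
From mathcomp Require mpoly.
From mathcomp Require Import ring lra zify.

Set Implicit Arguments.
Unset Strict Implicit.
Unset Printing Implicit Defensive.
Import Order.TTheory GRing.Theory Num.Theory.
Local Open Scope ring_scope.

(** * Homogeneous harmonic polynomials *)

(** The exponent d/2 + t - s comes from squares: degree l contributes about (l+1)^(d-1) harmonics
    with weight (l+1)^(-2s), so the squared uniform error has order (n+1)^(d-2s), summable because s
    > d/2; measuring a polynomial of degree n in H^t costs (n+1)^(2t).

    The point values belong to f0 while the coefficients belong to the L2 class of f. The peaking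
    powers link the two: they are nonnegative and concentrate at a point, and each of them sees only
    finitely many coefficients. Thus pointwise information is obtained without first identifying the
    limit of the expansions.

    Gaussian integrals reduce rotation invariance to a recurrence for one-dimensional moments.
    Likewise the constancy of the sum of squares is settled by a polynomial differential equation
    along a line, without a group action or a path on the sphere.

    For the first bound, the error estimate is added to the H^t norm of P_n f. That norm is at most
    a constant times |f|_{H^s}, which the first term absorbs whenever its exponent is
    nonnegative. *)

Lemma sum_nat_ends (F : nat -> nat) n : (0 < n)%N ->
  (\sum_(0 <= i < n.+1) F i = F 0 + \sum_(0 <= i < n.-1) F i.+1 + F n)%N.
Proof. by case: n => // n _; rewrite big_nat_recl// big_nat_recr//= addnA. Qed.

Section HarmonicAlgebra.
Import mpoly.
Variables (R : realType) (d : nat).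
Local Notation P := {mpoly R[d.+1]}.
Implicit Types (p q : P) (i j : 'I_d.+1).

(** Infinitesimal rotation in the plane of the axes i and j. *)
Definition angular i j p : P := 'X_i * p^`M(j) - 'X_j * p^`M(i).

Definition normsq : P := \sum_i 'X_i ^+ 2.

Lemma mderivXU i j : ('X_j : P)^`M(i) = (i == j)%:R.
Proof.
rewrite mderivX mnm1E eq_sym; case: eqP => [->|_]; last by rewrite scale0r.
by rewrite scale1r -mpolyX0; congr mpolyX; apply/mnmP => k; rewrite mnmBE subnn mnm0E.
Qed.

Lemma mderiv_sum (I : Type) (r : seq I) (Q : pred I) (F : I -> P) i :
  (\sum_(k <- r | Q k) F k)^`M(i) = \sum_(k <- r | Q k) (F k)^`M(i).
Proof. exact: raddf_sum. Qed.

Lemma angularM i j p q : angular i j (p * q) = angular i j p * q + p * angular i j q.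
Proof. rewrite /angular !mderivM; ring. Qed.

Lemma angularZ i j c p : angular i j (c *: p) = c *: angular i j p.
Proof. by rewrite /angular !mderivZ -!scalerAr scalerBr. Qed.

Lemma angularD i j p q : angular i j (p + q) = angular i j p + angular i j q.
Proof. rewrite /angular !mderivD; ring. Qed.

Lemma angular_sum (I : Type) (r : seq I) (Q : pred I) (F : I -> P) i j :
  angular i j (\sum_(k <- r | Q k) F k) = \sum_(k <- r | Q k) angular i j (F k).
Proof. by rewrite /angular !mderiv_sum !mulr_sumr -sumrB. Qed.

Lemma laplacianD p q : laplacian (p + q) = laplacian p + laplacian q.
Proof. by rewrite /laplacian -big_split; apply: eq_bigr => i _; rewrite !mderivD. Qed.

Lemma laplacianZ c p : laplacian (c *: p) = c *: laplacian p.
Proof.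
by rewrite /laplacian scaler_sumr; apply: eq_bigr => i _; rewrite !mderivZ.
Qed.

Lemma laplacian0 : laplacian (0 : P) = 0.
Proof. by rewrite -[X in laplacian X](scale0r 0) laplacianZ scale0r. Qed.

Lemma laplacianB p q : laplacian (p - q) = laplacian p - laplacian q.
Proof. by rewrite -scaleN1r laplacianD laplacianZ scaleN1r. Qed.

Lemma laplacian_sum (I : Type) (r : seq I) (Q : pred I) (F : I -> P) :
  laplacian (\sum_(k <- r | Q k) F k) = \sum_(k <- r | Q k) laplacian (F k).
Proof. exact: (big_morph _ laplacianD laplacian0). Qed.

Lemma laplacianM p q : laplacian (p * q) =
  laplacian p * q + \sum_i p^`M(i) * q^`M(i) *+ 2 + p * laplacian q.
Proof.
rewrite /laplacian mulr_suml mulr_sumr -!big_split /=; apply: eq_bigr => i _.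
rewrite !mderivM !mderivD !mderivM; ring.
Qed.

Lemma laplacian_deriv i p : laplacian p^`M(i) = (laplacian p)^`M(i).
Proof.
rewrite /laplacian mderiv_sum; apply: eq_bigr => j _.
by rewrite (mderiv_comm i) (mderiv_comm i).
Qed.

Lemma laplacianX i : laplacian ('X_i : P) = 0.
Proof.
by rewrite /laplacian big1// => j _; rewrite mderivXU -mpolyC_nat mderivC.
Qed.

Lemma sum_pick (F : 'I_d.+1 -> P) i : \sum_j (j == i)%:R * F j = F i.
Proof.
rewrite (bigD1 i)//= eqxx mul1r big1 ?addr0// => j /negPf ->.
by rewrite mul0r.
Qed.

Lemma laplacianXM i p : laplacian ('X_i * p) = p^`M(i) *+ 2 + 'X_i * laplacian p.
Proof.
rewrite laplacianM laplacianX mul0r add0r; congr (_ + _).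
under eq_bigr do rewrite mderivXU -mulrnAr.
by rewrite sum_pick.
Qed.

(** Rotation invariance of the Laplacian: commuting it past each variable leaves twice the same
    mixed derivative, and the two copies cancel. *)
Lemma laplacian_angular i j p : laplacian (angular i j p) = angular i j (laplacian p).
Proof.
rewrite /angular laplacianB !laplacianXM !laplacian_deriv mderiv_comm; ring.
Qed.

Lemma dhomog_mderiv l p i : p \is (l.+1).-homog -> p^`M(i) \is l.-homog.
Proof.
move=> hp; apply/dhomogP => m.
rewrite mcoeff_msupp mcoeff_deriv; apply: contra_neq_eq => hm.
rewrite (dhomog_nemf_coeff hp) ?mul0rn//= mdegD mdeg1 addn1.
by rewrite eqSS.
Qed.

Lemma dhomog0_mderiv p i : p \is 0.-homog -> p^`M(i) = 0.
Proof.
move=> hp; apply/mpolyP => m; rewrite mcoeff_deriv mcoeff0.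
by rewrite (dhomog_nemf_coeff hp) ?mul0rn//= mdegD mdeg1 addn1.
Qed.

Lemma dhomogXU i : ('X_i : P) \is 1.-homog.
Proof. by rewrite dhomogX; apply/eqP/mdeg1. Qed.

Lemma dhomogXMderiv l p i j : p \is l.-homog -> 'X_i * p^`M(j) \is l.-homog.
Proof.
case: l => [|l] hp; first by rewrite dhomog0_mderiv// mulr0 dhomog0.
exact: (dhomogM (dhomogXU i) (dhomog_mderiv j hp)).
Qed.

Lemma dhomog_angular l p i j : p \is l.-homog -> angular i j p \is l.-homog.
Proof. by move=> hp; apply: rpredB; exact: dhomogXMderiv. Qed.

Lemma dhomog_laplacian l p : p \is l.-homog -> laplacian p \is (l - 2).-homog.
Proof.
move=> hp; apply: rpred_sum => i _.
case: l hp => [|[|l]] hp.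
- by rewrite !dhomog0_mderiv ?dhomog0// dhomog0.
- by rewrite (dhomog0_mderiv _ (dhomog_mderiv i hp)) dhomog0.
- by rewrite subSS subSS subn0; do 2 apply: dhomog_mderiv.
Qed.

Lemma euler l p : p \is l.-homog -> \sum_i 'X_i * p^`M(i) = l%:R *: p.
Proof.
move=> hp.
have E i : 'X_i * p^`M(i) = \sum_(m <- msupp p) (p@_m * (m i)%:R) *: 'X_[m].
  rewrite {1}(mpolyE p) mderiv_sum mulr_sumr; apply: eq_bigr => m _.
  rewrite mderivZ mderivX -!scalerAr scalerA.
  (* If X_i does not divide the monomial, the truncated subtraction of exponents cannot be undone,
     but then the coefficient [m i] is 0. *)
  have [->|mi] := eqVneq (m i) 0%N; first by rewrite mulr0 !scale0r.
  rewrite -mpolyXD; congr (_ *: 'X_[_]).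
  by rewrite addmC submK// lep1mP.
under eq_bigr => i _ do rewrite E.
rewrite exchange_big/= [in RHS](mpolyE p) scaler_sumr big_seq [RHS]big_seq.
apply: eq_bigr => m hm.
by rewrite -scaler_suml -mulr_sumr -natr_sum -mdegE (dhomog_mf hp hm) scalerA mulrC.
Qed.

Lemma normsq_homog : normsq \is 2.-homog.
Proof. by apply: rpred_sum => i _; rewrite -[2%N]mul1n dhomogMn// dhomogXU. Qed.

Lemma mderiv_normsq i : normsq^`M(i) = 'X_i *+ 2.
Proof.
rewrite /normsq mderiv_sum.
have E j : ('X_j ^+ 2 : P)^`M(i) = (j == i)%:R * ('X_j *+ 2).
  by rewrite expr2 mderivM mderivXU (eq_sym i); ring.
by under eq_bigr => j _ do rewrite E; rewrite sum_pick.
Qed.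

Lemma laplacian_normsq : laplacian normsq = (2 * d.+1)%:R.
Proof.
rewrite /laplacian; under eq_bigr => i _ do
  rewrite mderiv_normsq mderivMn mderivXU eqxx.
by rewrite sumr_const card_ord -mulrnA.
Qed.

Lemma laplacian_normsqM l p : p \is l.-homog ->
  laplacian (normsq * p) = (2 * d.+1 + 4 * l)%:R *: p + normsq * laplacian p.
Proof.
move=> hp; rewrite laplacianM laplacian_normsq mulr_natl.
under eq_bigr => i _ do rewrite mderiv_normsq mulrnAl -mulrnA.
by rewrite sumrMnl (euler hp) -!scaler_nat scalerA -scalerDl -natrM -natrD.
Qed.

Lemma angular_angular i j p : angular i j (angular i j p) =
  'X_i ^+ 2 * p^`M(j)^`M(j) + 'X_j ^+ 2 * p^`M(i)^`M(i)
  - 'X_i * 'X_j * p^`M(i)^`M(j) *+ 2 - 'X_i * p^`M(i) - 'X_j * p^`M(j)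
  + (j == i)%:R * ('X_i * p^`M(i) *+ 2).
Proof.
rewrite /angular !mderivB !mderivM !mderivXU !eqxx (mderiv_comm i j) (eq_sym j).
by rewrite (eq_sym i j); have [->|_] := eqVneq j i; rewrite ?mulr1n ?mulr0n; ring.
Qed.

(** Squared total angular momentum. Expanding the squares leaves the Euler operator and its
    second-order analogue, both scalar on forms of degree l. The factor 2 arises because the sum
    runs over ordered pairs, so each plane counts twice. *)
Lemma casimir l p : p \is l.-homog -> laplacian p = 0 ->
  \sum_i \sum_j angular i j (angular i j p) = - (2 * l * (l + d - 1))%:R *: p.
Proof.
move=> hp lp.
(* The Euler operator applied twice, minus itself: l^2 - l. *)
have E2 : \sum_i \sum_j 'X_i * 'X_j * p^`M(i)^`M(j) = (l * (l - 1))%:R *: p.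
  rewrite exchange_big /=.
  transitivity (\sum_j 'X_j * (\sum_i 'X_i * p^`M(i))^`M(j)
                - \sum_j 'X_j * p^`M(j)); last first.
    rewrite (euler hp); under eq_bigr do rewrite mderivZ -scalerAr.
    rewrite -scaler_sumr (euler hp) scalerA -scalerBl; congr (_ *: _).
    case: l {hp} => [|l]; first by rewrite mul0n mul0r subr0.
    by rewrite subn1/= natrM -natr1; ring.
  rewrite -sumrB; apply: eq_bigr => j _.
  rewrite mderiv_sum mulr_sumr.
  rewrite -[X in _ - X](sum_pick (fun i => 'X_i * p^`M(i)) j) -sumrB.
  apply: eq_bigr => i _; rewrite mderivM mderivXU (eq_sym j) mderiv_comm.
  by have [->|_] := eqVneq i j; rewrite ?mulr1n ?mulr0n; ring.
under eq_bigr => i _ do under eq_bigr => j _ do rewrite angular_angular.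
under eq_bigr => i _ do rewrite !big_split/= !sumrN (sum_pick (fun=> _))
   sumrMnl -mulr_sumr -/(laplacian p) lp mulr0 add0r -mulr_suml (euler hp)
   sumr_const card_ord.
rewrite !big_split/= !sumrN sumrMnl E2 -mulr_sumr -/(laplacian p) lp mulr0 add0r.
rewrite !sumrMnl (euler hp) sumr_const card_ord.
rewrite -!scaler_nat !scalerA -!scaleNr -!scalerDl; congr (_ *: _).
case: l {hp E2} => [|l]; first by ring.
rewrite addSn !subn1/= !natrM -!natr1 natrD; ring.
Qed.

Definition solid_harmonic l p := p \is l.-homog /\ laplacian p = 0.

Lemma normsqX_homog (j : nat) : normsq ^+ j \is (2 * j).-homog.
Proof. exact: dhomogMn normsq_homog. Qed.

Lemma laplacian_normsqXM l (j : nat) p : solid_harmonic l p ->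
  laplacian (normsq ^+ j.+1 * p) =
  (2 * j.+1 * (d.+1 + 2 * l + 2 * j))%:R *: (normsq ^+ j * p).
Proof.
move=> [hp lp]; elim: j => [|j IH].
  rewrite expr0 mul1r expr1 (laplacian_normsqM hp) lp mulr0 addr0.
  by congr (_%:R *: _); lia.
rewrite exprS -mulrA (laplacian_normsqM (dhomogM (normsqX_homog j.+1) hp)) IH.
rewrite -scalerAr mulrA -exprS -scalerDl -natrD; congr (_%:R *: _).
nia.
Qed.

Lemma iter_laplacianD J p q :
  iter J (@laplacian R d) (p + q) = iter J (@laplacian R d) p + iter J (@laplacian R d) q.
Proof. by elim: J => //= J ->; rewrite laplacianD. Qed.

Lemma iter_laplacianZ J c p :
  iter J (@laplacian R d) (c *: p) = c *: iter J (@laplacian R d) p.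
Proof. by elim: J => //= J ->; rewrite laplacianZ. Qed.

(** Each Laplacian removes one factor [normsq] and leaves a positive constant. That c is nonzero is
    what lets [harmonic_decomposition] solve for its top component. *)
Lemma iter_laplacian_normsqXM l J p : solid_harmonic l p ->
  exists2 c, c != 0 & iter J (@laplacian R d) (normsq ^+ J * p) = c *: p.
Proof.
move=> hp; elim: J => [|J [c c0 IH]]; first by exists 1; rewrite ?oner_neq0// mul1r scale1r.
exists ((2 * J.+1 * (d.+1 + 2 * l + 2 * J))%:R * c).
  by rewrite mulf_neq0// pnatr_eq0; lia.
by rewrite iterSr (laplacian_normsqXM _ hp) iter_laplacianZ IH scalerA.
Qed.

Lemma dhomog_iter_laplacian l J p : p \is l.-homog ->
  iter J (@laplacian R d) p \is (l - 2 * J).-homog.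
Proof.
move=> hp; elim: J => [|J IH]; first by rewrite subn0.
by rewrite mulnS addnC subnDA; apply: dhomog_laplacian.
Qed.

Lemma laplacian_low l p : p \is l.-homog -> (l < 2)%N -> laplacian p = 0.
Proof.
case: l => [|[|//]] hp _; rewrite /laplacian big1// => i _.
  by rewrite !dhomog0_mderiv ?dhomog0.
by rewrite (dhomog0_mderiv _ (dhomog_mderiv i hp)).
Qed.

Lemma iter_laplacian_low l J p : p \is l.-homog -> (l < 2 * J)%N ->
  iter J (@laplacian R d) p = 0.
Proof.
elim: J l p => [|J IH] l p hp; first by lia.
have [l2 _|l2 lJ] := ltnP l 2.
  rewrite iterSr (laplacian_low hp l2).
  by elim: J {IH} => //= J ->; exact: laplacian0.
rewrite iterSr (IH (l - 2)%N)//; first exact: dhomog_laplacian.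
lia.
Qed.

(** Induction on J: the J-fold Laplacian q of p is harmonic, and a multiple of [normsq ^+ J * q] has
    the same J-fold Laplacian as p; the difference is killed one step earlier. *)
Lemma harmonic_decomposition J l p : p \is l.-homog ->
  iter J (@laplacian R d) p = 0 ->
  exists h : nat -> P, (forall j : nat, solid_harmonic (l - 2 * j) (h j)) /\
    p = \sum_(j < J) normsq ^+ j * h j.
Proof.
elim: J p => [|J IH] p hp.
  move=> /= p0; exists (fun=> 0); split; last by rewrite big_ord0.
  by move=> j; split; [exact: dhomog0|exact: laplacian0].
move=> hJ.
(* When [l - 2 * J] would be truncated, J Laplacians already annihilate p and the top component is
   0. *)
have [lJ|Jl] := ltnP l (2 * J).
  have [h [hh pE]] := IH p hp (iter_laplacian_low hp lJ).
  exists (fun j : nat => if j == J then 0 else h j); split.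
    move=> j; case: ifP => // _.
    by split; [exact: dhomog0|exact: laplacian0].
  rewrite big_ord_recr/= eqxx mulr0 addr0 {1}pE; apply: eq_bigr => j _.
  by rewrite ltn_eqF.
have hq : solid_harmonic (l - 2 * J) (iter J (@laplacian R d) p).
  by split; [exact: dhomog_iter_laplacian|].
set q := iter J _ p in hq *.
have [c c0 cE] := iter_laplacian_normsqXM J hq.
pose r := p - normsq ^+ J * (c^-1 *: q).
have hr : r \is l.-homog.
  have := dhomogM (normsqX_homog J) (dhomogZ c^-1 hq.1).
  by rewrite subnKC//; exact: rpredB.
have /(IH r hr)[h [hh rE]] : iter J (@laplacian R d) r = 0.
  rewrite /r -scaleN1r iter_laplacianD iter_laplacianZ -scalerAr iter_laplacianZ cE.
  by rewrite -/q [X in -1 *: X]scalerA mulVf// scale1r scaleN1r subrr.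
exists (fun j : nat => if j == J then c^-1 *: q else h j); split.
  move=> j; case: eqP => // ->.
  by split; [apply: rpredZ; exact: hq.1|rewrite laplacianZ hq.2 scaler0].
rewrite big_ord_recr/= eqxx -[p in LHS](subrK (normsq ^+ J * (c^-1 *: q))) -/r.
congr (_ + _); rewrite {1}rE; apply: eq_bigr => j _.
by rewrite ltn_eqF.
Qed.

(** Read at a single monomial, the equation expresses a coefficient with exponent at least 2 in the
    first variable through coefficients whose exponent there is smaller by 2. *)
Lemma harmonic_eq0 p : laplacian p = 0 ->
  (forall m : 'X_{1..d.+1}, (m ord0 <= 1)%N -> p@_m = 0) -> p = 0.
Proof.
move=> lp p1; apply/mpolyP => m; rewrite mcoeff0.
have [k] := ubnP (m ord0); elim: k m => // k IH m mk.
have [m1|m1] := leqP (m ord0) 1; first exact: p1.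
pose m' := (m - (U_(ord0) + U_(ord0)))%MM.
have mE : m = (m' + U_(ord0) + U_(ord0))%MM.
  apply/mnmP => i; rewrite !mnmDE !mnmBE !mnmDE !mnm1E.
  by case: eqP => [<-|_]; lia.
have := congr1 (mcoeff m') lp; rewrite mcoeff0 /laplacian raddf_sum/=.
under eq_bigr => i _ do rewrite !mcoeff_deriv.
rewrite (bigD1 ord0)//= big1 ?addr0 => [|i i0]; last first.
  rewrite IH ?mul0rn// !mnmDE !mnmBE !mnmDE !mnm1E (negPf i0) eqxx.
  lia.
rewrite -mE -mulrnA => /eqP; rewrite mulrn_eq0 muln_eq0/=.
by move=> /eqP.
Qed.

Definition ray (u v : 'I_d.+1 -> R) p : {poly R} :=
  mmap polyC (fun i => (u i)%:P + (v i - u i) *: 'X) p.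

Lemma horner_ray u v p t :
  (ray u v p).[t] = p.@[fun i => u i + (v i - u i) * t].
Proof.
rewrite /ray /mmap mevalE horner_sum; apply: eq_bigr => m _.
rewrite hornerM hornerC /mmap1 horner_prod; congr (_ * _).
by apply: eq_bigr => i _; rewrite !hornerE.
Qed.

Lemma rayM u v p q : ray u v (p * q) = ray u v p * ray u v q.
Proof. exact: rmorphM. Qed.

Lemma rayD u v p q : ray u v (p + q) = ray u v p + ray u v q.
Proof. exact: raddfD. Qed.

Lemma ray_sum (I : Type) (r : seq I) (Q : pred I) (F : I -> P) u v :
  ray u v (\sum_(k <- r | Q k) F k) = \sum_(k <- r | Q k) ray u v (F k).
Proof. exact: raddf_sum. Qed.

Lemma rayZ u v c p : ray u v (c *: p) = c *: ray u v p.
Proof. by rewrite -mul_mpolyC rayM [X in X * _]mmapC mul_polyC. Qed.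

(** Chain rule: the polynomials obeying it contain constants and variables and are closed under sums
    and products. *)
Lemma deriv_ray u v p :
  (ray u v p)^`() = \sum_i (v i - u i) *: ray u v p^`M(i).
Proof.
pose S p := (ray u v p)^`() = \sum_i (v i - u i) *: ray u v p^`M(i).
have SM p1 p2 : S p1 -> S p2 -> S (p1 * p2).
  rewrite /S => h1 h2; rewrite rayM derivM h1 h2 mulr_suml mulr_sumr -big_split/=.
  by apply: eq_bigr => i _; rewrite mderivM /ray raddfD/= !rmorphM/= scalerDr scalerAl scalerAr.
have SD p1 p2 : S p1 -> S p2 -> S (p1 + p2).
  rewrite /S => h1 h2; rewrite /ray raddfD/= derivD -!/(ray _ _ _) h1 h2 -big_split/=.
  by apply: eq_bigr => i _; rewrite mderivD /ray raddfD/= scalerDr.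
have SC c : S c%:MP.
  rewrite /S /ray mmapC derivC big1// => i _.
  by rewrite mderivC raddf0 scaler0.
have SX i : S 'X_i.
  rewrite /S /ray mmapX mmap1U derivD derivC add0r derivZ derivX.
  rewrite (bigD1 i)//= big1 ?addr0 => [|j ji].
    by rewrite mderivXU eqxx rmorph1.
  by rewrite mderivXU (negPf ji) rmorph0 scaler0.
have S0 : S 0 by have := SC 0; rewrite mpolyC0.
have S1 : S 1 by have := SC 1; rewrite mpolyC1.
rewrite -/(S p) (mpolyE p); apply: (big_ind S) => // m _.
rewrite -mul_mpolyC; apply: (SM _ _ (SC _)).
rewrite mpolyXE_id; apply: (big_ind S); [exact: S1|exact: SM|move=> i _].
by elim: (m i) => [|k IH]; rewrite ?expr0// exprS; exact: SM.
Qed.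

Lemma poly_eval_eq0 (p : {poly R}) : (forall t, p.[t] = 0) -> p = 0.
Proof.
move=> p0; apply: (@roots_geq_poly_eq0 _ p [seq k%:R | k <- iota 0 (size p)]).
- by apply/allP => t _; apply/eqP.
- rewrite map_inj_uniq ?iota_uniq//.
  by move=> m n /eqP; rewrite eqr_nat => /eqP.
- by rewrite size_map size_iota.
Qed.

(* The equation [q e' = l q' e] with [q(0) <> 0] determines [e] up to a factor,
   coefficient by coefficient; [q ^+ l] is a solution. *)
Lemma proportional_of_deriv (k q : {poly R}) (l : nat) : q.[0] = 1 ->
  q * k^`() = l%:R *: (q^`() * k) -> k = k.[0] *: q ^+ l.
Proof.
move=> q0 ode; apply/eqP; rewrite -subr_eq0; apply/eqP.
set e := (k - _).
have qX : q * (q ^+ l)^`() = l%:R *: (q^`() * q ^+ l).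
  case: l {ode e} => [|l]; first by rewrite expr0 derivC mulr0 scale0r.
  by rewrite deriv_exp/= -scaler_nat -scalerAr; congr (_ *: _); rewrite mulrCA -exprS.
have eode : q * e^`() = l%:R *: (q^`() * e).
  rewrite /e derivB derivZ mulrBr -scalerAr ode qX mulrBr.
  by rewrite [RHS]scalerBr; congr (_ - _); rewrite -!scalerAr !scalerA mulrC.
have e0 : e`_0 = 0.
  by rewrite -horner_coef0 /e hornerD hornerN hornerZ horner_exp q0 expr1n mulr1 subrr.
apply/polyP => n; rewrite coef0.
have [N] := ubnP n; elim: N n => // N IH [|n] nN; first exact: e0.
have /(congr1 (fun r : {poly R} => r`_n)) := eode.
rewrite coefM coefZ coefM big_ord_recl/= subn0 big1 ?addr0 => [|i _]; last first.
  have lt_in := ltn_ord i.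
  by rewrite coef_deriv IH ?mul0rn ?mulr0//= /bump/=; lia.
rewrite big1 ?mulr0 => [|i _]; last first.
  by have lt_in := ltn_ord i; rewrite IH ?mulr0//; lia.
rewrite -horner_coef0 q0 mul1r coef_deriv => /eqP.
by rewrite mulrn_eq0 => /eqP.
Qed.

(** By Euler's identity, vanishing rotations give [normsq] times the i-th derivative of p as 2 l X_i
    p. On the line through u and v this becomes q k' = l q' k, with q and k the restrictions of
    [normsq] and p, so k = k(0) q^l. Solving it among polynomials avoids dividing by q, which
    vanishes on the line when v = -u. *)
Lemma homog_angular_invariant l p (u v : 'I_d.+1 -> R) : p \is (2 * l).-homog ->
  (forall i j w, (angular i j p).@[w] = 0) ->
  normsq.@[u] = 1 -> normsq.@[v] = 1 -> p.@[u] = p.@[v].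
Proof.
move=> hp rp u1 v1.
have at0 r : (ray u v r).[0] = r.@[u].
  by rewrite horner_ray; apply: meval_eq => i; rewrite mulr0 addr0.
have at1 r : (ray u v r).[1] = r.@[v].
  by rewrite horner_ray; apply: meval_eq => i; rewrite mulr1 addrC subrK.
have E i : normsq * p^`M(i) = (2 * l)%:R *: ('X_i * p) + \sum_j 'X_j * angular j i p.
  rewrite scalerAr -(euler hp) mulr_suml mulr_sumr -big_split/=.
  by apply: eq_bigr => j _; rewrite /angular; ring.
have r0 i j : ray u v (angular i j p) = 0.
  by apply: poly_eval_eq0 => t; rewrite horner_ray.
have ode : ray u v normsq * (ray u v p)^`() =
    l%:R *: ((ray u v normsq)^`() * ray u v p).
  rewrite !deriv_ray mulr_sumr mulr_suml scaler_sumr; apply: eq_bigr => i _.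
  rewrite -!scalerAr -rayM E mderiv_normsq rayD ray_sum.
  rewrite big1 ?addr0 => [|j _]; last by rewrite rayM r0 mulr0.
  rewrite -[_ *+ 2]scaler_nat !rayZ rayM -!scalerAl !scalerA; congr (_ *: _).
  by rewrite natrM; ring.
have := proportional_of_deriv _ ode.
rewrite at0 u1 => /(_ erefl) /(congr1 (fun r : {poly R} => r.[1])).
by rewrite hornerZ horner_exp !at1 at0 v1 expr1n mulr1.
Qed.

(* By [harmonic_eq0] a harmonic form is determined by its coefficients on the
   monomials of degree at most 1 in the first variable, and these monomials are
   given by that degree and d - 1 further exponents. *)
Lemma harmonic_dependent l K (Q : 'I_K -> P) : (0 < d)%N ->
  (forall k, solid_harmonic l (Q k)) -> (2 * l.+1 ^ d.-1 < K)%N ->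
  exists2 c : 'I_K -> R, (exists k, c k != 0) & \sum_k c k *: Q k = 0.
Proof.
move=> d0 hQ ltK.
pose I : finType := (bool * d.-1.-tuple 'I_l.+1)%type.
pose mon (bg : I) : 'X_{1..d.+1} := [multinom
  nth 0%N ((bg.1 : nat) :: rcons (map val bg.2) (l - bg.1 - sumn (map val bg.2))) i
  | i < d.+1].
have monP (m : 'X_{1..d.+1}) : mdeg m = l -> (m ord0 <= 1)%N -> exists bg, mon bg = m.
  move=> ml m1.
  pose g : d.-1.-tuple 'I_l.+1 := [tuple inord (m (inord j.+1)) | j < d.-1].
  have gE (j : nat) : (j < d.-1)%N -> nth 0%N (map val g) j = m (inord j.+1).
    move=> jd; rewrite (nth_map ord0) ?size_tuple//.
    have -> : nth ord0 g j = tnth g (Ordinal jd) by rewrite (tnth_nth ord0).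
    rewrite tnth_mktuple /= inordK// ltnS -ml mdegE (bigD1 (inord j.+1))//=.
    exact: leq_addr.
  have sg : (m ord0 + sumn (map val g) + m ord_max)%N = l.
    have -> : sumn (map val g) = \sum_(0 <= b < d.-1) m (inord b.+1).
      rewrite sumnE (big_nth 0%N) size_map size_tuple.
      by rewrite big_nat [RHS]big_nat; apply: eq_bigr => j /andP[_ jd]; exact: gE.
    transitivity (\sum_(0 <= b < d.+1) m (inord b)); last first.
      by rewrite -[RHS]ml mdegE big_mkord; apply: eq_bigr => j _; rewrite inord_val.
    rewrite (sum_nat_ends (fun b => m (inord b)) d0); congr (_ + _ + _)%N; congr (m _).
      by apply/val_inj; rewrite /= inordK.
    by apply/val_inj; rewrite /= inordK.
  clearbody g; exists (m ord0 == 1%N, g); apply/mnmP => i; rewrite mnmE.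
  have mb : (m ord0 == 1%N) = m ord0 :> nat by case: (m ord0) m1 => [|[]].
  case: (posnP (nat_of_ord i)) => [i0|i0].
    rewrite i0/= mb; congr (m _); exact/val_inj.
  rewrite -(prednK i0)/= nth_rcons size_map size_tuple.
  have := ltn_ord i; rewrite ltnS leq_eqVlt => /predU1P[id|id].
    rewrite id ltnn eqxx mb.
    have -> : i = ord_max by apply/val_inj.
    by move: sg; set a := sumn _; lia.
  have -> : (i.-1 < d.-1)%N by lia.
  rewrite gE; last by lia.
  by congr (m _); apply/val_inj; rewrite /= prednK// inordK// ltnS ltnW.
pose A : 'M[R]_(K, #|I|) := \matrix_(k, a) (Q k)@_(mon (enum_val a)).
have : kermx A != 0.
  rewrite -mxrank_eq0 mxrank_ker subn_eq0 -ltnNge.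
  apply: leq_ltn_trans (rank_leq_col A) _.
  by rewrite card_prod card_bool card_tuple card_ord.
move=> /rowV0Pn[c /sub_kermxP cA c0].
exists (fun k => c ord0 k).
  apply/existsP; apply: contraR c0; rewrite negb_exists => /forallP c0.
  by apply/eqP/rowP => k; rewrite mxE; apply/eqP; rewrite -[_ == _]negbK.
apply: harmonic_eq0.
  rewrite laplacian_sum big1// => k _.
  by rewrite laplacianZ (hQ k).2 scaler0.
move=> m m1; rewrite raddf_sum/=.
have [ml|ml] := eqVneq (mdeg m) l; last first.
  by rewrite big1// => k _; rewrite mcoeffZ (dhomog_nemf_coeff (hQ k).1 ml) mulr0.
have [bg <-] := monP m ml m1.
have /rowP/(_ (enum_rank bg)) := cA; rewrite !mxE => {}cA.
rewrite -[RHS]cA; apply: eq_bigr => k _.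
by rewrite mcoeffZ mxE enum_rankK.
Qed.

End HarmonicAlgebra.

(* Only now, because the notations of mpoly, opened in the section above, clash
   with those of the analysis library. *)
From mathcomp Require Import all_classical all_reals all_analysis.
From mathcomp Require Import measurable_realfun.
Import (canonicals, coercions) mpoly.
Import numFieldNormedType.Exports.
Local Open Scope classical_set_scope.
Local Open Scope ring_scope.

(** * Gaussian integrals and the surface measure *)

(** The pushforward packaged with its measure structure, so that it can be passed wherever a measure
    is expected. *)
Definition image_measure d1 d2 (T1 : measurableType d1) (T2 : measurableType d2)
    (R : realType) (mu : {measure set T1 -> \bar R}) (f : T1 -> T2)
    (mf : measurable_fun setT f) : {measure set T2 -> \bar R} :=
  measure_function_pushforward__canonical__measure_function_Measure mu mf.

Section TupleIntegral.
Variable R : realType.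
Local Notation RR := (measurableTypeR R).
Local Notation mu := (@lebesgue_measure R).
Local Notation mun := (@lebesgue_tuple R).
Local Open Scope ereal_scope.

Lemma tnth_cons_tuple0 n (p : RR * n.-tuple RR) :
  tnth (Defs.cons_tuple p) ord0 = p.1.
Proof. by rewrite (tnth_nth p.1). Qed.

Lemma tnth_cons_tupleS n (p : RR * n.-tuple RR) i :
  tnth (Defs.cons_tuple p) (lift ord0 i) = tnth p.2 i.
Proof. by rewrite !(tnth_nth p.1). Qed.

Lemma ge0_integral_cons n (f : n.+1.-tuple RR -> \bar R) :
  measurable_fun setT f -> (forall t, 0 <= f t) ->
  \int[mun n.+1]_t f t = \int[mu]_x \int[mun n]_t f (Defs.cons_tuple (x, t)).
Proof.
move=> mf f0.
rewrite [LHS](ge0_integral_pushforward (@measurable_cons_tuple _ RR n))//.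
rewrite preimage_setT (fubini_tonelli1 (f \o @Defs.cons_tuple _ RR n))//.
  by apply: measurableT_comp => //; exact: measurable_cons_tuple.
by move=> p; exact: f0.
Qed.

Lemma integrable_cons n (f : n.+1.-tuple RR -> \bar R) :
  measurable_fun setT f ->
  (mu \x mun n).-integrable setT (f \o @Defs.cons_tuple _ RR n) ->
  (mun n.+1).-integrable setT f /\
  \int[mun n.+1]_t f t = \int[mu]_x \int[mun n]_t f (Defs.cons_tuple (x, t)).
Proof.
move=> mf fi; have mc := @measurable_cons_tuple _ RR n.
split; first exact: (integrable_pushforward mc).
rewrite [LHS](integral_pushforward mc)//.
by rewrite preimage_setT -(integral12_prod_meas1 fi).
Qed.

(** Lebesgue measure is c times its image under multiplication by c, since the two agree on
    half-open intervals. *)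
Lemma ge0_integral_scale (c : R) (f : RR -> \bar R) : (0 < c)%R ->
  measurable_fun setT f -> (forall t, 0 <= f t) ->
  \int[mu]_x f (c * x)%R = (c^-1)%:E * \int[mu]_x f x.
Proof.
move=> c0 mf f0.
have mc : measurable_fun [set: RR] (fun x : RR => (c * x)%R : RR).
  exact: measurable_funM.
pose nu := mscale (NngNum (ltW c0)) (image_measure mu mc).
have muE : forall A, measurable A -> mu A = nu A.
  apply: lebesgue_measure_unique => _ [[a b]] _ <-.
  transitivity (c%:E * mu `](c^-1 * a)%R, (c^-1 * b)%R]%classic); last first.
    congr (_ * mu _); apply/seteqP; split => x; rewrite /= !in_itv/=;
      by rewrite ltr_pdivrMl// ler_pdivlMl.
  rewrite !lebesgue_measure_itv/= !lte_fin ltr_pM2l ?invr_gt0//.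
  case: ifP => _; last by rewrite mule0.
  by rewrite -EFinD -EFinM -mulrBr mulrA divff ?mul1r// gt_eqF.
have -> : \int[mu]_x f x = \int[nu]_x f x.
  by apply: eq_measure_integral => A mA _; exact: muE.
rewrite ge0_integral_mscale// ge0_integral_pushforward// preimage_setT muleA -EFinM/=.
by rewrite mulVf ?mul1e// gt_eqF.
Qed.

Definition scale_tuple n (c : R) (t : n.-tuple RR) : n.-tuple RR :=
  [tuple (c * tnth t i)%R | i < n].

Lemma measurable_scale_tuple n c : measurable_fun setT (@scale_tuple n c).
Proof.
apply/measurable_fun_tnthP => i.
rewrite (_ : _ \o _ = (fun t => c * tnth t i)%R); last first.
  by apply/funext => t /=; rewrite tnth_mktuple.
by apply: measurable_funM => //; exact: measurable_tnth.
Qed.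

Lemma ge0_integral_scale_tuple n (c : R) (f : n.-tuple RR -> \bar R) : (0 < c)%R ->
  measurable_fun setT f -> (forall t, 0 <= f t) ->
  \int[mun n]_t f (scale_tuple c t) = (c ^- n)%:E * \int[mun n]_t f t.
Proof.
move=> c0; elim: n f => [|n IH] f mf f0.
  rewrite expr0 invr1 mul1e; apply: eq_integral => t _; congr f.
  by rewrite [LHS]tuple0 [RHS]tuple0.
have mfs : measurable_fun setT (f \o @scale_tuple n.+1 c).
  by apply: measurableT_comp => //; exact: measurable_scale_tuple.
have sE (x : RR) (t : n.-tuple RR) : scale_tuple c (Defs.cons_tuple (x, t)) =
    Defs.cons_tuple ((c * x)%R : RR, scale_tuple c t).
  apply/eq_from_tnth => i; rewrite tnth_mktuple.
  case: (unliftP ord0 i) => [j|] ->; last by rewrite !tnth_cons_tuple0.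
  by rewrite !tnth_cons_tupleS tnth_mktuple.
have mfx x : measurable_fun setT (fun t => f (Defs.cons_tuple (x, t))).
  by apply: measurableT_comp => //; apply: measurable_cons => //; exact: measurable_id.
transitivity (\int[mu]_x \int[mun n]_t f (Defs.cons_tuple ((c * x)%R, scale_tuple c t))).
  rewrite (ge0_integral_cons mfs)//; last by move=> t; exact: f0.
  by apply: eq_integral => x _; apply: eq_integral => t _; rewrite /= sE.
have mF : measurable_fun setT (fun x => \int[mun n]_t f (Defs.cons_tuple (x, t))).
  apply: (measurable_fun_fubini_tonelli_F (m2 := mun n) (f \o @Defs.cons_tuple _ RR n)).
    by apply: measurableT_comp => //; exact: measurable_cons_tuple.
  by move=> p; exact: f0.
under eq_integral => x _ do rewrite (IH _ (mfx _) (fun t => f0 _)).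
rewrite ge0_integralZl//; last 3 first.
  have mcs : measurable_fun setT (fun x : RR => (c * x)%R : RR) by exact: measurable_funM.
  exact: (measurableT_comp mF mcs).
  by move=> x _; exact: integral_ge0.
  by rewrite lee_fin invr_ge0 exprn_ge0// ltW.
rewrite (ge0_integral_scale c0 mF); last by move=> x; exact: integral_ge0.
rewrite muleA -EFinM -invfM -exprSr.
by congr (_ * _); rewrite -ge0_integral_cons.
Qed.

End TupleIntegral.

(** * One-dimensional Gaussian moments *)

Section GaussMoments.
Variable R : realType.
Local Notation RR := (measurableTypeR R).
Local Notation mu := (@lebesgue_measure R).

Definition gauss_mono k (x : R) : R := x ^+ k * gauss_fun x.

Lemma measurable_gauss_mono k : measurable_fun [set: RR] (gauss_mono k : RR -> R).
Proof.
apply: measurable_funM; last exact: measurable_gauss_fun.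
exact: exprn_measurable.
Qed.

Lemma continuous_gauss_mono k : continuous (gauss_mono k).
Proof.
by move=> x; apply: cvgM; [exact: exprn_continuous|exact: continuous_gauss_fun].
Qed.

(** Half of the Gaussian exponent absorbs the power, leaving the other half as an integrable
    majorant. For |x| > 1 the constant comes from the k-th term of the series of exp(x^2/2), as
    |x|^k <= x^(2k); the added 1 covers |x| <= 1. *)
Lemma gauss_decay k (x : R) : `|x| ^+ k * expR (- (x ^+ 2 / 2)) <= 2 ^+ k * k`!%:R + 1.
Proof.
have h0 : 0 <= x ^+ 2 / 2 by rewrite divr_ge0// sqr_ge0.
have e1 : expR (- (x ^+ 2 / 2)) <= 1 by rewrite -[leRHS]expR0 ler_expR oppr_le0.
have [x1|x1] := leP `|x| 1.
  apply: (@le_trans _ _ 1); last by rewrite lerDr mulr_ge0// exprn_ge0.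
  by rewrite mulr_ile1 ?expR_ge0// ?exprn_ge0// exprn_ile1.
apply: (@le_trans _ _ (2 ^+ k * k`!%:R)); last by rewrite lerDl ler01.
rewrite expRN ler_pdivrMr ?expR_gt0//.
apply: (@le_trans _ _ (2 ^+ k * k`!%:R * ((x ^+ 2 / 2) ^+ k / k`!%:R))).
  have -> : 2 ^+ k * k`!%:R * ((x ^+ 2 / 2) ^+ k / k`!%:R) = (x ^+ 2) ^+ k :> R.
    rewrite -mulrA [k`!%:R * _]mulrC divfK ?pnatr_eq0 -?lt0n ?fact_gt0//.
    by rewrite -exprMn mulrC divfK ?pnatr_eq0.
  rewrite -real_normK ?num_real// -exprM mulnC exprM.
  by rewrite ler_eXnr// exprn_ege1// ltW.
rewrite ler_pM2l; last by rewrite mulr_gt0 ?exprn_gt0// ltr0n fact_gt0.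
case: k => [|k]; first by rewrite expr0 fact0 divr1 -[leLHS]expR0 ler_expR.
by apply: le_trans (expR_ge1Dxn k h0); rewrite lerDr.
Qed.

Lemma gauss_fun_sqr (x : R) : gauss_fun x = expR (- (x ^+ 2 / 2)) * expR (- (x ^+ 2 / 2)).
Proof. by rewrite -expRD /gauss_fun -opprD -splitr. Qed.

Lemma integrable_gauss_mono k : mu.-integrable [set: RR] (EFin \o gauss_mono k).
Proof.
pose C : R := 2 ^+ k * k`!%:R + 1.
have h : mu.-integrable [set: RR] (fun x => (C * expR (- (x ^+ 2 / 2)))%:E).
  have p0 : normal_peak 1 != 0 :> R by rewrite gt_eqF// normal_peak_gt0// oner_neq0.
  rewrite (_ : (fun _ => _) =
      fun x => ((C / normal_peak 1)%:E * (normal_pdf 0 1 x)%:E)%E).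
    by apply: integrableZl => //; exact: integrable_normal_pdf.
  apply/funext => x; rewrite -EFinM normal_pdfE ?oner_neq0// /normal_fun.
  by rewrite mulrA divfK// subr0 expr1n mulNr.
apply: le_integrable h => //; first by apply/measurable_EFinP; exact: measurable_gauss_mono.
move=> x _; rewrite lee_fin /gauss_mono normrM normrX gauss_fun_sqr.
rewrite (ger0_norm (mulr_ge0 (expR_ge0 _) (expR_ge0 _))) mulrA.
rewrite [leRHS]ger0_norm; last first.
  by rewrite mulr_ge0 ?expR_ge0// addr_ge0// mulr_ge0// exprn_ge0.
by rewrite ler_wpM2r ?expR_ge0// gauss_decay.
Qed.

(** Makes the boundary terms vanish in [Rintegral_gauss_mono_deriv]. *)
Lemma gauss_mono_small k (x : R) : 1 <= `|x| ->
  `|gauss_mono k x| <= (2 ^+ k.+1 * k.+1`!%:R + 1) / `|x|.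
Proof.
move=> x1; have x0 : 0 < `|x| by exact: lt_le_trans x1.
rewrite ler_pdivlMr// /gauss_mono normrM normrX mulrAC -exprSr.
apply: le_trans (gauss_decay k.+1 x); rewrite ler_wpM2l ?exprn_ge0//.
rewrite ger0_norm ?expR_ge0// ler_expR lerN2 ler_pdivrMr// ler_peMr ?sqr_ge0//.
by rewrite ler1n.
Qed.

Lemma is_derive_gauss_fun (x : R) : is_derive x 1 (@gauss_fun R) (- (2 * x) * gauss_fun x).
Proof.
have dsq : is_derive x 1 (fun y : R => - y ^+ 2) (- (2 * x)).
  have := is_deriveN (is_deriveX 2 (is_derive_id x (1 : R))).
  by rewrite expr1 /GRing.scale/= mulr1.
have d1 : derivable (fun y : R => - y ^+ 2) x 1 by [].
have d2 : derivable (@expR R) (- x ^+ 2) 1 by [].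
have -> : @gauss_fun R = expR \o (fun y : R => - y ^+ 2) by [].
split.
  apply/derivable1_diffP; apply: differentiable_comp; exact/derivable1_diffP.
rewrite -derive1E derive1_comp// !derive1E !derive_val.
by rewrite mulrC.
Qed.

Lemma is_derive_gauss_mono k (x : R) :
  is_derive x 1 (gauss_mono k) (k%:R * gauss_mono k.-1 x - 2 * gauss_mono k.+1 x).
Proof.
have dX := is_deriveX k (is_derive_id x (1 : R)).
rewrite (_ : gauss_mono k = (id ^+ k) * @gauss_fun R); last first.
  by apply/funext => y; rewrite !fctE.
apply: (is_derive_eq (is_deriveM dX (is_derive_gauss_fun x))).
by rewrite /gauss_mono /GRing.scale/= fctE/= mulr1 exprS; ring.
Qed.

(** The integrand is the derivative of [gauss_mono k], so its integral over growing symmetric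
    intervals is a boundary term tending to 0; dominated convergence identifies the limit. At k = 0
    the truncated predecessor is multiplied by 0. *)
Lemma Rintegral_gauss_mono_deriv k :
  \int[mu]_x (k%:R * gauss_mono k.-1 x - 2 * gauss_mono k.+1 x) = 0.
Proof.
pose f x := k%:R * gauss_mono k.-1 x - 2 * gauss_mono k.+1 x.
have fi : mu.-integrable [set: RR] (EFin \o f).
  rewrite (_ : _ \o _ = fun x =>
    (k%:R%:E * (gauss_mono k.-1 x)%:E - 2%:E * (gauss_mono k.+1 x)%:E)%E)//.
  by apply: integrableB => //; apply: integrableZl => //; exact: integrable_gauss_mono.
have fc : continuous f.
  move=> x; apply: cvgB; (apply: cvgM; [exact: cvg_cst|exact: continuous_gauss_mono]).
have mf : measurable_fun [set: RR] (f : RR -> R).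
  by apply/measurable_EFinP; exact: measurable_int fi.
pose I n : interval R := `[- n.+1%:R, n.+1%:R].
have FTC n : (\int[mu]_(x in [set` I n]) (f x)%:E =
    (gauss_mono k n.+1%:R - gauss_mono k (- n.+1%:R))%:E)%E.
  rewrite EFinB; apply: continuous_FTC2 => //.
  - by rewrite gtrN.
  - exact: continuous_subspaceT.
  - split; first by move=> x _; have [] := is_derive_gauss_mono k x.
      exact/cvg_at_right_filter/continuous_gauss_mono.
    exact/cvg_at_left_filter/continuous_gauss_mono.
  - by move=> x _; rewrite derive1E; have [_ ->] := is_derive_gauss_mono k x.
pose f_ n x := ((f \_ [set` I n]) x)%:E.
have mf_ n : measurable_fun [set: RR] (f_ n : RR -> \bar R).
  apply/measurable_EFinP; apply/(measurable_restrictT _ _).1 => //.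
  exact: measurable_funTS.
have mEf : measurable_fun [set: RR] (EFin \o f) by exact/measurable_EFinP.
have f_f : {ae mu, forall x, setT x -> f_ ^~ x @ \oo --> (EFin \o f) x}.
  apply: aeW => x _; apply: cvg_near_cst.
  near=> n; rewrite /f_ patchE ifT// inE /I/= in_itv/= -ler_norml.
  near: n; exists (Num.truncn `|x|) => // n /= xn.
  by rewrite (le_trans (ltW (truncnS_gt _)))// ler_nat.
have gi : mu.-integrable [set: RR] (fun x => `|f x|%:E).
  exact: (integrable_abse fi).
have f_g : {ae mu, forall x n, setT x -> (`|f_ n x| <= `|f x|%:E)%E}.
  apply: aeW => x n _; rewrite /f_ patchE lee_fin.
  by case: ifP => // _; rewrite normr0.
have [_ _ lim_f] := dominated_convergence measurableT mf_ mEf f_f gi f_g.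
have I_f n : (\int[mu]_x f_ n x = (gauss_mono k n.+1%:R - gauss_mono k (- n.+1%:R))%:E)%E.
  rewrite -FTC [RHS]integral_mkcond; apply: eq_integral => x _.
  by rewrite /f_ restrict_EFin.
have lim0 : (gauss_mono k n.+1%:R - gauss_mono k (- n.+1%:R))%:E @[n --> \oo] --> 0%E.
  pose C := 2 ^+ k.+1 * k.+1`!%:R + 1 : R.
  apply: cvg_EFin; first exact: nearW.
  apply/norm_cvg0P; apply: (@squeeze_cvgr _ _ _ _ (cst 0) (fun n => 2 * C * (@harmonic R n))).
  - apply: nearW => n; rewrite normr_ge0/= (le_trans (ler_normB _ _))//.
    rewrite /harmonic/= -mulrA mulr_natl mulr2n.
    have h (y : R) : `|y| = n.+1%:R -> `|gauss_mono k y| <= C * n.+1%:R^-1.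
      by move=> yE; rewrite -yE; apply: gauss_mono_small; rewrite yE ler1n.
    by apply: lerD; apply: h; rewrite ?normrN normr_nat.
  - exact: cvg_cst.
  - rewrite -[X in _ --> X](mulr0 (2 * C)).
    by apply: cvgM; [exact: cvg_cst|exact: cvg_harmonic].
rewrite /Rintegral -/f.
have -> : (\int[mu]_x (f x)%:E = 0)%E; last by [].
have E : [sequence (\int[mu]_x f_ n x)%E]_n =
    fun n => (gauss_mono k n.+1%:R - gauss_mono k (- n.+1%:R))%:E.
  by apply/funext => n; rewrite /= I_f.
rewrite E in lim_f.
by apply: cvg_unique lim_f lim0; exact: ereal_hausdorff.
Unshelve. all: by end_near. Qed.

Lemma gauss_moment_rec k : \int[mu]_x gauss_mono k.+1 x =
  k%:R / 2 * \int[mu]_x gauss_mono k.-1 x.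
Proof.
have i n c : mu.-integrable [set: RR] (EFin \o (fun x => c * gauss_mono n x)).
  rewrite (_ : _ \o _ = fun x => (c%:E * (gauss_mono n x)%:E)%E)//.
  by apply: integrableZl => //; exact: integrable_gauss_mono.
have := Rintegral_gauss_mono_deriv k.
rewrite RintegralB// !RintegralZl//; try exact: integrable_gauss_mono.
move/eqP; rewrite subr_eq0 => /eqP h.
by rewrite mulrAC h mulrAC divff ?mul1r ?pnatr_eq0.
Qed.

End GaussMoments.

Section ProductIntegral.
Variable R : realType.
Local Notation RR := (measurableTypeR R).
Local Notation mu := (@lebesgue_measure R).
Local Notation mun := (@lebesgue_tuple R).

Lemma measurable_prod_tuple n (g : 'I_n -> RR -> R) :
  (forall i, measurable_fun setT (g i)) ->
  measurable_fun setT (fun t : n.-tuple RR => \prod_i g i (tnth t i)).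
Proof.
move=> mg; apply: measurable_prod => i _.
by apply: measurableT_comp => //; exact: measurable_tnth.
Qed.

Lemma integral_prod_tuple n (g : 'I_n -> RR -> R) :
  (forall i, mu.-integrable setT (EFin \o g i)) ->
  (mun n).-integrable setT (EFin \o (fun t : n.-tuple RR => \prod_i g i (tnth t i))) /\
  \int[mun n]_t (\prod_i g i (tnth t i)) = \prod_i \int[mu]_x g i x.
Proof.
elim: n g => [|n IH] g gi.
  under eq_fun do rewrite big_ord0.
  split; last by rewrite big_ord0 /Rintegral integral_dirac// diracT mul1e.
  apply/integrableP; split; first exact: measurable_cst.
  by rewrite integral_dirac//= diracT mul1e normr1 ltry.
have mg i : measurable_fun [set: RR] (g i).
  by apply/measurable_EFinP; exact: measurable_int (gi i).
have [Gi GE] := IH (fun i => g (lift ord0 i)) (fun i => gi _).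
pose G (t : n.-tuple RR) := \prod_i g (lift ord0 i) (tnth t i).
pose f (t : n.+1.-tuple RR) := \prod_i g i (tnth t i).
rewrite -/f; rewrite -/G in Gi GE.
have mf : measurable_fun setT f by exact: (measurable_prod_tuple mg).
have mG : measurable_fun setT G by exact: (measurable_prod_tuple (fun i => mg _)).
have fE x t : f (Defs.cons_tuple (x, t)) = g ord0 x * G t.
  rewrite /f big_ord_recl tnth_cons_tuple0; congr (_ * _).
  by apply: eq_bigr => i _; rewrite tnth_cons_tupleS.
have mEf : measurable_fun setT (EFin \o f) by exact/measurable_EFinP.
have fci : (mu \x mun n)%E.-integrable setT ((EFin \o f) \o @Defs.cons_tuple _ RR n).
  apply/integrable12ltyP.
    by apply: measurableT_comp => //; exact: measurable_cons_tuple.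
  rewrite (_ : (fun x => _) = fun x => (`|(g ord0 x)%:E| * \int[mun n]_t `|(G t)%:E|)%E).
    have Gfin : (\int[mun n]_t `|(G t)%:E| < +oo)%E by case/integrableP: Gi.
    rewrite ge0_integralZr//; last 2 first.
      by apply: measurableT_comp => //; exact/measurable_EFinP.
      exact: integral_ge0.
    apply: lte_mul_pinfty => //; first exact: integral_ge0.
    by rewrite ge0_fin_numE; [case/integrableP: (gi ord0)|exact: integral_ge0].
  apply/funext => x; rewrite -ge0_integralZl//; last first.
    by apply: measurableT_comp => //; exact/measurable_EFinP.
  by apply: eq_integral => t _; rewrite /= fE -EFinM normrM.
have [fi fint] := integrable_cons mEf fci.
split=> //; rewrite big_ord_recl -GE /Rintegral fint.
have Ex x : (\int[mun n]_t (EFin \o f) (Defs.cons_tuple (x, t)) =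
    (g ord0 x)%:E * \int[mun n]_t (G t)%:E)%E.
  rewrite -integralZl//.
  by apply: eq_integral => t _; rewrite /= fE EFinM.
have Gf := integrable_fin_num measurableT Gi.
transitivity (fine (\int[mu]_x ((g ord0 x)%:E * (fine (\int[mun n]_t (G t)%:E))%:E))%E).
  by congr fine; apply: eq_integral => x _; rewrite fineK//; exact: Ex.
rewrite integralZr//; last exact: gi.
by rewrite fineM//; exact: (integrable_fin_num measurableT (gi ord0)).
Qed.

End ProductIntegral.

(** * Gaussian integrals of polynomials *)

Section GaussPolynomials.
Variables (R : realType) (d : nat).
Local Notation RR := (measurableTypeR R).
Local Notation mu := (@lebesgue_measure R).
Local Notation T := (d.+1.-tuple RR).
Local Notation mun := (@lebesgue_tuple R d.+1).
Local Notation P := (mpoly.mpoly d.+1 R).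

Definition gauss_poly (p : P) (t : T) : R :=
  mpoly.meval (tnth t) p * \prod_i gauss_fun (tnth t i).

Lemma gauss_polyX m t :
  gauss_poly (mpoly.mpolyX R m) t = \prod_i gauss_mono (m i) (tnth t i).
Proof. by rewrite /gauss_poly mpoly.mevalX -big_split. Qed.

Lemma gauss_polyDZ c p q t :
  gauss_poly (c *: p + q) t = c * gauss_poly p t + gauss_poly q t.
Proof. by rewrite /gauss_poly mpoly.mevalD mpoly.mevalZ mulrDl mulrA. Qed.

Lemma integrable_gauss_poly p : mun.-integrable setT (EFin \o gauss_poly p).
Proof.
elim/mpoly.mpolyind: p => [|c m p _ _ IH].
  rewrite (_ : _ \o _ = cst 0%E); first exact: integrable0.
  by apply/funext => t; rewrite /= /gauss_poly mpoly.meval0 mul0r.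
rewrite (_ : _ \o _ = fun t => (c%:E * (gauss_poly (mpoly.mpolyX R m) t)%:E
    + (gauss_poly p t)%:E)%E); last first.
  by apply/funext => t; rewrite /= gauss_polyDZ.
apply: integrableD => //; apply: integrableZl => //.
have [+ _] := integral_prod_tuple (fun i => integrable_gauss_mono R (m i)).
by apply: eq_integrable => // t _; rewrite /= gauss_polyX.
Qed.

Definition gauss_int p := \int[mun]_t gauss_poly p t.

Lemma gauss_intDZ c p q : gauss_int (c *: p + q) = c * gauss_int p + gauss_int q.
Proof.
rewrite /gauss_int -RintegralZl//; last exact: integrable_gauss_poly.
rewrite -RintegralD//; last exact: integrable_gauss_poly.
  by apply: eq_Rintegral => t _; rewrite gauss_polyDZ.
rewrite (_ : _ \o _ = fun t => (c%:E * (gauss_poly p t)%:E)%E)//.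
by apply: integrableZl => //; exact: integrable_gauss_poly.
Qed.

Lemma gauss_intX m :
  gauss_int (mpoly.mpolyX R m) = \prod_i \int[mu]_x gauss_mono (m i) x.
Proof.
have [_ <-] := integral_prod_tuple (fun i => integrable_gauss_mono R (m i)).
by apply: eq_Rintegral => t _; rewrite gauss_polyX.
Qed.

Lemma gauss_int0 : gauss_int 0 = 0.
Proof.
rewrite /gauss_int (_ : (fun _ => _) = cst 0) ?Rintegral_cst ?mul0r//.
by apply/funext => t; rewrite /gauss_poly mpoly.meval0 mul0r.
Qed.

Lemma gauss_intZ c p : gauss_int (c *: p) = c * gauss_int p.
Proof. by rewrite -[c *: p]addr0 gauss_intDZ gauss_int0 addr0. Qed.

(** Infinitesimal rotation invariance of the Gaussian measure. On a monomial, the moment recurrence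
    lowers the raised exponent, and both halves of [angular] become the same product of moments,
    symmetric in i and j. *)
Lemma gauss_int_angular i j p : gauss_int (angular i j p) = 0.
Proof.
elim/mpoly.mpolyind: p => [|c m p _ _ IH].
  by rewrite /angular !mpoly.mderiv0 !mulr0 subr0 gauss_int0.
rewrite angularD angularZ gauss_intDZ IH addr0.
suff -> : gauss_int (angular i j (mpoly.mpolyX R m)) = 0 by rewrite mulr0.
rewrite /angular !mpoly.mderivX -!scalerAr -!mpoly.mpolyXD -scaleNr addrC.
have [->|ij] := eqVneq i j.
  by rewrite -scalerDl addNr scale0r gauss_int0.
rewrite gauss_intDZ gauss_intZ !gauss_intX.
set M := fun k : nat => \int[mu]_x gauss_mono k x.
have ME k : M k.+1 = k%:R / 2 * M k.-1 by exact: gauss_moment_rec.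
pose r := \prod_(k | (k != i) && (k != j)) M (m k).
have H a b : a != b -> (forall k, (k != a) && (k != b) = (k != i) && (k != j)) ->
    (m b)%:R * \prod_k M (mpoly.mnm_add (mpoly.mnm1 a) (mpoly.mnm_sub m (mpoly.mnm1 b)) k) =
    (m a)%:R * (m b)%:R / 2 * M (m a).-1 * M (m b).-1 * r.
  move=> ab kab; rewrite (bigD1 a)//= (bigD1 b)/= 1?eq_sym//.
  rewrite !mpoly.mnmDE !mpoly.mnmBE !mpoly.mnm1E !eqxx (negPf ab) (eq_sym b) (negPf ab).
  rewrite subn0 add0n add1n subn1 ME.
  rewrite (_ : \prod_(k | _) _ = r); first by ring.
  apply: eq_big => [k|k]; first exact: kab.
  move=> /andP[ka kb]; rewrite mpoly.mnmDE mpoly.mnmBE !mpoly.mnm1E.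
  by rewrite eq_sym (negPf ka) eq_sym (negPf kb) add0n subn0.
have ji : j != i by rewrite eq_sym.
rewrite mulNr (H i j ij (fun=> erefl)) (H j i ji (fun=> andbC _ _)); ring.
Qed.

End GaussPolynomials.

(** * Cones, directions and the surface measure *)

Section Polar.
Variables (R : realType) (d : nat).
Local Notation RR := (measurableTypeR R).
Local Notation T := (d.+1.-tuple RR).
Local Notation mun := (@lebesgue_tuple R d.+1).
Local Notation P := (mpoly.mpoly d.+1 R).
Local Notation S := (set_type (sphere R d)).
Local Notation omega := (surface_measure R d).

Definition tnorm (t : T) : RR := enorm (\row_i tnth t i).

Lemma measurable_tnorm : measurable_fun setT tnorm.
Proof. exact: measurable_enorm. Qed.

Lemma tnorm_ge0 t : 0 <= tnorm t. Proof. exact: enorm_ge0. Qed.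

Lemma row_scale_tuple c (t : T) :
  \row_i tnth (scale_tuple c t) i = c *: \row_i tnth t i :> 'rV[R]_d.+1.
Proof. by apply/rowP => i; rewrite !mxE tnth_mktuple. Qed.

Lemma tnorm_scale c (t : T) : 0 <= c -> tnorm (scale_tuple c t) = c * tnorm t.
Proof. by move=> c0; rewrite /tnorm row_scale_tuple enormZ ger0_norm. Qed.

Lemma radial_scale c (t : T) : 0 < c -> radial (scale_tuple c t) = radial t.
Proof.
move=> c0; rewrite /radial row_scale_tuple enormZ gtr0_norm//.
by rewrite scalerA invfM mulrAC mulVf ?mul1r// gt_eqF.
Qed.

Lemma enorm_eq0 n (x : 'rV[R]_n) : enorm x = 0 -> x = 0.
Proof.
move=> /eqP; rewrite sqrtr_eq0 => xs.
have x0 : \sum_i x ord0 i ^+ 2 == 0 by rewrite eq_le xs sumr_ge0// => i _; rewrite sqr_ge0.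
apply/rowP => i; rewrite mxE; apply/eqP; rewrite -sqrf_eq0.
by move: x0; rewrite psumr_eq0; [move=> /allP/(_ i (mem_index_enum _))|move=> ? _; exact: sqr_ge0].
Qed.

Lemma tnth_radial (t : T) i : tnth t i = tnorm t * \val (radial t) ord0 i.
Proof.
(* At the origin both sides are 0, whatever default value [radial] takes there. *)
have [t0|t0] := eqVneq (tnorm t) 0.
  rewrite t0 mul0r; have /rowP/(_ i) := enorm_eq0 t0.
  by rewrite !mxE.
rewrite /radial -/(tnorm t) insubdK; first by rewrite !mxE mulrA divff// mul1r.
apply/mem_set; rewrite /sphere/= enormZ -/(tnorm t).
by rewrite ger0_norm ?mulVf// invr_ge0 tnorm_ge0.
Qed.

Lemma tnorm_sqr (t : T) : tnorm t ^+ 2 = \sum_i tnth t i ^+ 2.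
Proof.
rewrite sqr_sqrtr ?sumr_ge0//; last by move=> i _; rewrite sqr_ge0.
by apply: eq_bigr => i _; rewrite mxE.
Qed.

Lemma gauss_fun_tnorm (t : T) : gauss_fun (tnorm t) = \prod_i gauss_fun (tnth t i).
Proof.
rewrite /gauss_fun tnorm_sqr -sumrN.
by apply: (big_morph expR); [exact: expRD|exact: expR0].
Qed.

Lemma dhomog_meval k (p : P) (v w : 'I_d.+1 -> R) c : p \is mpoly.ishomog1 k mpoly.mdeg ->
  (forall i, v i = c * w i) -> mpoly.meval v p = c ^+ k * mpoly.meval w p.
Proof.
move=> hp vw; rewrite !mpoly.mevalE mulr_sumr big_seq [RHS]big_seq.
apply: eq_bigr => m mp; rewrite mulrCA; congr (_ * _).
rewrite -(mpoly.dhomog_mf hp mp) /= mpoly.mdegE.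
rewrite (big_morph (fun k => c ^+ k) (exprD c) (expr0 c)) -big_split/=.
by apply: eq_bigr => i _; rewrite vw exprMn.
Qed.

Lemma gauss_poly_polar k (p : P) t : p \is mpoly.ishomog1 k mpoly.mdeg ->
  gauss_poly p t = gauss_mono k (tnorm t) * eval_sphere p (radial t).
Proof.
move=> hp; rewrite /gauss_poly /gauss_mono -gauss_fun_tnorm mulrAC; congr (_ * _).
by rewrite (dhomog_meval hp (tnth_radial t)).
Qed.

Lemma measurable_coord i : measurable_fun setT (fun x : S => \val x ord0 i : RR).
Proof.
move=> _ B mB; rewrite setTI; apply: sub_sigma_algebra.
rewrite -bigcup_seq/=; exists i => /=; first by rewrite mem_index_enum.
by exists B => //; rewrite setTI.
Qed.

Lemma measurable_eval_sphere (p : P) : measurable_fun setT (eval_sphere p : S -> R).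
Proof.
rewrite (_ : eval_sphere p = fun x : S => \sum_(m <- mpoly.msupp p)
    mpoly.mcoeff m p * \prod_i (\val x ord0 i) ^+ (m i)); last first.
  by apply/funext => x; rewrite /eval_sphere mpoly.mevalE.
apply: measurable_sum => m; apply: measurable_funM => //.
by apply: measurable_prod => i _; apply: measurable_funX; exact: measurable_coord.
Qed.

Lemma sphere_normsq (x : S) : \sum_i (\val x ord0 i) ^+ 2 = 1.
Proof.
have h : enorm (\val x) = 1 by exact: set_mem (valP x).
rewrite -[LHS]sqr_sqrtr; last by rewrite sumr_ge0// => i _; rewrite sqr_ge0.
by rewrite -/(enorm _) h expr1n.
Qed.

Lemma coord_le1 (x : S) i : `|\val x ord0 i| <= 1.
Proof.
rewrite -(@ler_pXn2r _ 2)// ?nnegrE// expr1n real_normK ?num_real//.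
rewrite -(sphere_normsq x) (bigD1 i)//= lerDl.
by apply: sumr_ge0 => j _; rewrite sqr_ge0.
Qed.

Lemma eval_sphere_bounded (p : P) : exists2 M, 0 <= M & forall x : S, `|eval_sphere p x| <= M.
Proof.
exists (\sum_(m <- mpoly.msupp p) `|mpoly.mcoeff m p|); first exact: sumr_ge0.
move=> x; rewrite /eval_sphere mpoly.mevalE (le_trans (ler_norm_sum _ _ _))//.
apply: ler_sum => m _; rewrite normrM ler_piMr// normr_prod.
apply: prodr_ile1 => i _.
by rewrite normr_ge0 normrX exprn_ile1// coord_le1.
Qed.

(** On the ball the indicator is at most e times the integrable Gaussian. *)
Lemma unit_ball_finite : (mun [set t : T | tnorm t <= 1]%R < +oo)%E.
Proof.
have h := integrable_gauss_poly (1 : P).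
have [_ h2] := integrableP _ _ _ h.
have mg : measurable_fun setT (gauss_poly (1 : P)) by apply/measurable_EFinP; case/integrableP: h.
have : (\int[mun]_t (expR 1 * `|gauss_poly 1 t|)%:E < +oo)%E.
  under eq_integral do rewrite EFinM.
  rewrite ge0_integralZl//.
    by apply: lte_mul_pinfty.
  by apply: measurableT_comp => //; exact: measurableT_comp.
apply: le_lt_trans.
have mB := @measurable_unit_ball R d.
rewrite -(setIT [set t : T | _]) -integral_indic//.
apply: ge0_le_integral => //.
- by apply/measurable_EFinP; exact: measurable_indic.
- by apply/measurable_EFinP; apply: measurable_funM => //; exact: measurableT_comp.
move=> t _; rewrite lee_fin /gauss_poly mpoly.meval1 mul1r -gauss_fun_tnorm.
rewrite ger0_norm ?expR_ge0// /gauss_fun -expRD indicE.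
have [/set_mem/= t1|_] := boolP (_ \in _); last exact: expR_ge0.
by rewrite -[leLHS]expR0 ler_expR subr_ge0 exprn_ile1// tnorm_ge0.
Qed.
Lemma measurable_open_cube (c : T) (e : R) :
  measurable [set t : T | forall i, `|tnth t i - tnth c i| < e].
Proof.
pose I i : interval R := `]tnth c i - e, tnth c i + e[.
set C := (X in measurable X).
rewrite (_ : C = \big[setI/setT]_(i < d.+1) ((@tnth _ RR)^~ i @^-1` [set` I i])).
  apply: bigsetI_measurable => i _; rewrite -[X in measurable X]setTI.
  by apply: measurable_tnth.
rewrite -bigcap_seq; apply/seteqP; split => t /= h i.
  by move=> _; rewrite /= in_itv/= -ltr_distl; exact: h.
by have := h i (mem_index_enum _); rewrite /= in_itv/= -ltr_distl.
Qed.

(** The indicator is a product of interval indicators, so the volume is the product of the side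
    lengths. *)
Lemma open_cube_gt0 (c : T) (e : R) : 0 < e ->
  (0 < mun [set t : T | forall i, (`|tnth t i - tnth c i| < e)%R])%E.
Proof.
move=> e0; pose I i : interval R := `]tnth c i - e, tnth c i + e[.
have fi i : (@lebesgue_measure R).-integrable setT (EFin \o (\1_[set` I i] : RR -> R)).
  exact: integrable_indic_itv.
have [hi hE] := integral_prod_tuple fi.
set C := [set t : T | _].
have CE t : \1_C t = \prod_i \1_[set` I i] (tnth t i) :> R.
  rewrite indicE; case: (boolP (t \in C)) => [/set_mem tC|tC].
    rewrite big1// => i _; rewrite indicE mem_set//= in_itv/=.
    by have := tC i; rewrite ltr_distl.
  have [i ti] : exists i, ~ (`|tnth t i - tnth c i| < e).
    by apply/existsNP => h; move/negP: tC; apply; exact/mem_set.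
  rewrite (bigD1 i)//= indicE memNset ?mul0r//= in_itv/=.
  by move: ti; rewrite ltr_distl.
have mC : measurable C by exact: measurable_open_cube.
clearbody C.
have : 0 < \int[mun]_t \1_C t.
  under eq_Rintegral do rewrite CE.
  rewrite hE prodr_gt0// => i _.
  rewrite /Rintegral integral_indic//= setIT lebesgue_measure_itv/= lte_fin.
  rewrite ltrD2l gtrN// -EFinB/= opprD addrACA subrr add0r opprK.
  by rewrite addr_gt0.
rewrite /Rintegral integral_indic// setIT => h.
rewrite lt_neqAle measure_ge0 andbT; apply/eqP => C0.
by move: (lt_eqF h) => /eqP; apply; exact: (congr1 fine C0).
Qed.
(** The truncated cone over B. At r = 1 its volume times d + 1 is the surface measure of B; other
    radii are reached by scaling. *)
Definition cone (B : set S) (r : R) : set T := [set t | tnorm t <= r] `&` @radial R d @^-1` B.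

Lemma measurable_cone (B : set S) r : measurable B -> measurable (cone B r).
Proof.
move=> mB; apply: measurableI.
  have h := measurable_tnorm measurableT (measurable_itv `]-oo, r]).
  rewrite setTI in h; suff <- : tnorm @^-1` [set` `]-oo, r]] = [set t | tnorm t <= r] by [].
  by apply/seteqP; split => t; rewrite /= in_itv.
by rewrite -[X in measurable X]setTI; exact: measurable_radial.
Qed.

Lemma surface_measure_cone (B : set S) : measurable B ->
  (omega B = d.+1%:R%:E * mun (cone B 1))%E.
Proof.
move=> mB; rewrite /surface_measure /pushforward /ball_measure /mscale/= /mrestr.
by rewrite /cone setIC.
Qed.

Lemma cone_scale (B : set S) r : measurable B -> 0 < r ->
  (mun (cone B r) = (r ^+ d.+1)%:E * mun (cone B 1))%E.
Proof.
move=> mB r0.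
have ri : 0 < r^-1 by rewrite invr_gt0.
have h := @ge0_integral_scale_tuple R d.+1 r^-1 (EFin \o \1_(cone B 1)) ri.
rewrite -(setIT (cone B r)) -(setIT (cone B 1)) -!integral_indic//; try exact: measurable_cone.
have -> : r ^+ d.+1 = r^-1 ^- d.+1 by rewrite -exprVn invrK.
rewrite -h; last 2 first.
- by apply/measurable_EFinP; apply: measurable_indic; exact: measurable_cone.
- by move=> t /=; rewrite lee_fin.
apply: eq_integral => t _ /=; congr _%:E; rewrite !indicE; congr (nat_of_bool _)%:R.
apply/idP/idP => /set_mem [/= h1 h2]; apply/mem_set; split => /=.
- by rewrite tnorm_scale ?invr_ge0 ?(ltW r0)// mulrC ler_pdivrMr// mul1r.
- by rewrite /preimage/= radial_scale.
- by move: h1; rewrite tnorm_scale ?invr_ge0 ?(ltW r0)// mulrC ler_pdivrMr// mul1r.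
- by move: h2; rewrite /preimage/= radial_scale.
Qed.

Lemma cone_finite (B : set S) r : measurable B -> (mun (cone B r) < +oo)%E.
Proof.
move=> mB.
have h : (mun (cone B (Num.max r 1)%R) < +oo)%E.
  rewrite cone_scale//; last by rewrite lt_max ltr01 orbT.
  apply: lte_mul_pinfty => //; first by rewrite lee_fin exprn_ge0// le_max ler01 orbT.
  apply: le_lt_trans unit_ball_finite; apply: le_measure; rewrite ?inE.
  - exact: measurable_cone.
  - exact: measurable_unit_ball.
  - exact: subIsetl.
apply: le_lt_trans h; apply: le_measure; rewrite ?inE; try exact: measurable_cone.
by move=> t [/= t1 t2]; split => //=; rewrite le_max t1.
Qed.

(** At most the origin is left, and it is enclosed in cones of arbitrarily small volume; no separate
    argument for points is made. *)
Lemma cone_nonpos (B : set S) r : measurable B -> r <= 0 -> mun (cone B r) = 0%E.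
Proof.
move=> mB r0; apply/eqP; rewrite eq_le measure_ge0 andbT.
have fin : mun (cone B 1) \is a fin_num by rewrite ge0_fin_numE// cone_finite.
apply/lee_addgt0Pr => e e0; rewrite add0e.
pose m := fine (mun (cone B 1)).
have m0 : 0 <= m by rewrite fine_ge0.
(* q <= 1 gives q^(d+1) <= q, and the second bound gives q m <= e. *)
pose q := Num.min 1 (e / (m + 1)).
have q0 : 0 < q by rewrite lt_min ltr01 divr_gt0// ltr_wpDl.
apply: (@le_trans _ _ (mun (cone B q))).
  apply: le_measure; rewrite ?inE; try exact: measurable_cone.
  by move=> t [/= t1 t2]; split => //=; rewrite (le_trans t1)// (le_trans r0)// ltW.
rewrite cone_scale// -(fineK fin) -EFinM lee_fin -/m.
apply: (@le_trans _ _ (q * m)).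
  rewrite ler_wpM2r// exprS ler_piMr ?(ltW q0)// exprn_ile1 ?(ltW q0)//.
  by rewrite ge_min lexx.
apply: (@le_trans _ _ (e / (m + 1) * m)).
  by rewrite ler_wpM2r// ge_min lexx orbT.
by rewrite mulrAC ler_pdivrMr ?ltr_wpDl// ler_wpM2l ?(ltW e0)// lerDl.
Qed.

Lemma surface_finite : (omega setT < +oo)%E.
Proof.
rewrite surface_measure_cone//; apply: lte_mul_pinfty => //; exact: cone_finite.
Qed.

(** Independence of norm and direction, on the sets that determine the joint law: scaling multiplies
    all cones by the same power of r. *)
Lemma cone_independent (B : set S) r : measurable B ->
  (omega setT * mun (cone B r) = omega B * mun (cone setT r))%E.
Proof.
move=> mB; rewrite !surface_measure_cone//.
have [r0|r0] := leP r 0; first by rewrite (cone_nonpos mB r0) (cone_nonpos measurableT r0) !mule0.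
rewrite !(cone_scale _ r0)// -!muleA; congr (_ * _)%E.
by rewrite muleCA [RHS]muleCA; congr (_ * _)%E; rewrite muleC.
Qed.

End Polar.

Section MeasureScaling.
Context d (T : measurableType d) (R : realType).

Lemma integral_mscale (mu : {measure set T -> \bar R}) (c : R) (c0 : 0 <= c)
    (f : T -> \bar R) : measurable_fun setT f -> mu.-integrable setT f ->
  (mscale (NngNum c0) mu).-integrable setT f /\
  (\int[mscale (NngNum c0) mu]_x f x = c%:E * \int[mu]_x f x)%E.
Proof.
move=> mf fi; have [_ fy] := integrableP _ _ _ fi; split.
  apply/integrableP; split => //; rewrite ge0_integral_mscale//.
    by rewrite lte_mul_pinfty.
  exact: measurableT_comp.
rewrite [LHS]integralE (integralE mu setT f) muleBr//; last exact: integrable_add_def.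
congr (_ - _)%E; rewrite ge0_integral_mscale//.
- exact: measurable_funepos.
- exact: measurable_funeneg.
Qed.

Lemma eq_measure_integrable (m1 m2 : {measure set T -> \bar R}) (f : T -> \bar R) :
  (forall A, measurable A -> m1 A = m2 A) ->
  m1.-integrable setT f -> m2.-integrable setT f.
Proof.
move=> m12 /integrableP[mf fi]; apply/integrableP; split => //.
by rewrite (@eq_measure_integral _ _ _ _ m1)// => A mA _; rewrite m12.
Qed.

End MeasureScaling.

(** * Polar coordinates *)

Section PolarIntegral.
Variables (R : realType) (d : nat).
Local Notation RR := (measurableTypeR R).
Local Notation T := (d.+1.-tuple RR).
Local Notation mun := (@lebesgue_tuple R d.+1).
Local Notation P := (mpoly.mpoly d.+1 R).
Local Notation S := (set_type (sphere R d)).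
Local Notation omega := (surface_measure R d).

(** The radial factor of polar coordinates, taken as an image measure instead of through a density
    in r. *)
Definition radial_law : {measure set RR -> \bar R} :=
  image_measure mun (@measurable_tnorm R d).

Lemma radial_law_ray r : radial_law [set` `]-oo, r]] = mun (@cone R d setT r).
Proof.
congr (mun _); apply/seteqP; split => t; rewrite /= in_itv/=; last by case.
by split.
Qed.

Lemma radial_law_ray_fin r : (radial_law [set` `]-oo, r]] < +oo)%E.
Proof. by rewrite radial_law_ray; exact: cone_finite. Qed.

Lemma radial_law_sigma_finite : sigma_finite setT radial_law.
Proof.
exists (fun n => [set` `]-oo, n%:R]]).
  apply/esym; rewrite -subTset => x _; exists (Num.truncn `|x|).+1 => //=.
  rewrite in_itv/= (le_trans (ler_norm _))// ltW//; exact: truncnS_gt.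
move=> n; split; first exact: measurable_itv.
exact: radial_law_ray_fin.
Qed.

HB.instance Definition _ := Measure.on radial_law.
HB.instance Definition _ := Measure_isSigmaFinite.Build _ _ _ radial_law
  radial_law_sigma_finite.

Lemma surface_fin_num_fun : fin_num_fun omega.
Proof.
move=> A mA; rewrite ge0_fin_numE//; apply: le_lt_trans (surface_finite R d).
by apply: le_measure; rewrite ?inE.
Qed.
HB.instance Definition _ := Measure_isFinite.Build _ _ _ omega surface_fin_num_fun.

Lemma integrable_bounded (f : S -> R) M : measurable_fun setT f ->
  (forall x, `|f x| <= M) -> omega.-integrable setT (EFin \o f).
Proof.
move=> mf fM; have mEf : measurable_fun setT (EFin \o f) by exact/measurable_EFinP.
apply/integrableP; split => //.
apply: (@le_lt_trans _ _ (\int[omega]_x (cst M%:E x))%E).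
  apply: ge0_le_integral => //; first exact: measurableT_comp.
  by move=> x _; rewrite lee_fin.
rewrite integral_cst//; apply: lte_mul_pinfty => //; last exact: surface_finite.
by rewrite lee_fin (le_trans _ (fM (e0 R d))).
Qed.

Lemma integrable_eval_sphere p : omega.-integrable setT (EFin \o eval_sphere p).
Proof.
have [M _ hM] := eval_sphere_bounded p.
by apply: integrable_bounded hM; exact: measurable_eval_sphere.
Qed.

(** Half-open intervals are differences of rays, and finiteness on rays makes the subtraction
    legitimate. *)
Lemma measure_unique_rays (m1 m2 : {measure set RR -> \bar R}) :
  (forall r, (m1 [set` `]-oo, r]] < +oo)%E) ->
  (forall r, m1 [set` `]-oo, r]] = m2 [set` `]-oo, r]]) ->
  forall A, measurable A -> m1 A = m2 A.
Proof.
move=> m1fin m12 A mA.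
have Em (m : {measure set RR -> \bar R}) (a b : R) : a <= b -> (m [set` `]-oo, b]] < +oo)%E ->
    m `]a, b]%classic = (m [set` `]-oo, b]] - m [set` `]-oo, a]])%E.
  move=> ab mb.
  have -> : `]a, b]%classic = [set` `]-oo, b]] `\` [set` `]-oo, a]] :> set RR.
    apply/seteqP; split => x; rewrite /= !in_itv/=.
      by move=> /andP[ax ->]; split => //; rewrite leNgt ax.
    by move=> [-> /negP]; rewrite -ltNge => ->.
  rewrite measureD//.
  congr (_ - m _)%E; apply/seteqP; split => x; rewrite /= !in_itv/=; first by case.
  by move=> xa; split=> //; exact: le_trans xa ab.
have H := @measure_unique _ R RR (@ocitv R) (fun n => `]- n%:R, n%:R]%classic)
  erefl (@ocitvI R) _ _ m1 m2 _ _ A mA.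
apply: H => //.
- by move=> n; exists (- n%:R, n%:R).
- apply/seteqP; split => // x _; exists (Num.truncn `|x|).+1 => //=.
  rewrite in_itv/= -[X in _ && X]/(x <= _).
  have := truncnS_gt `|x|; rewrite ltr_norml => /andP[-> ?] /=; exact: ltW.
- move=> _ [[a b]] _ <- /=.
  have [ab|ba] := leP a b; last by rewrite set_itv_ge ?measure0//= bnd_simp -leNgt ltW.
  by rewrite !Em// ?m12// -m12.
- move=> n; rewrite Em//; last by rewrite (le_trans _ (ler0n _ _))// oppr_le0.
  apply: le_lt_trans (m1fin n%:R).
  by rewrite leeBlDr ?leeDl// ge0_fin_numE.
Qed.

(** For fixed B both sides are measures in A, and on rays they agree by [cone_independent]. *)
Lemma polar_rect A B : measurable A -> measurable B ->
  (omega setT * mun (@tnorm R d @^-1` A `&` @radial R d @^-1` B) = radial_law A * omega B)%E.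
Proof.
move=> mA mB.
have mrB : measurable (@radial R d @^-1` B).
  by rewrite -[X in measurable X]setTI; exact: measurable_radial.
have wB : omega B \is a fin_num.
  rewrite ge0_fin_numE//; apply: le_lt_trans (surface_finite R d).
  by apply: le_measure; rewrite ?inE.
have wT : omega setT \is a fin_num by rewrite ge0_fin_numE// surface_finite.
have f0 C : 0 <= fine (omega C) by exact: fine_ge0.
pose m1 := mscale (NngNum (f0 setT)) (image_measure (mrestr mun mrB) (@measurable_tnorm R d)).
pose m2 := mscale (NngNum (f0 B)) radial_law.
have ray1 r : m1 [set` `]-oo, r]] = (omega setT * mun (cone B r))%E.
  have E : @tnorm R d @^-1` [set` `]-oo, r]] = [set t | tnorm t <= r].
    by apply/seteqP; split => t; rewrite /= in_itv.
  by rewrite /m1 /mscale/= fineK// /cone -E.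
have ray2 r : m2 [set` `]-oo, r]] = (omega B * mun (@cone R d setT r))%E.
  by rewrite /m2 /mscale/= fineK// radial_law_ray.
have E1 : m1 A = (omega setT * mun (@tnorm R d @^-1` A `&` @radial R d @^-1` B))%E.
  by rewrite /m1 /mscale/= fineK.
have E2 : m2 A = (radial_law A * omega B)%E.
  by rewrite /m2 /mscale/= fineK// muleC.
rewrite -E1 -E2; apply: measure_unique_rays => // r; last first.
  by apply: (etrans (ray1 r)); rewrite cone_independent//; exact/esym/ray2.
have : (omega setT * mun (cone B r) < +oo)%E.
  rewrite lte_mul_pinfty//; exact: cone_finite.
by rewrite -(ray1 r).
Qed.

Definition polar (t : T) : RR * S := (tnorm t, radial t).

Lemma measurable_polar : measurable_fun setT polar.
Proof.
by apply: measurable_fun_pair; [exact: measurable_tnorm|exact: measurable_radial].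
Qed.

Lemma surface_fin_num : omega setT \is a fin_num.
Proof. by rewrite ge0_fin_numE// surface_finite. Qed.

Definition area : R := fine (omega setT).

Lemma area_ge0 : 0 <= area. Proof. exact: fine_ge0. Qed.

Lemma polar_measure X : measurable X ->
  ((radial_law \x omega) X = mscale (NngNum area_ge0) (image_measure mun measurable_polar) X)%E.
Proof.
apply: product_measure_unique => A B mA mB.
transitivity (area%:E * mun (@tnorm R d @^-1` A `&` @radial R d @^-1` B))%E => //.
by rewrite fineK ?polar_rect// surface_fin_num.
Qed.

(** For odd k the power of the norm is not a polynomial in the coordinates, so it is dominated by
    one through r^k <= 1 + r^(2k). *)
Lemma integrable_gauss_tnorm k :
  mun.-integrable setT ((EFin \o gauss_mono k) \o @tnorm R d).
Proof.
apply: le_integrable (integrable_gauss_poly (1 + normsq R d ^+ k : P)) => //.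
  apply/measurable_EFinP; apply: measurableT_comp; last exact: measurable_tnorm.
  exact: measurable_gauss_mono.
move=> t _ /=; rewrite lee_fin /gauss_poly /gauss_mono -gauss_fun_tnorm !normrM.
rewrite ler_wpM2r//.
have -> : mpoly.meval (tnth t) (1 + normsq R d ^+ k) = 1 + (tnorm t ^+ 2) ^+ k.
  rewrite mpoly.mevalD mpoly.meval1 rmorphXn/= tnorm_sqr /normsq.
  rewrite raddf_sum/=; congr (_ + _ ^+ _); apply: eq_bigr => i _.
  by rewrite rmorphXn/= mpoly.mevalXU.
have t0 := tnorm_ge0 t.
rewrite !ger0_norm ?addr_ge0 ?exprn_ge0//.
have [t1|t1] := leP (tnorm t) 1.
  by rewrite (le_trans (exprn_ile1 _ t0 t1))// lerDl !exprn_ge0.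
rewrite -exprM mulnC exprM (@le_trans _ _ ((tnorm t ^+ k) ^+ 2))//.
  by rewrite ler_eXnr// exprn_ege1// ltW.
by rewrite lerDr.
Qed.

Lemma integrable_radial_law k : radial_law.-integrable setT (EFin \o gauss_mono k).
Proof.
apply: integrable_pushforward => //; first exact: measurable_tnorm.
  by apply/measurable_EFinP; exact: measurable_gauss_mono.
by rewrite preimage_setT; exact: integrable_gauss_tnorm.
Qed.

(** A homogeneous integrand splits into a radial and an angular factor ([gauss_poly_polar]). The
    product of the two laws is [area] times the image of Lebesgue measure under [polar], whence the
    factor [area]. *)
Lemma integral_polar (k : nat) (p : P) : p \is mpoly.ishomog1 k mpoly.mdeg ->
  area * gauss_int p = (\int[radial_law]_r gauss_mono k r) * \int[omega]_x eval_sphere p x.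
Proof.
move=> hp.
pose G (z : RR * S) := gauss_mono k z.1 * eval_sphere p z.2.
have mG : measurable_fun setT G.
  apply: measurable_funM.
    by apply: measurableT_comp => //; exact: measurable_gauss_mono.
  by apply: measurableT_comp => //; exact: measurable_eval_sphere.
have Gi : (image_measure mun measurable_polar).-integrable setT (EFin \o G).
  apply: integrable_pushforward => //; first exact: measurable_polar.
    exact/measurable_EFinP.
  apply: eq_integrable (integrable_gauss_poly p) => // t _.
  by rewrite /= (gauss_poly_polar t hp).
have EG : (\int[image_measure mun measurable_polar]_z (G z)%:E = (gauss_int p)%:E)%E.
  rewrite [LHS]integral_pushforward//; first last.
  - apply: eq_integrable (integrable_gauss_poly p) => // t _.
    by rewrite /= (gauss_poly_polar t hp).
  - exact/measurable_EFinP.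
  - exact: measurable_polar.
  rewrite /gauss_int fineK; last exact: integrable_fin_num (integrable_gauss_poly p).
  rewrite preimage_setT; apply: eq_integral => t _.
  by rewrite /= (gauss_poly_polar t hp).
have mEG : measurable_fun setT (EFin \o G) by exact/measurable_EFinP.
have [GI GE] := integral_mscale area_ge0 mEG Gi.
have GI' : (radial_law \x omega)%E.-integrable setT (EFin \o G).
  by apply: eq_measure_integrable GI => A mA; exact/esym/polar_measure.
have fub := integral12_prod_meas1 GI'.
have E1 : (\int[radial_law \x omega]_z (EFin \o G) z = area%:E * (gauss_int p)%:E)%E.
  by rewrite -EG -GE; apply: eq_measure_integral => A mA _; exact: polar_measure.
rewrite E1 in fub.
have pi : omega.-integrable setT (EFin \o eval_sphere p) by exact: integrable_eval_sphere.
have ki := integrable_radial_law k.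
have fpi := integrable_fin_num measurableT pi.
have fki := integrable_fin_num measurableT ki.
apply: EFin_inj; rewrite !EFinM -fub /Rintegral !fineK//.
transitivity (\int[radial_law]_r ((gauss_mono k r)%:E *
    (fine (\int[omega]_x (eval_sphere p x)%:E))%:E))%E.
  by apply: eq_integral => r _; rewrite /fubini_F fineK// -integralZl.
by rewrite integralZr// fineK.
Qed.

Lemma radial_moment_gt0 k : 0 < \int[radial_law]_r gauss_mono k r.
Proof.
(* On the cube of half-width 1/2 about (1, ..., 1) the coordinates lie in [1/2, 2], so the norm is
   at least 1/2 and its square at most 4 (d + 1). This is the origin of the lower bound b. *)
pose c : T := [tuple 1 | i < d.+1].
pose C := [set t : T | forall i, (`|tnth t i - tnth c i| < 2^-1)%R].
have mC : measurable C by exact: measurable_open_cube.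
pose b : R := 2^-1 ^+ k * gauss_fun (Num.sqrt (4 * d.+1%:R)).
have b0 : 0 < b by rewrite mulr_gt0// ?expR_gt0// exprn_gt0// invr_gt0.
have bC t : C t -> b <= gauss_mono k (tnorm t).
  move=> Ct; have tb i : 2^-1 <= tnth t i <= 2.
    have := Ct i; rewrite tnth_mktuple ltr_norml => /andP[h1 h2].
    by apply/andP; split; lra.
  have t2 : 2^-1 <= tnorm t.
    rewrite -(@ler_pXn2r _ 2)// ?nnegrE ?tnorm_ge0// tnorm_sqr big_ord_recl.
    rewrite ler_wpDr ?sumr_ge0//; first by move=> i _; rewrite sqr_ge0.
    have /andP[h _] := tb ord0.
    by rewrite ler_pXn2r ?nnegrE ?invr_ge0// (le_trans _ h)// invr_ge0.
  rewrite /b /gauss_mono ler_pM ?exprn_ge0 ?expR_ge0//.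
    by rewrite lerXn2r ?nnegrE ?tnorm_ge0 ?invr_ge0.
  rewrite ler_expR lerN2 tnorm_sqr sqr_sqrtr ?mulr_ge0//.
  rewrite mulrC mulr_natl -[X in _ *+ X]card_ord -sumr_const; apply: ler_sum => i _.
  have /andP[h1 h2] := tb i; rewrite (_ : 4 = 2 ^+ 2); last by rewrite -natrX.
  rewrite ler_pXn2r ?nnegrE//.
  by rewrite (le_trans _ h1)// invr_ge0.
have mg : measurable_fun setT (EFin \o (gauss_mono k \o @tnorm R d)).
  apply/measurable_EFinP; apply: measurableT_comp; last exact: measurable_tnorm.
  exact: measurable_gauss_mono.
have g0 t : (0 <= gauss_mono k (tnorm t)) by rewrite mulr_ge0 ?exprn_ge0 ?tnorm_ge0 ?expR_ge0.
have E : (\int[radial_law]_r (gauss_mono k r)%:E = \int[mun]_t (gauss_mono k (tnorm t))%:E)%E.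
  rewrite [LHS]integral_pushforward//; first exact: measurable_tnorm.
    by apply/measurable_EFinP; exact: measurable_gauss_mono.
  rewrite preimage_setT; exact: integrable_gauss_tnorm.
have fin := integrable_fin_num measurableT (integrable_radial_law k).
rewrite -lte_fin /Rintegral fineK// E.
apply: (@lt_le_trans _ _ (b%:E * mun C)%E).
  by rewrite mule_gt0// open_cube_gt0// invr_gt0.
rewrite -(setIT C) -integral_indic// -ge0_integralZl//; first last.
- by rewrite lee_fin ltW.
- by apply/measurable_EFinP; exact: measurable_indic.
apply: ge0_le_integral => //.
- by move=> t _; rewrite -EFinM lee_fin mulr_ge0// ltW.
- by apply: measurable_funeM; apply/measurable_EFinP; exact: measurable_indic.
move=> t _; rewrite -EFinM lee_fin indicE.
have [/set_mem/bC h|_] := boolP (t \in C).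
  by rewrite mulr1n mulr1.
by rewrite mulr0n mulr0; exact: g0.
Qed.

Lemma surface_int_angular k (p : P) i j : p \is mpoly.ishomog1 k mpoly.mdeg ->
  \int[omega]_x eval_sphere (angular i j p) x = 0.
Proof.
move=> /(dhomog_angular i j)/integral_polar.
rewrite gauss_int_angular mulr0 => /esym/eqP; rewrite mulf_eq0 => /orP[|/eqP//].
by rewrite gt_eqF// radial_moment_gt0.
Qed.

End PolarIntegral.

(** * Positivity of the measure of small caps *)

Section Caps.
Variables (R : realType) (d : nat).
Local Notation RR := (measurableTypeR R).
Local Notation T := (d.+1.-tuple RR).
Local Notation mun := (@lebesgue_tuple R d.+1).
Local Notation S := (set_type (sphere R d)).
Local Notation omega := (surface_measure R d).

(** Neighbourhoods in the sup distance: they match the topology inherited from row vectors and are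
    finite intersections of coordinate conditions, hence measurable. *)
Definition cap (x : S) (e : R) : set S :=
  [set y : S | forall i, `|\val y ord0 i - \val x ord0 i| < e].

Lemma measurable_cap x e : measurable (cap x e).
Proof.
pose I i : interval R := `]\val x ord0 i - e, \val x ord0 i + e[.
rewrite (_ : cap x e = \big[setI/setT]_(i < d.+1)
    ((fun y : S => \val y ord0 i : RR) @^-1` [set` I i])).
  apply: bigsetI_measurable => i _; rewrite -[X in measurable X]setTI.
  by apply: measurable_coord.
rewrite -bigcap_seq; apply/seteqP; split => t /= h i.
  by move=> _; rewrite /= in_itv/= -ltr_distl; exact: h.
by have := h i (mem_index_enum _); rewrite /= in_itv/= -ltr_distl.
Qed.

Lemma cap_gt0 x e : 0 < e -> (0 < omega (cap x e))%E.
Proof.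
move=> e0; have mc := measurable_cap x e.
rewrite surface_measure_cone//; apply: mule_gt0 => //.
pose n : R := d.+1%:R.
have n1 : 1 <= n by rewrite ler1n.
pose c : T := [tuple \val x ord0 i / 2 | i < d.+1].
(* A cube about x/2 of half-width de is to lie in the cone over the cap. The first bound keeps the
   norm within 1/4 of 1/2, hence in [1/4, 1]; the second keeps the coordinate error below e/20 + e/5
   = e/4, which is at most e times the norm. *)
pose de := Num.min (16 * n)^-1 (e / (20 * n)).
have de0 : 0 < de.
  by rewrite lt_min invr_gt0 divr_gt0 ?mulr_gt0// ?(lt_le_trans _ n1).
apply: (lt_le_trans (open_cube_gt0 c de0)).
apply: le_measure; rewrite ?inE; [exact: measurable_open_cube|exact: measurable_cone|].
move=> t /= ht.
have de1 : de <= (16 * n)^-1 by rewrite ge_min lexx.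
have nde : n * de <= 16^-1.
  by rewrite -ler_pdivlMl ?(lt_le_trans _ n1)// -invfM mulrC.
have nde2 : n * de <= e / 20.
  rewrite -ler_pdivlMl ?(lt_le_trans _ n1)// (le_trans (_ : _ <= e / (20 * n)))//.
    by rewrite ge_min lexx orbT.
  by rewrite invfM mulrA mulrC.
have dn : de <= n * de by rewrite ler_peMl// ltW.
have hi i : `|tnth t i - \val x ord0 i / 2| < de by have := ht i; rewrite tnth_mktuple.
have sq : `|tnorm t ^+ 2 - 2^-1 ^+ 2| <= 2 * (n * de).
  have -> : tnorm t ^+ 2 - 2^-1 ^+ 2 =
      \sum_i (tnth t i - \val x ord0 i / 2) * (tnth t i + \val x ord0 i / 2).
    rewrite tnorm_sqr -[2^-1 ^+ 2]mul1r -(sphere_normsq x) mulr_suml -sumrB.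
    by apply: eq_bigr => i _; rewrite -subr_sqr expr_div_n exprVn.
  apply: (le_trans (ler_norm_sum _ _ _)).
  have -> : 2 * (n * de) = \sum_(i < d.+1) 2 * de.
    by rewrite sumr_const card_ord mulrCA -[RHS]mulr_natl.
  apply: ler_sum => i _; rewrite normrM mulrC; apply: ler_pM => //; last exact: ltW.
  have := hi i; have := coord_le1 x i; rewrite ler_norml ltr_norml ler_norml.
  by move=> /andP[? ?] /andP[? ?]; apply/andP; split; lra.
have t0 := tnorm_ge0 t.
have tn : `|tnorm t - 2^-1| <= 4 * (n * de).
  move: sq; rewrite subr_sqr normrM [X in _ * X]ger0_norm; last by rewrite addr_ge0.
  move=> sq; have := normr_ge0 (tnorm t - 2^-1).
  set a := `| _ | in sq *; move=> a0.
  have : a * 2^-1 <= a * (tnorm t + 2^-1) by rewrite ler_wpM2l// lerDr.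
  by move=> h; have := le_trans h sq; lra.
have /andP[t1 t2] : 4^-1 <= tnorm t <= 1.
  by move: tn; rewrite ler_norml => /andP[? ?]; apply/andP; split; lra.
split => // i /=.
have tpos : 0 < tnorm t by rewrite (lt_le_trans _ t1).
rewrite -(ltr_pM2l tpos) -[X in X * `|_|]gtr0_norm// -normrM mulrBr -tnth_radial.
rewrite (_ : _ - _ = (tnth t i - \val x ord0 i / 2) +
  \val x ord0 i * (2^-1 - tnorm t)); last by field.
apply: (le_lt_trans (ler_normD _ _)).
have h2 : `|\val x ord0 i * (2^-1 - tnorm t)| <= 4 * (n * de).
  rewrite normrM distrC; apply: le_trans tn; rewrite ler_piMl//; exact: coord_le1.
have h3 : e / 4 <= tnorm t * e by rewrite mulrC ler_wpM2r// ltW.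
by have := hi i; lra.
Qed.

Lemma area_gt0 : 0 < area R d.
Proof.
apply: fine_gt0; rewrite (lt_le_trans (cap_gt0 (e0 R d) ltr01))/=.
  by rewrite -ge0_fin_numE// surface_fin_num.
by apply: le_measure; rewrite ?inE//; exact: measurable_cap.
Qed.

End Caps.

(** * Spherical harmonics *)

Section SphericalPolynomials.
Variables (R : realType) (d : nat).
Local Notation RR := (measurableTypeR R).
Local Notation P := (mpoly.mpoly d.+1 R).
Local Notation S := (set_type (sphere R d)).
Local Notation omega := (surface_measure R d).
Local Notation homog l := (mpoly.ishomog1 l mpoly.mdeg).
Implicit Types (p q : P) (x : S).

Lemma eval_sphereM p q x : eval_sphere (p * q) x = eval_sphere p x * eval_sphere q x.
Proof. exact: mpoly.mevalM. Qed.

Lemma eval_sphereD p q x : eval_sphere (p + q) x = eval_sphere p x + eval_sphere q x.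
Proof. exact: mpoly.mevalD. Qed.

Lemma eval_sphereZ c p x : eval_sphere (c *: p) x = c * eval_sphere p x.
Proof. exact: mpoly.mevalZ. Qed.

Lemma eval_sphere_sum (I : Type) (r : seq I) (Q : pred I) (F : I -> P) x :
  eval_sphere (\sum_(k <- r | Q k) F k) x = \sum_(k <- r | Q k) eval_sphere (F k) x.
Proof. exact: raddf_sum. Qed.

Lemma eval_sphere_normsq x : eval_sphere (normsq R d) x = 1.
Proof.
rewrite /normsq eval_sphere_sum -[RHS](sphere_normsq x); apply: eq_bigr => i _.
by rewrite /eval_sphere rmorphXn/= mpoly.mevalXU.
Qed.

Definition sphere_int p := \int[omega]_x eval_sphere p x.

Lemma sphere_intD p q : sphere_int (p + q) = sphere_int p + sphere_int q.
Proof.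
rewrite /sphere_int -RintegralD//; try exact: integrable_eval_sphere.
by apply: eq_Rintegral => x _; rewrite eval_sphereD.
Qed.

Lemma sphere_intZ c p : sphere_int (c *: p) = c * sphere_int p.
Proof.
rewrite /sphere_int -RintegralZl//; last exact: integrable_eval_sphere.
by apply: eq_Rintegral => x _; rewrite eval_sphereZ.
Qed.

Lemma sphere_int_sum (I : Type) (r : seq I) (Q : pred I) (F : I -> P) :
  sphere_int (\sum_(k <- r | Q k) F k) = \sum_(k <- r | Q k) sphere_int (F k).
Proof.
apply: (big_morph _ sphere_intD).
by rewrite -[0 in LHS](scale0r 0) sphere_intZ mul0r.
Qed.

Lemma ip_eval_sphere p q : ip (eval_sphere p : S -> R) (eval_sphere q) = sphere_int (p * q).
Proof. by apply: eq_Rintegral => x _; rewrite eval_sphereM. Qed.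

Lemma sphere_int_angularM l k p q i j : p \is homog l -> q \is homog k ->
  sphere_int (angular i j p * q) = - sphere_int (p * angular i j q).
Proof.
move=> hp hq; have := surface_int_angular i j (mpoly.dhomogM hp hq).
rewrite -/(sphere_int _) angularM sphere_intD => /eqP.
by rewrite addr_eq0 => /eqP.
Qed.

Lemma harmonic_orthogonal l k p q : (0 < d)%N -> solid_harmonic l p -> solid_harmonic k q ->
  l != k -> sphere_int (p * q) = 0.
Proof.
move=> d0 [hp lp] [hq lq] lk.
have H : sphere_int ((\sum_i \sum_j angular i j (angular i j p)) * q) =
    sphere_int (p * (\sum_i \sum_j angular i j (angular i j q))).
  rewrite mulr_suml mulr_sumr !sphere_int_sum; apply: eq_bigr => i _.
  rewrite mulr_suml mulr_sumr !sphere_int_sum; apply: eq_bigr => j _.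
  rewrite (sphere_int_angularM _ _ (dhomog_angular i j hp) hq).
  by rewrite (sphere_int_angularM _ _ hp (dhomog_angular i j hq)) opprK.
move: H; rewrite (casimir hp lp) (casimir hq lq) -scalerAl -scalerAr !sphere_intZ.
move=> /eqP; rewrite -subr_eq0 -mulrBl mulf_eq0 => /orP[|/eqP//].
rewrite opprK addrC subr_eq0 eqr_nat => /eqP h; exfalso; move/eqP: lk; apply.
(* For d > 0 the eigenvalue l (l + d - 1) is strictly increasing in l. *)
by case: (ltngtP l k) => // lk; nia.
Qed.

Variables (Z : nat -> nat) (Y : forall l, 'I_(Z l) -> S -> R).
Hypothesis hY : forall l, orthonormal_basis (spherical_harmonics l) (@Y l).
Hypothesis d0 : (0 < d)%N.

Lemma basis_polynomial l : exists Q : 'I_(Z l) -> P,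
  forall k, solid_harmonic l (Q k) /\ Y k = eval_sphere (Q k).
Proof.
have h : forall k : 'I_(Z l), exists q, solid_harmonic l q /\ Y k = eval_sphere q.
  move=> k; have [q hq <-] := onb_mem (hY l) k.
  by exists q.
by have [Q hQ] := choice h; exists Q.
Qed.

Lemma basis_eval l (k : 'I_(Z l)) : exists q, solid_harmonic l q /\ Y k = eval_sphere q.
Proof. by have [q hq <-] := onb_mem (hY l) k; exists q. Qed.

Lemma ip_basis_ne l1 l2 (k1 : 'I_(Z l1)) (k2 : 'I_(Z l2)) : l1 != l2 ->
  ip (Y k1) (Y k2) = 0.
Proof.
have [q1 [h1 ->]] := basis_eval k1; have [q2 [h2 ->]] := basis_eval k2.
by rewrite ip_eval_sphere; exact: harmonic_orthogonal.
Qed.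

(** A linear dependence among the polynomials restricts to one among the orthonormal functions
    [Y k], whose coefficients must vanish. *)
Lemma basis_card l : (Z l <= 2 * l.+1 ^ d.-1)%N.
Proof.
rewrite leqNgt; apply/negP => lt.
have [Q hQ] := basis_polynomial l.
have [c [k ck] cQ] := harmonic_dependent d0 (fun k => (hQ k).1) lt.
move/eqP: ck; apply.
have : ip (eval_sphere (\sum_k c k *: Q k)) (Y k) = 0.
  rewrite cQ /ip; rewrite (_ : (fun _ => _) = cst 0) ?Rintegral_cst ?mul0r//.
  by apply/funext => x; rewrite /eval_sphere mpoly.meval0 mul0r.
rewrite (hQ k).2 ip_eval_sphere mulr_suml sphere_int_sum (bigD1 k)//= big1.
  rewrite addr0 -scalerAl sphere_intZ -ip_eval_sphere -(hQ k).2.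
  by rewrite (onb_orthonormal (hY l)) eqxx mulr1.
move=> i ik; rewrite -scalerAl sphere_intZ -ip_eval_sphere -(hQ k).2 -(hQ i).2.
by rewrite (onb_orthonormal (hY l)) (negPf ik) mulr0.
Qed.

Lemma harmonic_expand l p : solid_harmonic l p -> exists c : 'I_(Z l) -> R,
  (forall k, c k = ip (eval_sphere p) (Y k)) /\
  forall x, eval_sphere p x = \sum_k c k * Y k x.
Proof.
move=> hp.
have [c cE] : exists c : 'I_(Z l) -> R, eval_sphere p = fun x => \sum_k c k * Y k x.
  by apply: (onb_span (hY l)); exists p.
exists c; split; last by move=> x; rewrite cE.
move=> k; have [Q hQ] := basis_polynomial l.
have -> : eval_sphere p = eval_sphere (\sum_k c k *: Q k) :> (S -> R).
  apply/funext => x; rewrite cE eval_sphere_sum; apply: eq_bigr => i _.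
  by rewrite eval_sphereZ (hQ i).2.
rewrite (hQ k).2 ip_eval_sphere mulr_suml sphere_int_sum (bigD1 k)//= big1.
  rewrite addr0 -scalerAl sphere_intZ -ip_eval_sphere -(hQ k).2.
  by rewrite (onb_orthonormal (hY l)) eqxx mulr1.
move=> i ik; rewrite -scalerAl sphere_intZ -ip_eval_sphere -(hQ k).2 -(hQ i).2.
by rewrite (onb_orthonormal (hY l)) (negPf ik) mulr0.
Qed.

(** Extends the vanishing of a homogeneous polynomial from the sphere to the whole space. *)
Lemma sphere_ray (w : 'I_d.+1 -> R) :
  exists c (u : S), forall i, w i = c * \val u ord0 i.
Proof.
pose t : d.+1.-tuple RR := [tuple w i | i < d.+1].
by exists (tnorm t), (radial t) => i; rewrite -tnth_radial tnth_mktuple.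
Qed.

(* The operators [angular i j] preserve the space of harmonics, where their matrix
   in the basis Y is antisymmetric, so they annihilate the sum of squares. *)
Lemma addition_theorem l x : \sum_(k < Z l) Y k x ^+ 2 = (Z l)%:R / area R d.
Proof.
have [Q hQ] := basis_polynomial l.
pose K := \sum_k Q k * Q k.
have KE y : eval_sphere K y = \sum_(k < Z l) Y k y ^+ 2.
  rewrite /K eval_sphere_sum; apply: eq_bigr => k _.
  by rewrite eval_sphereM -(hQ k).2 expr2.
have hK : K \is homog (2 * l)%N.
  by rewrite mul2n -addnn; apply: rpred_sum => k _; apply: mpoly.dhomogM; exact: (hQ k).1.1.
have rK i j (y : S) : eval_sphere (angular i j K) y = 0.
  have hr k : solid_harmonic l (angular i j (Q k)).
    split; first exact: dhomog_angular (hQ k).1.1.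
    by rewrite laplacian_angular (hQ k).1.2 /angular !mpoly.mderiv0 !mulr0 subrr.
  have -> : eval_sphere (angular i j K) y =
      \sum_(k < Z l) \sum_(m < Z l) 2 *
        (ip (eval_sphere (angular i j (Q k))) (Y m) * (Y k y * Y m y)).
    rewrite /K angular_sum eval_sphere_sum; apply: eq_bigr => k _.
    rewrite angularM eval_sphereD !eval_sphereM mulrC -mulr2n -[LHS]mulr_natl -mulr_sumr.
    have [c [cE cE']] := harmonic_expand (hr k).
    congr (_ * _); rewrite cE' -(hQ k).2 mulr_sumr; apply: eq_bigr => m _.
    by rewrite cE; ring.
  (* Twice the double sum is the sum plus its transpose, where antisymmetry cancels the entries (k,
     m) and (m, k). *)
  apply/eqP; rewrite -[_ == 0](mulrn_eq0 _ 2)/= mulr2n; apply/eqP.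
  rewrite {2}exchange_big -big_split big1//= => k _.
  rewrite -big_split big1//= => m _.
  rewrite !(hQ k).2 !(hQ m).2 !ip_eval_sphere.
  rewrite (sphere_int_angularM _ _ (hQ k).1.1 (hQ m).1.1) [Q k * _]mulrC; ring.
have rK0 i j w : mpoly.meval w (angular i j K) = 0.
  have [c [u wu]] := sphere_ray w.
  rewrite (dhomog_meval (dhomog_angular i j hK) wu).
  by have := rK i j u; rewrite /eval_sphere => ->; rewrite mulr0.
have Kcst y : eval_sphere K y = eval_sphere K x.
  apply: (homog_angular_invariant hK rK0); exact: eval_sphere_normsq.
have : sphere_int K = (Z l)%:R.
  rewrite sphere_int_sum (eq_bigr (fun=> 1)) ?sumr_const ?card_ord// => k _.
  by rewrite -ip_eval_sphere -(hQ k).2 (onb_orthonormal (hY l)) eqxx.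
rewrite -KE /sphere_int; under eq_Rintegral do rewrite Kcst.
by rewrite Rintegral_cst// -/(area R d) => <-; rewrite mulfK// gt_eqF// area_gt0.
Qed.

End SphericalPolynomials.

(** * Inequalities for finite sums *)

Section FiniteSums.
Variable R : realType.

Lemma cauchy_schwarz_sum (I : finType) (a b : I -> R) :
  (\sum_i a i * b i) ^+ 2 <= (\sum_i a i ^+ 2) * (\sum_i b i ^+ 2).
Proof.
set S := \sum_i _ * _; set A := \sum_i a i ^+ 2; set B := \sum_i b i ^+ 2.
have B0 : 0 <= B by apply: sumr_ge0 => i _; exact: sqr_ge0.
have [b0|Bn0] := eqVneq B 0.
  have bi i : b i = 0.
    apply/eqP; rewrite -sqrf_eq0; move/eqP: b0; rewrite psumr_eq0.
      by move=> /allP/(_ i (mem_index_enum _)).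
    by move=> j _; exact: sqr_ge0.
  rewrite b0 mulr0 /S big1 ?expr0n// => i _.
  by rewrite bi mulr0.
have Bp : 0 < B by rewrite lt_def Bn0.
have : 0 <= \sum_i (B * a i - S * b i) ^+ 2 by apply: sumr_ge0 => i _; exact: sqr_ge0.
have -> : \sum_i (B * a i - S * b i) ^+ 2 = B * (A * B - S ^+ 2).
  rewrite (eq_bigr (fun i => B ^+ 2 * a i ^+ 2 + - (2 * B * S) * (a i * b i)
    + S ^+ 2 * b i ^+ 2)); last by move=> i _; ring.
  by rewrite !big_split/= -!mulr_sumr -/S -/A -/B; ring.
by rewrite pmulr_rge0// subr_ge0.
Qed.

Lemma minkowski_sum (I : finType) (a b : I -> R) :
  Num.sqrt (\sum_i (a i + b i) ^+ 2) <=
  Num.sqrt (\sum_i a i ^+ 2) + Num.sqrt (\sum_i b i ^+ 2).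
Proof.
set A := \sum_i a i ^+ 2; set B := \sum_i b i ^+ 2.
have A0 : 0 <= A by apply: sumr_ge0 => i _; exact: sqr_ge0.
have B0 : 0 <= B by apply: sumr_ge0 => i _; exact: sqr_ge0.
rewrite -[leRHS]ger0_norm; last by rewrite addr_ge0// sqrtr_ge0.
rewrite -sqrtr_sqr ler_wsqrtr// sqrrD !sqr_sqrtr//.
have -> : \sum_i (a i + b i) ^+ 2 = A + (\sum_i a i * b i) *+ 2 + B.
  rewrite /A /B -sumrMnl -!big_split/=; apply: eq_bigr => i _.
  by rewrite sqrrD.
rewrite lerD2r lerD2l lerMn2r/= -sqrtrM//.
apply: (le_trans (ler_norm _)); rewrite -sqrtr_sqr ler_wsqrtr//.
exact: cauchy_schwarz_sum.
Qed.

(** Discrete comparison with the integral of x^(-e-1). With q = l/(l+1) the claim reduces to q^(-e)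
    >= 1 + e/(l+1), which follows from ln q <= -1/(l+1) and exp y >= 1 + y. *)
Lemma powR_telescope (e : R) l : 0 < e -> (0 < l)%N ->
  l.+1%:R `^ (- e - 1) <= e^-1 * (l%:R `^ (- e) - l.+1%:R `^ (- e)).
Proof.
move=> e0 l0.
have lp : 0 < l%:R :> R by rewrite ltr0n.
have lp1 : 0 < l.+1%:R :> R by rewrite ltr0n.
have q : ln (l%:R / l.+1%:R) <= - l.+1%:R^-1 :> R.
  have -> : l%:R / l.+1%:R = 1 + - l.+1%:R^-1 :> R.
    by rewrite -natr1; field; rewrite natr1 gt_eqF.
  by apply: le_ln1Dx; rewrite ltrN2 invf_lt1// ltr1n ltnS.
have p0 : 0 < l.+1%:R `^ (- e) :> R by rewrite powR_gt0.
rewrite mulrC ler_pdivlMr// powRB; last by rewrite (gt_eqF lp1) implybT.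
rewrite powRr1 ?(ltW lp1)//.
have -> : l%:R `^ (- e) = l.+1%:R `^ (- e) * (l%:R / l.+1%:R) `^ (- e) :> R.
  rewrite -powRM ?divr_ge0//; congr powR.
  by rewrite mulrC divfK// gt_eqF.
rewrite -[X in _ - X]mulr1 -mulrBr -mulrA ler_pM2l//.
rewrite /powR gt_eqF ?divr_gt0// lerBrDr.
apply: le_trans (expR_ge1Dx _); rewrite addrC lerD2l mulrC.
by rewrite mulNr -mulrN ler_wpM2l ?(ltW e0)// lerNr.
Qed.

Lemma sum_powR (e : R) N M : 0 < e ->
  \sum_(N.+1 <= l < M) l.+1%:R `^ (- e - 1) <= e^-1 * N.+1%:R `^ (- e).
Proof.
move=> e0.
have [NM|MN] := leqP N.+1 M; last first.
  by rewrite big_geq ?(ltnW MN)// mulr_ge0 ?invr_ge0 ?(ltW e0) ?powR_ge0.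
apply: (@le_trans _ _ (\sum_(N.+1 <= l < M) e^-1 * (l%:R `^ (- e) - l.+1%:R `^ (- e)))).
  rewrite big_nat [leRHS]big_nat; apply: ler_sum => l /andP[Nl _].
  by apply: powR_telescope => //; exact: leq_trans Nl.
rewrite -mulr_sumr ler_wpM2l ?invr_ge0 ?(ltW e0)//.
under eq_bigr do rewrite -opprB.
rewrite sumrN telescope_sumr// opprB lerBlDr lerDl powR_ge0//.
Qed.

End FiniteSums.

(** * Square-integrable functions on the sphere *)

Section SquareIntegrable.
Variables (R : realType) (d : nat).
Local Notation S := (set_type (sphere R d)).
Local Notation omega := (surface_measure R d).
Implicit Types f g : S -> R.

Definition square_integrable f := measurable_fun setT f /\
  omega.-integrable setT (EFin \o (fun x => f x ^+ 2)).

Lemma poweR2 (y : R) : ((`|y%:E| `^ 2%R)%E = (y ^+ 2)%:E).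
Proof. by rewrite /= powR_mulrn// real_normK// num_real. Qed.

Lemma Lfun2P f : f \in Lfun omega 2%:E <-> square_integrable f.
Proof.
have E : (('N[omega]_2%:E[EFin \o f])%E `^ 2%R = \int[omega]_x (f x ^+ 2)%:E)%E.
  rewrite poweR_Lnorm ?pnatr_eq0//; apply: eq_integral => x _.
  exact: poweR2.
have fin : (\int[omega]_x (f x ^+ 2)%:E < +oo <-> 'N[omega]_2%:E[EFin \o f] < +oo)%E.
  rewrite -E; split; last exact: poweR_lty.
  by apply: lty_poweRy; rewrite pnatr_eq0.
have int : measurable_fun setT f ->
    (omega.-integrable setT (EFin \o (fun x => f x ^+ 2)) <->
    (\int[omega]_x (f x ^+ 2)%:E < +oo)%E).
  move=> mf; rewrite (eq_integral (fun x => `|(f x ^+ 2)%:E|%E)); last first.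
    by move=> x _; rewrite /= ger0_norm// sqr_ge0.
  split; first by case/integrableP.
  move=> h; apply/integrableP; split => //.
  by apply/measurable_EFinP; exact: measurable_funX.
split.
  move=> /andP[]; rewrite inE/= => mf; rewrite inE/= /finite_norm => /fin h.
  by split => //; exact/int.
move=> [mf] /(int mf)/fin h; apply/andP; split; first by rewrite inE.
by rewrite inE.
Qed.

Lemma Lnorm2E f : square_integrable f ->
  ('N[omega]_2%:E[EFin \o f] = (Num.sqrt (\int[omega]_x f x ^+ 2)%R)%:E)%E.
Proof.
move=> [mf fi]; rewrite unlock.
have -> : (\int[omega]_x `|(EFin \o f) x| `^ 2 = (\int[omega]_x f x ^+ 2)%:E)%E.
  rewrite /Rintegral fineK; last exact: integrable_fin_num fi.
  by apply: eq_integral => x _; exact: poweR2.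
rewrite poweR_EFin powR12_sqrt// Rintegral_ge0// => x _; exact: sqr_ge0.
Qed.

Lemma square_integrable_integrable f : square_integrable f ->
  omega.-integrable setT (EFin \o f).
Proof.
move=> [mf fi].
have h1 : omega.-integrable setT (EFin \o (fun x => 1 + f x ^+ 2)).
  rewrite (_ : _ \o _ = fun x => (1%:E + (f x ^+ 2)%:E)%E)//.
  apply: integrableD => //; apply: (@integrable_bounded _ _ (cst 1) 1) => //.
  by move=> x; rewrite normr1.
apply: le_integrable h1 => //; first exact/measurable_EFinP.
move=> x _; rewrite lee_fin [leRHS]ger0_norm ?addr_ge0 ?sqr_ge0//.
have [x1|x1] := leP `|f x| 1; first by rewrite (le_trans x1)// lerDl sqr_ge0.
rewrite (@le_trans _ _ (`|f x| ^+ 2))//; first by rewrite ler_eXnr// ltW.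
by rewrite real_normK ?num_real// lerDr.
Qed.

Lemma integrable_mul_eval f p : omega.-integrable setT (EFin \o f) ->
  omega.-integrable setT (EFin \o (fun x => f x * eval_sphere p x)).
Proof.
move=> fi; have [M M0 hM] := eval_sphere_bounded p.
have mf : measurable_fun setT f by apply/measurable_EFinP; case/integrableP: fi.
have h : omega.-integrable setT (EFin \o (fun x => M * `|f x|)).
  rewrite (_ : _ \o _ = fun x => (M%:E * (abse \o (EFin \o f)) x)%E)//.
  by apply: integrableZl => //; exact: integrable_abse.
apply: le_integrable h => //.
  by apply/measurable_EFinP; apply: measurable_funM => //; exact: measurable_eval_sphere.
move=> x _; rewrite lee_fin normrM mulrC.
by rewrite [leRHS]ger0_norm ?mulr_ge0// ler_wpM2r.
Qed.

Lemma square_integrable_eval p : square_integrable (eval_sphere p : S -> R).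
Proof.
split; first exact: measurable_eval_sphere.
rewrite (_ : (fun _ => _) = eval_sphere (p * p)); first exact: integrable_eval_sphere.
by apply/funext => x; rewrite eval_sphereM expr2.
Qed.

Lemma ip_oppl f p : omega.-integrable setT (EFin \o f) ->
  ip (\- f) (eval_sphere p) = - ip f (eval_sphere p).
Proof.
move=> fi; rewrite /ip -mulN1r -RintegralZl//; last exact: integrable_mul_eval.
by apply: eq_Rintegral => x _; rewrite /= mulN1r mulNr.
Qed.

Lemma ip_subl f g p : omega.-integrable setT (EFin \o f) ->
  omega.-integrable setT (EFin \o g) ->
  ip (f \- g) (eval_sphere p) = ip f (eval_sphere p) - ip g (eval_sphere p).
Proof.
move=> fi gi; rewrite /ip -RintegralB//; try exact: integrable_mul_eval.
by apply: eq_Rintegral => x _; rewrite /= mulrBl.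
Qed.

End SquareIntegrable.

(** * Harmonic expansions of polynomials and L2 functions *)

Section Expansions.
Variables (R : realType) (d : nat).
Local Notation P := (mpoly.mpoly d.+1 R).
Local Notation S := (set_type (sphere R d)).
Local Notation omega := (surface_measure R d).
Local Notation homog l := (mpoly.ishomog1 l mpoly.mdeg).
Variables (Z : nat -> nat) (Y : forall l, 'I_(Z l) -> S -> R).
Hypothesis hY : forall l, orthonormal_basis (spherical_harmonics l) (@Y l).
Hypothesis d0 : (0 < d)%N.
Local Notation coeffs := (forall l, 'I_(Z l) -> R).
Implicit Types (f g : S -> R) (c : coeffs).

Definition expansion n c : S -> R :=
  fun x => \sum_(l < n.+1) \sum_(k < Z l) c l k * @Y l k x.

Definition hat f : coeffs := fun l k => ip f (@Y l k).

Definition basis_poly l : 'I_(Z l) -> P := projT1 (cid (basis_polynomial hY l)).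

Lemma basis_poly_harmonic l k : solid_harmonic l (@basis_poly l k).
Proof. by rewrite /basis_poly; case: cid => Q /= hQ; exact: (hQ k).1. Qed.

Lemma basis_polyE l k : @Y l k = eval_sphere (@basis_poly l k).
Proof. by rewrite /basis_poly; case: cid => Q /= hQ; exact: (hQ k).2. Qed.

Definition expansion_poly n c : P :=
  \sum_(l < n.+1) \sum_(k < Z l) c l k *: @basis_poly l k.

Lemma expansionE n c : expansion n c = eval_sphere (expansion_poly n c).
Proof.
apply/funext => x; rewrite /expansion /expansion_poly eval_sphere_sum.
apply: eq_bigr => l _; rewrite eval_sphere_sum; apply: eq_bigr => k _.
by rewrite eval_sphereZ -basis_polyE.
Qed.

Lemma msize_homog l (p : P) : p \is homog l -> (mpoly.mmeasure mpoly.mdeg p <= l.+1)%N.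
Proof.
move=> hp; rewrite mpoly.mmeasureE; apply/bigmax_leqP_seq => m mp _.
by rewrite (mpoly.dhomog_mf hp mp).
Qed.

Lemma expansion_poly_space n c : poly_space n (expansion n c).
Proof.
rewrite expansionE; exists (expansion_poly n c) => //=.
apply: (leq_trans (mpoly.mmeasure_sum _ _ _ _)); apply/bigmax_leqP => l _.
apply: (leq_trans (mpoly.mmeasure_sum _ _ _ _)); apply/bigmax_leqP => k _.
apply: (leq_trans (mpoly.mmeasureZ_le _ _ _)).
apply: (leq_trans (msize_homog (basis_poly_harmonic k).1)).
by have := ltn_ord l.
Qed.

Lemma hat_expansion n c l k : hat (expansion n c) k = if (l <= n)%N then c l k else 0.
Proof.
rewrite /hat expansionE (basis_polyE k) ip_eval_sphere /expansion_poly mulr_suml sphere_int_sum.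
have z (l' : 'I_n.+1) : (l' : nat) != l ->
    sphere_int ((\sum_(k' < Z l') c l' k' *: basis_poly k') * basis_poly k) = 0.
  move=> ll; rewrite mulr_suml sphere_int_sum big1// => k' _.
  rewrite -scalerAl sphere_intZ -ip_eval_sphere -!basis_polyE.
  by rewrite (ip_basis_ne hY d0)// mulr0.
case: ifPn => ln; last first.
  by rewrite big1// => l' _; apply: z; apply: contraNneq ln => <-; have := ltn_ord l'.
have ln' : (l < n.+1)%N by [].
rewrite (bigD1 (Ordinal ln'))//= [X in _ + X]big1 ?addr0; last first.
  by move=> l' ll; apply: z; apply: contra ll => /eqP h; apply/eqP/val_inj.
rewrite mulr_suml sphere_int_sum (bigD1 k)//= big1 ?addr0.
  rewrite -scalerAl sphere_intZ -ip_eval_sphere -!basis_polyE.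
  by rewrite (onb_orthonormal (hY l)) eqxx mulr1.
move=> k' kk; rewrite -scalerAl sphere_intZ -ip_eval_sphere -!basis_polyE.
by rewrite (onb_orthonormal (hY l)) (negPf kk) mulr0.
Qed.

Definition in_span n f := exists c, f = expansion n c.

Lemma in_spanD n f g : in_span n f -> in_span n g -> in_span n (fun x => f x + g x).
Proof.
move=> [c1 ->] [c2 ->]; exists (fun l k => c1 l k + c2 l k); apply/funext => x.
rewrite /expansion -big_split; apply: eq_bigr => l _; rewrite -big_split.
by apply: eq_bigr => k _; rewrite mulrDl.
Qed.

Lemma in_span0 n : in_span n (fun=> 0).
Proof.
exists (fun l k => 0); apply/funext => x; rewrite /expansion big1// => l _.
by rewrite big1// => k _; rewrite mul0r.
Qed.

Lemma in_span_sum n (I : Type) (r : seq I) (F : I -> S -> R) :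
  (forall i, in_span n (F i)) -> in_span n (fun x => \sum_(i <- r) F i x).
Proof.
move=> hF; elim: r => [|i r IH].
  rewrite (_ : (fun _ => _) = fun=> 0); first exact: in_span0.
  by apply/funext => x; rewrite big_nil.
rewrite (_ : (fun _ => _) = fun x => F i x + \sum_(i <- r) F i x).
  by apply: in_spanD.
by apply/funext => x; rewrite big_cons.
Qed.

Lemma in_span_harmonic n l p : (l <= n)%N -> solid_harmonic l p ->
  in_span n (eval_sphere p).
Proof.
move=> ln hp; have [c [_ cE]] := harmonic_expand hY hp.
(* These coefficients live in degree l only. The indices k and k' have different types, so they are
   compared through [val]. *)
exists (fun l' k' => \sum_(k < Z l) c k * ((l' == l) && (val k' == val k))%:R).
apply/funext => x; rewrite cE /expansion.
have ln' : (l < n.+1)%N by [].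
rewrite (bigD1 (Ordinal ln'))//= [X in _ + X]big1 ?addr0; last first.
  move=> l' ll; rewrite big1// => k' _; rewrite big1 ?mul0r// => k _.
  have -> : ((l' : nat) == l) = false.
    by apply/negP => /eqP h; move/eqP: ll; apply; exact/val_inj.
  by rewrite mulr0.
apply: eq_bigr => k _; rewrite eqxx/= (bigD1 k)//= eqxx mulr1 big1 ?addr0// => k' kk.
have -> : ((k : nat) == k') = false.
  by apply/negP => /eqP h; move/eqP: kk; apply; exact/esym/val_inj.
by rewrite mulr0.
Qed.

(** Each homogeneous component is a sum of powers of [normsq] times harmonic forms of no larger
    degree, and [normsq] is 1 on the sphere. *)
Lemma poly_space_span n f : poly_space n f -> in_span n f.
Proof.
move=> [p /= hp <-].
rewrite (mpoly.pihomog_partitionE hp).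
rewrite (_ : eval_sphere _ = fun x => \sum_(e < n.+1) eval_sphere (mpoly.pihomog mpoly.mdeg e p) x).
  apply: in_span_sum => e.
  have he := mpoly.pihomogP mpoly.mdeg e p.
  (* A form of degree e < 2 (e + 1) does not survive e + 1 Laplacians. *)
  have low : iter e.+1 (@laplacian R d) (mpoly.pihomog mpoly.mdeg e p) = 0.
    by apply: (iter_laplacian_low he); rewrite mulnS; lia.
  have [h [hh ->]] := harmonic_decomposition he low.
  rewrite (_ : eval_sphere _ = fun x => \sum_(j < e.+1) eval_sphere (h j) x).
    apply: in_span_sum => j; apply: in_span_harmonic (hh j).
    by have := ltn_ord e; lia.
  apply/funext => x; rewrite eval_sphere_sum; apply: eq_bigr => j _.
  rewrite eval_sphereM; have -> : eval_sphere (normsq R d ^+ j) x = 1.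
    elim: (nat_of_ord j) => [|i IH]; first by rewrite expr0 /eval_sphere mpoly.meval1.
    by rewrite exprS eval_sphereM eval_sphere_normsq IH mulr1.
  by rewrite mul1r.
by apply/funext => x; rewrite eval_sphere_sum.
Qed.

Lemma poly_space_expand n f : poly_space n f -> f = expansion n (hat f).
Proof.
move=> /poly_space_span[c ->]; apply/funext => x; apply: eq_bigr => l _.
by apply: eq_bigr => k _; rewrite hat_expansion -ltnS ltn_ord.
Qed.

Lemma ip_expansion_r f n c : omega.-integrable setT (EFin \o f) ->
  ip f (expansion n c) = \sum_(l < n.+1) \sum_(k < Z l) c l k * hat f k.
Proof.
move=> fi; rewrite /hat.
have h l (k : 'I_(Z l)) : c l k * ip f (@Y l k) = ip f (eval_sphere (c l k *: basis_poly k)).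
  rewrite /ip -RintegralZl//; last first.
    by rewrite (basis_polyE k); exact: integrable_mul_eval.
  by apply: eq_Rintegral => x _; rewrite eval_sphereZ -basis_polyE mulrCA.
have hs (I : Type) (r : seq I) (F : I -> P) :
    ip f (eval_sphere (\sum_(i <- r) F i)) = \sum_(i <- r) ip f (eval_sphere (F i)).
  elim: r => [|i r IH].
    rewrite !big_nil /ip (_ : (fun _ => _) = cst 0) ?Rintegral_cst ?mul0r//.
    by apply/funext => x; rewrite /eval_sphere mpoly.meval0 mulr0.
  rewrite !big_cons -IH /ip -RintegralD//; try exact: integrable_mul_eval.
  by apply: eq_Rintegral => x _; rewrite eval_sphereD mulrDr.
rewrite expansionE /expansion_poly hs; apply: eq_bigr => l _.
by rewrite hs; apply: eq_bigr => k _; rewrite h.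
Qed.

Lemma ip_expansion n c c' : ip (expansion n c) (expansion n c') =
  \sum_(l < n.+1) \sum_(k < Z l) c l k * c' l k.
Proof.
rewrite ip_expansion_r; last by rewrite expansionE; exact: integrable_eval_sphere.
apply: eq_bigr => l _; apply: eq_bigr => k _.
by rewrite hat_expansion -ltnS ltn_ord mulrC.
Qed.

Lemma bessel f n : square_integrable f ->
  \sum_(l < n.+1) \sum_(k < Z l) hat f k ^+ 2 <= \int[omega]_x f x ^+ 2.
Proof.
move=> hf; have fi := square_integrable_integrable hf.
pose e := expansion n (hat f).
have E : \sum_(l < n.+1) \sum_(k < Z l) hat f k ^+ 2 = ip f e.
  by rewrite ip_expansion_r//; apply: eq_bigr => l _; apply: eq_bigr => k _; rewrite expr2.
have E2 : ip e e = ip f e.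
  by rewrite ip_expansion -E; apply: eq_bigr => l _; apply: eq_bigr => k _; rewrite expr2.
have i1 : omega.-integrable setT (EFin \o (fun x => f x ^+ 2)) by case: hf.
have i2 : omega.-integrable setT (EFin \o (fun x => f x * e x)).
  by rewrite /e expansionE; exact: integrable_mul_eval.
have i3 : omega.-integrable setT (EFin \o (fun x => e x * e x)).
  by rewrite /e expansionE; apply: integrable_mul_eval; exact: integrable_eval_sphere.
have i4 : omega.-integrable setT (EFin \o (fun x => 2 * (f x * e x))).
  rewrite (_ : _ \o _ = fun x => (2%:E * (f x * e x)%:E)%E)//.
  by apply: integrableZl.
have i5 : omega.-integrable setT (EFin \o (fun x => f x ^+ 2 - 2 * (f x * e x))).
  rewrite (_ : _ \o _ = fun x => ((f x ^+ 2)%:E - (2 * (f x * e x))%:E)%E)//.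
  by apply: integrableB.
have : 0 <= \int[omega]_x (f x ^+ 2 - 2 * (f x * e x) + e x * e x).
  apply: Rintegral_ge0 => x _; rewrite (_ : _ + _ = (f x - e x) ^+ 2) ?sqr_ge0//.
  by ring.
rewrite RintegralD// RintegralB// RintegralZl// -/(ip f e) -/(ip e e) E2 -E.
lra.
Qed.

End Expansions.

(** * Uniform convergence of harmonic expansions *)

Section Peak.
Variables (R : realType) (d : nat).
Local Notation P := (mpoly.mpoly d.+1 R).
Local Notation S := (set_type (sphere R d)).
Local Notation omega := (surface_measure R d).
Implicit Types (f g : S -> R) (x y : S).

Lemma continuous_cap f x (a : R) : continuous f -> a < f x ->
  exists2 e, 0 < e & forall y, cap x e y -> a < f y.
Proof.
move=> cf ax.
have h : nbhs x [set y : S | a < f y].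
  exact: (@cvgr_gt R S (nbhs x) (nbhs_filter x) f (f x) (cf x) a ax).
have [e /= e0 he] := (@nbhs_ballP R S x _).1 h.
exists e => // y hy; apply: he.
split => //= i j; rewrite (ord1 i) /ball/= distrC; exact: hy.
Qed.

(** This is (1 + x.y)/2. On the sphere it equals |x + y|^2/4 = 1 - |x - y|^2/4, so it lies in [0, 1]
    and reaches 1 only at x. *)
Definition peak_poly x : P :=
  2^-1 *: (1 + \sum_i \val x ord0 i *: mpoly.mpolyX R (mpoly.mnm1 i)).

Definition peak x y := 1 - (\sum_i (\val y ord0 i - \val x ord0 i) ^+ 2) / 4.

Lemma eval_peak_poly x y : eval_sphere (peak_poly x) y = peak x y.
Proof.
rewrite /peak_poly eval_sphereZ eval_sphereD eval_sphere_sum.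
have -> : eval_sphere (1 : P) y = 1 by rewrite /eval_sphere mpoly.meval1.
under eq_bigr do rewrite eval_sphereZ /eval_sphere mpoly.mevalXU.
rewrite /peak.
have -> : \sum_i (\val y ord0 i - \val x ord0 i) ^+ 2 =
    2 - 2 * \sum_i \val x ord0 i * \val y ord0 i.
  rewrite (eq_bigr (fun i => (\val y ord0 i) ^+ 2 + (\val x ord0 i) ^+ 2 +
      (- 2) * (\val x ord0 i * \val y ord0 i))); last by move=> i _; ring.
  by rewrite !big_split/= !sphere_normsq -mulr_sumr; ring.
by field.
Qed.

Lemma msize_peak_poly x : (mpoly.mmeasure mpoly.mdeg (peak_poly x) <= 2)%N.
Proof.
apply: (leq_trans (mpoly.mmeasureZ_le _ _ _)).
apply: (leq_trans (mpoly.mmeasureD_le _ _ _)).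
rewrite geq_max mpoly.mmeasure1/=.
apply: (leq_trans (mpoly.mmeasure_sum _ _ _ _)); apply/bigmax_leqP => i _.
apply: (leq_trans (mpoly.mmeasureZ_le _ _ _)).
by rewrite mpoly.mmeasureX /= mpoly.mdeg1.
Qed.

Lemma msizeM_leq (p q : P) a b : (mpoly.mmeasure mpoly.mdeg p <= a.+1)%N ->
  (mpoly.mmeasure mpoly.mdeg q <= b.+1)%N -> (mpoly.mmeasure mpoly.mdeg (p * q) <= (a + b).+1)%N.
Proof.
move=> pa qb.
have [->|p0] := eqVneq p 0; first by rewrite mul0r mpoly.mmeasure0.
have [->|q0] := eqVneq q 0; first by rewrite mulr0 mpoly.mmeasure0.
rewrite mpoly.msizeM// -subn1 leq_subLR; apply: leq_trans (leq_add pa qb) _; lia.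
Qed.

Lemma msize_peak_polyX x K : (mpoly.mmeasure mpoly.mdeg (peak_poly x ^+ K) <= K.+1)%N.
Proof.
elim: K => [|K IH]; first by rewrite expr0 mpoly.mmeasure1.
by rewrite exprS; apply: (@msizeM_leq _ _ 1 K) => //; exact: msize_peak_poly.
Qed.

Lemma peak_ge0 x y : 0 <= peak x y.
Proof.
rewrite -eval_peak_poly /peak_poly eval_sphereZ eval_sphereD eval_sphere_sum.
have -> : eval_sphere (1 : P) y = 1 by rewrite /eval_sphere mpoly.meval1.
under eq_bigr do rewrite eval_sphereZ /eval_sphere mpoly.mevalXU.
have : 0 <= \sum_i (\val x ord0 i + \val y ord0 i) ^+ 2.
  by apply: sumr_ge0 => i _; exact: sqr_ge0.
rewrite (eq_bigr (fun i => (\val y ord0 i) ^+ 2 + (\val x ord0 i) ^+ 2 +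
    2 * (\val x ord0 i * \val y ord0 i))); last by move=> i _; ring.
by rewrite !big_split/= !sphere_normsq -mulr_sumr; lra.
Qed.

Lemma peak_outside x y e : 0 <= e -> ~ cap x e y -> peak x y <= 1 - e ^+ 2 / 4.
Proof.
move=> e0 /existsNP[i /negP]; rewrite -leNgt => hi.
rewrite /peak lerB// ler_pM2r ?invr_gt0//.
rewrite (bigD1 i)//= ler_wpDr ?sumr_ge0//; first by move=> j _; exact: sqr_ge0.
by rewrite -[leRHS]real_normK ?num_real// ler_pXn2r// nnegrE.
Qed.

Lemma peak_inside x y e : 0 <= e -> cap x e y -> 1 - d.+1%:R * e ^+ 2 / 4 <= peak x y.
Proof.
move=> e0 hy; rewrite /peak lerB// ler_pM2r ?invr_gt0//.
rewrite mulr_natl -[X in _ *+ X]card_ord -sumr_const; apply: ler_sum => i _.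
by rewrite -real_normK ?num_real// ler_pXn2r// ?nnegrE// ltW//; exact: hy.
Qed.

Lemma expn_unbounded (r B : R) : 1 < r -> exists K : nat, B < r ^+ K.
Proof.
move=> r1; pose h := r - 1; have h0 : 0 < h by rewrite subr_gt0.
have bern K : 1 + K%:R * h <= r ^+ K.
  elim: K => [|K IH]; first by rewrite mul0r addr0 expr0.
  rewrite exprS -natr1; apply: (@le_trans _ _ (r * (1 + K%:R * h))); last first.
    by rewrite ler_pM2l// (lt_trans _ r1).
  rewrite (_ : r = 1 + h); last by rewrite /h; ring.
  have : 0 <= K%:R * h * h by rewrite !mulr_ge0// ltW.
  by lra.
exists (Num.truncn (`|B| / h)).+1; apply: lt_le_trans (bern _).
have := truncnS_gt (`|B| / h); rewrite ltr_pdivrMr// => hB.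
by have := ler_norm B; lra.
Qed.

Lemma ae_Rintegral_ge0 f : measurable_fun setT f ->
  {ae omega, forall x, 0 <= f x} -> 0 <= \int[omega]_x f x.
Proof.
move=> mf f0; rewrite /Rintegral (ae_eq_integral (fun x => (Num.max 0 (f x))%:E))//.
- by apply: fine_ge0; apply: integral_ge0 => x _; rewrite lee_fin le_max lexx.
- exact/measurable_EFinP.
- by apply/measurable_EFinP; apply: measurable_maxr.
- by apply: filterS f0 => x fx _; rewrite max_r.
Qed.

Lemma continuous_eval_sphere p : continuous (eval_sphere p : S -> R).
Proof.
have cc i : continuous (fun x : S => \val x ord0 i : R).
  move=> x; apply/(@cvgrPdist_lt _ _ _ (nbhs x) (nbhs_filter x)) => e e0.
  by apply/(@nbhs_ballP R S x _); exists e => //= y [_ /(_ ord0 i)].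
have cst_c (c : R) : continuous (fun _ : S => c).
  by move=> x; exact: (@cvg_cst _ _ _ (nbhs x) (nbhs_filter x)).
have cD (f g : S -> R) : continuous f -> continuous g -> continuous (fun x => f x + g x).
  by move=> cf cg x; exact: (@cvgD _ _ _ (nbhs x) (nbhs_filter x) _ _ _ _ (cf x) (cg x)).
have cM (f g : S -> R) : continuous f -> continuous g -> continuous (fun x => f x * g x).
  by move=> cf cg x; exact: (@cvgM _ _ (nbhs x) (nbhs_filter x) _ _ _ _ (cf x) (cg x)).
have -> : eval_sphere p = fun x : S => \sum_(m <- mpoly.msupp p)
    mpoly.mcoeff m p * \prod_(i <- index_enum 'I_d.+1) (\val x ord0 i) ^+ (m i).
  by apply/funext => x; rewrite /eval_sphere mpoly.mevalE.
elim: (mpoly.msupp p) => [|m r IH].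
  by rewrite (_ : (fun _ => _) = fun=> 0)//; apply/funext => x; rewrite big_nil.
under eq_fun do rewrite big_cons; apply: (cD) => //; apply: (cM) => //.
elim: (index_enum _) => [|i u IHu].
  by rewrite (_ : (fun _ => _) = fun=> 1)//; apply/funext => x; rewrite big_nil.
under eq_fun do rewrite big_cons; apply: (cM) => //.
elim: (m i) => [|k IHk]; first exact: cst_c.
by under eq_fun do rewrite exprS; exact: cM.
Qed.

(* If f0 - p N exceeded tau by more than some de > 0 at x0, then f - p M >= de near
   x0 for all M >= N. But f - p M is orthogonal to the powers of [peak_poly x0] of
   exponent at most M, which for large M concentrate near x0. *)
Lemma peak_upper f f0 (p : nat -> P) N (tau : R) x0 :
  omega.-integrable setT (EFin \o f) -> {ae omega, forall x, f x = f0 x} ->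
  continuous f0 ->
  (forall M q, (mpoly.mmeasure mpoly.mdeg q <= M.+1)%N ->
    ip f (eval_sphere q) = ip (eval_sphere (p M)) (eval_sphere q)) ->
  (forall M x, (N <= M)%N -> `|eval_sphere (p M) x - eval_sphere (p N) x| <= tau) ->
  f0 x0 - eval_sphere (p N) x0 <= tau.
Proof.
move=> fi ff0 cf0 orth cauchy; rewrite leNgt; apply/negP => lt.
have tau0 : 0 <= tau by apply: le_trans (cauchy N x0 (leqnn N)).
pose g0 x := f0 x - eval_sphere (p N) x.
have lt' : tau < g0 x0 by [].
have cg0 : continuous g0.
  move=> x; have cp := @continuous_eval_sphere (p N) x.
  exact: (@cvgB _ _ _ (nbhs x) (nbhs_filter x) _ _ _ _ (cf0 x) cp).
pose de := (g0 x0 - tau) / 2.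
have de0 : 0 < de by rewrite divr_gt0// subr_gt0.
have [e1 e10 he1] : exists2 e, 0 < e & forall y, cap x0 e y -> tau + de < g0 y.
  by apply: continuous_cap => //; rewrite /de; lra.
pose e := Num.min 1 e1.
have e0 : 0 < e by rewrite lt_min ltr01.
have e1' : e <= 1 by rewrite ge_min lexx.
have he y : cap x0 e y -> tau + de < g0 y.
  move=> hy; apply: he1 => i; apply: lt_le_trans (hy i) _.
  by rewrite ge_min lexx orbT.
pose n : R := d.+1%:R.
have n1 : 1 <= n by rewrite ler1n.
(* The peak is at least q2 on the cap of radius e' and at most q1 off the cap of radius e. The
   divisor 2 n secures q1 < q2 although [peak_inside] loses a factor d + 1. *)
pose e' := e / (2 * n).
have e'0 : 0 < e' by rewrite divr_gt0// mulr_gt0// (lt_le_trans _ n1).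
have ne' : n * e' ^+ 2 <= e ^+ 2 / 4.
  rewrite /e' expr_div_n exprMn mulrA.
  rewrite ler_pdivrMr; last by rewrite mulr_gt0// ?exprn_gt0// (lt_le_trans _ n1).
  have : 0 <= e ^+ 2 * n * (n - 1).
    by rewrite mulr_ge0 ?subr_ge0// mulr_ge0 ?sqr_ge0// (le_trans ler01 n1).
  by lra.
have ee' : e' <= e.
  rewrite /e' ler_pdivrMr; last by rewrite mulr_gt0// (lt_le_trans _ n1).
  by rewrite ler_peMr ?(ltW e0)//; lra.
pose q1 := 1 - e ^+ 2 / 4; pose q2 := 1 - e ^+ 2 / 16.
have ee2 : 0 < e ^+ 2 <= 1 by rewrite exprn_gt0//= exprn_ile1// ltW.
have /andP[ee20 ee21] := ee2.
have q10 : 0 < q1 by rewrite /q1; lra.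
have q12 : q1 < q2 by rewrite /q1 /q2; lra.
(* An integrable majorant of |f - p M| valid for all M >= N at once, so that K can be fixed before
   M. *)
pose G x := `|f x| + `|eval_sphere (p N) x| + tau.
have mf : measurable_fun setT f by apply/measurable_EFinP; case/integrableP: fi.
have Gi : omega.-integrable setT (EFin \o G).
  rewrite (_ : _ \o _ = fun x => ((abse \o (EFin \o f)) x +
     (abse \o (EFin \o eval_sphere (p N))) x + (EFin \o cst tau) x)%E)//.
  apply: integrableD => //; last first.
    by apply: (@integrable_bounded _ _ (cst tau) tau) => // x; rewrite ger0_norm.
  apply: integrableD => //; apply: integrable_abse => //; exact: integrable_eval_sphere.
have G0 x : 0 <= G x by rewrite !addr_ge0.
pose V := cap x0 e'.
have mV : measurable V := measurable_cap x0 e'.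
have V0 : 0 < fine (omega V).
  apply: fine_gt0; rewrite cap_gt0//=; apply: le_lt_trans (surface_finite R d).
  by apply: le_measure; rewrite ?inE.
have q21 : 1 < q2 / q1 by rewrite ltr_pdivlMr// mul1r.
(* With this K the gain on V, at least [de * q2 ^+ K] times its measure, exceeds the possible loss
   [q1 ^+ K] times the integral of G. *)
have [K hK'] := expn_unbounded ((\int[omega]_x G x) / (de * fine (omega V))) q21.
have hK : (\int[omega]_x G x) * q1 ^+ K < de * fine (omega V) * q2 ^+ K.
  move: hK'; rewrite expr_div_n ltr_pdivlMr ?exprn_gt0// mulrAC.
  by rewrite (ltr_pdivrMr _ _ (mulr_gt0 de0 V0)) => h; rewrite [ltRHS]mulrC.
pose M := maxn N K.
have NM : (N <= M)%N by exact: leq_maxl.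
pose q := peak_poly x0 ^+ K.
have qE y : eval_sphere q y = peak x0 y ^+ K.
  by rewrite /q -eval_peak_poly /eval_sphere rmorphXn.
have qs : (mpoly.mmeasure mpoly.mdeg q <= M.+1)%N.
  by apply: leq_trans (msize_peak_polyX _ _) _; rewrite ltnS leq_maxr.
have i1 : omega.-integrable setT (EFin \o (fun x => f x * eval_sphere q x)).
  exact: integrable_mul_eval.
have i2 : omega.-integrable setT (EFin \o (fun x => eval_sphere (p M) x * eval_sphere q x)).
  by apply: integrable_mul_eval; exact: integrable_eval_sphere.
have iV : omega.-integrable setT (EFin \o (\1_V : S -> R)).
  apply: (@integrable_bounded _ _ _ 1); first exact: measurable_indic.
  by move=> x; rewrite indicE; case: (x \in V); rewrite ?normr1 ?normr0.
have i3 : omega.-integrable setT (EFin \o (fun x => de * q2 ^+ K * \1_V x)).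
  rewrite (_ : _ \o _ = fun x => ((de * q2 ^+ K)%:E * (EFin \o \1_V) x)%E)//.
  by apply: integrableZl.
have i4 : omega.-integrable setT (EFin \o (fun x => q1 ^+ K * G x)).
  rewrite (_ : _ \o _ = fun x => ((q1 ^+ K)%:E * (EFin \o G) x)%E)//.
  by apply: integrableZl.
have i12 : omega.-integrable setT
    (EFin \o (fun x => f x * eval_sphere q x - eval_sphere (p M) x * eval_sphere q x)).
  rewrite (_ : _ \o _ = fun x =>
    ((f x * eval_sphere q x)%:E - (eval_sphere (p M) x * eval_sphere q x)%:E)%E)//.
  by apply: integrableB.
have i34 : omega.-integrable setT
    (EFin \o (fun x => de * q2 ^+ K * \1_V x - q1 ^+ K * G x)).
  rewrite (_ : _ \o _ = fun x => ((de * q2 ^+ K * \1_V x)%:E - (q1 ^+ K * G x)%:E)%E)//.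
  by apply: integrableB.
(* Almost everywhere the first difference is at least the second. The first integrates to 0 by
   orthogonality, the second to a positive number by the choice of K: a contradiction. *)
have : 0 <= \int[omega]_x (f x * eval_sphere q x - eval_sphere (p M) x * eval_sphere q x
    - (de * q2 ^+ K * \1_V x - q1 ^+ K * G x)).
  apply: ae_Rintegral_ge0.
    have m12 : measurable_fun setT
      (fun x => f x * eval_sphere q x - eval_sphere (p M) x * eval_sphere q x).
      by apply/measurable_EFinP; case/integrableP: i12.
    apply: measurable_funB => //.
    by apply/measurable_EFinP; case/integrableP: i34.
  apply: filterS ff0 => x fx.
  have q0 := peak_ge0 x0 x.
  have MNx := cauchy M x NM.
  rewrite -mulrBl qE subr_ge0.
  have := pselect (cap x0 e x) => -[xU|xU].
    have gx := he x xU.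
    have fM : de <= f x - eval_sphere (p M) x.
      move: MNx gx; rewrite fx /g0 ler_norml => /andP[? ?]; lra.
    rewrite lerBlDr ler_wpDr ?mulr_ge0 ?exprn_ge0 ?(ltW q10)//.
    rewrite indicE; have [/set_mem xV|_] := boolP (x \in V); last first.
      by rewrite mulr0n mulr0 mulr_ge0 ?exprn_ge0// (le_trans (ltW de0)).
    rewrite mulr1n mulr1 ler_pM ?exprn_ge0 ?(ltW de0)//.
      by rewrite (le_trans (ltW q10))// ltW.
    rewrite lerXn2r ?nnegrE//; first by rewrite (le_trans (ltW q10))// ltW.
    apply: le_trans (peak_inside (ltW e'0) xV).
    by rewrite /q2 -/n; lra.
  have xV : x \notin V.
    by apply/negP => /set_mem xV; apply: xU => i; exact: lt_le_trans (xV i) ee'.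
  rewrite indicE (negPf xV) mulr0n mulr0 sub0r -mulNr.
  have px : peak x0 x <= q1 by exact: peak_outside (ltW e0) xU.
  have aG : `|f x - eval_sphere (p M) x| <= G x.
    rewrite /G (_ : f x - _ = f x + (- eval_sphere (p N) x) +
      - (eval_sphere (p M) x - eval_sphere (p N) x)); last by ring.
    apply: (le_trans (ler_normD _ _)); rewrite normrN lerD//.
    by apply: (le_trans (ler_normD _ _)); rewrite normrN.
  rewrite mulNr lerNl -mulNr (le_trans (ler_norm _))// normrM normrN.
  rewrite mulrC [X in X * _]ger0_norm ?exprn_ge0// ler_pM ?exprn_ge0//.
  by rewrite lerXn2r ?nnegrE// ltW.
rewrite RintegralB//.
rewrite RintegralB// [X in _ - X]RintegralB//.
rewrite -/(ip f _) -/(ip (eval_sphere (p M)) _) (orth M q qs) subrr sub0r.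
rewrite !RintegralZl// /Rintegral integral_indic// setIT.
rewrite -/(Rintegral omega setT G).
by rewrite oppr_ge0 leNgt subr_gt0 mulrC [X in _ < X]mulrAC hK.
Qed.

End Peak.

(** * Sobolev weights as powers of l + 1 *)

Section Weights.
Variables (R : realType) (d : nat).
Hypothesis d0 : (0 < d)%N.

Lemma eigenvalue_bounds l :
  l.+1%:R ^+ 2 / 2 <= 1 + eigenvalue_LB R d l <= d%:R * l.+1%:R ^+ 2.
Proof.
rewrite ler_pdivrMr// /eigenvalue_LB -natr1 -addnBA// natrM natrD natrB//.
have d1 : (1 : R) <= d%:R by rewrite ler1n.
have l0 : (0 : R) <= l%:R by rewrite ler0n.
have [D Dp Dd] : exists2 D : R, 0 <= D & d%:R = D + 1.
  by exists (d%:R - 1); rewrite ?subr_ge0// subrK.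
rewrite Dd; have h1 : 0 <= l%:R * D by rewrite mulr_ge0.
have h2 : 0 <= l%:R ^+ 2 * D by rewrite mulr_ge0// sqr_ge0.
have h3 : 0 <= (l%:R - 1) ^+ 2 :> R by rewrite sqr_ge0.
by apply/andP; split; nra.
Qed.

Lemma sobolev_weight_inv (r : R) (a : nat -> R) : 0 <= r -> sobolev_weight d r a ->
  exists c C : R, [/\ 0 < c, 0 < C & forall l,
    [/\ 0 < a l, c * l.+1%:R `^ (2 * r) <= (a l)^-1,
     (a l)^-1 <= C * l.+1%:R `^ (2 * r) & a l <= c^-1 * l.+1%:R `^ (- (2 * r))]].
Proof.
move=> r0 [c [C [c0 C0 h]]].
have dp : 0 < d%:R :> R by rewrite ltr0n.
have lp l : 0 < l.+1%:R `^ (2 * r) :> R by rewrite powR_gt0// ltr0n.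
pose u : R := 2^-1 `^ r; pose v : R := d%:R `^ r.
have u0 : 0 < u by rewrite powR_gt0.
have v0 : 0 < v by rewrite powR_gt0.
exists (u / C), (v / c); split; [by rewrite divr_gt0..|move=> l].
have /andP[h1 h2] := eigenvalue_bounds l; set L := 1 + eigenvalue_LB R d l in h1 h2 *.
have sq0 : 0 < l.+1%:R ^+ 2 :> R by rewrite exprn_gt0// ltr0n.
have L0 : 0 < L by apply: lt_le_trans h1; rewrite divr_gt0.
have Lr0 : 0 < L `^ r by rewrite powR_gt0.
have E : l.+1%:R `^ (2 * r) = (l.+1%:R ^+ 2) `^ r :> R.
  by rewrite powRrM -powR_mulrn.
have k1 : u * l.+1%:R `^ (2 * r) <= L `^ r.
  rewrite E -powRM ?(ltW sq0)//; apply: ge0_ler_powR => //;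
    rewrite ?nnegrE ?(ltW L0) ?mulr_ge0 ?invr_ge0 ?(ltW sq0)//.
  by rewrite mulrC.
have k2 : L `^ r <= v * l.+1%:R `^ (2 * r).
  rewrite E -powRM ?(ltW sq0) ?(ltW dp)//; apply: ge0_ler_powR => //;
    rewrite ?nnegrE ?(ltW L0) ?mulr_ge0 ?(ltW sq0)//.
have := h l; rewrite -/L powRN => /andP[h3 h4].
have a0 : 0 < a l by apply: lt_le_trans h3; rewrite mulr_gt0// invr_gt0.
have i1 : (a l)^-1 <= L `^ r / c.
  by rewrite -[leRHS]invrK lef_pV2 ?posrE ?invr_gt0 ?divr_gt0// invf_div.
have i2 : L `^ r / C <= (a l)^-1.
  by rewrite -[leLHS]invrK lef_pV2 ?posrE ?invr_gt0 ?divr_gt0// invf_div.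
have i3 : u / C * l.+1%:R `^ (2 * r) <= (a l)^-1.
  by apply: le_trans i2; rewrite mulrAC ler_pM2r ?invr_gt0.
split => //.
  by apply: (le_trans i1); rewrite mulrAC ler_pM2r ?invr_gt0.
rewrite powRN -invfM -[leLHS]invrK lef_pV2 ?posrE ?invr_gt0//.
by rewrite mulr_gt0// divr_gt0.
Qed.

Lemma sobolev_weight_powR (r : R) :
  sobolev_weight d r (fun l => (1 + eigenvalue_LB R d l) `^ (- r)).
Proof. by exists 1, 1; split => // l; rewrite mul1r lexx. Qed.

End Weights.

Lemma cauchy_schwarz_dep (R : realType) (Z : nat -> nat)
    (A B : forall l, 'I_(Z l) -> R) m n :
  (\sum_(m <= l < n) \sum_(k < Z l) A l k * B l k) ^+ 2 <=
  (\sum_(m <= l < n) \sum_(k < Z l) A l k ^+ 2) *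
  (\sum_(m <= l < n) \sum_(k < Z l) B l k ^+ 2).
Proof.
rewrite -[m]add0n !big_addn !big_mkord.
rewrite !(sig_big_dep xpredT (fun _ _ => true))/=.
exact: cauchy_schwarz_sum.
Qed.

(** * Pointwise distance to the truncated expansion *)

Section Pointwise.
Variables (R : realType) (d : nat).
Local Notation S := (set_type (sphere R d)).
Local Notation omega := (surface_measure R d).
Variables (Z : nat -> nat) (Y : forall l, 'I_(Z l) -> S -> R).
Hypothesis hY : forall l, orthonormal_basis (spherical_harmonics l) (@Y l).
Hypothesis d0 : (0 < d)%N.

(** Squared L2 norm of the degree-l component of f; Sobolev norms depend on f only through these
    numbers. *)
Definition energy f l := \sum_(k < Z l) hat Y f k ^+ 2.

Lemma energy_ge0 f l : 0 <= energy f l.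
Proof. by apply: sumr_ge0 => k _; exact: sqr_ge0. Qed.

Lemma expansion_diff N M c x : (N <= M)%N ->
  expansion Y M c x - expansion Y N c x =
  \sum_(N.+1 <= l < M.+1) \sum_(k < Z l) c l k * @Y l k x.
Proof.
move=> NM; rewrite /expansion.
rewrite -(big_mkord xpredT (fun l => \sum_(k < Z l) c l k * @Y l k x)).
rewrite -(big_mkord xpredT (fun l => \sum_(k < Z l) c l k * @Y l k x)).
by rewrite (big_cat_nat (n := N.+1))//= addrAC subrr add0r.
Qed.

(** Cauchy-Schwarz after moving [Num.sqrt (a l)] from the coefficients to the harmonics. One factor
    is the Sobolev tail; by the addition theorem and [basis_card] the other sums terms of order
    (l+1)^(d-1-2s), which [sum_powR] bounds by the order (N+1)^(d-2s). *)
Lemma expansion_tail (s : R) (a : nat -> R) : d%:R / 2 < s -> sobolev_weight d s a ->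
  exists2 C : R, 0 < C & forall f N M x, (N <= M)%N ->
    (expansion Y M (hat Y f) x - expansion Y N (hat Y f) x) ^+ 2 <=
    C * N.+1%:R `^ (d%:R - 2 * s) * \sum_(N.+1 <= l < M.+1) (a l)^-1 * energy f l.
Proof.
move=> ds ha.
have s0 : 0 <= s by apply: le_trans (ltW ds); rewrite divr_ge0.
have [c [C [c0 C0 h]]] := sobolev_weight_inv d0 s0 ha.
have e0 : 0 < 2 * s - d%:R by rewrite subr_gt0 mulrC -ltr_pdivrMr.
exists (c^-1 * 2 / area R d / (2 * s - d%:R)).
  by rewrite !divr_gt0 ?area_gt0// mulr_gt0// invr_gt0.
move=> f N M x NM; rewrite expansion_diff//.
under eq_bigr => l _.
  under eq_bigr => k _.
    have al : 0 < a l by case: (h l).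
    rewrite (_ : hat Y f k * Y k x = ((Num.sqrt (a l))^-1 * hat Y f k) * (Num.sqrt (a l) * Y k x)).
      over.
    by rewrite mulrACA mulVf ?mul1r// gt_eqF// sqrtr_gt0.
  over.
apply: (le_trans (cauchy_schwarz_dep _ _ _ _)); rewrite mulrC; apply: ler_pM.
- by apply: sumr_ge0 => l _; apply: sumr_ge0 => k _; exact: sqr_ge0.
- by apply: sumr_ge0 => l _; apply: sumr_ge0 => k _; exact: sqr_ge0.
- apply: (@le_trans _ _ (\sum_(N.+1 <= l < M.+1)
    (c^-1 * 2 / area R d) * l.+1%:R `^ (- (2 * s - d%:R) - 1))); last first.
    rewrite -mulr_sumr -!mulrA ler_pM2l ?invr_gt0// !mulrA.
    rewrite -!mulrA ler_pM2l// ler_pM2l ?invr_gt0 ?area_gt0//.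
    by rewrite -[d%:R - _]opprB; exact: sum_powR.
  apply: ler_sum => l _; have [al _ _ al'] := h l.
  under eq_bigr do rewrite exprMn sqr_sqrtr ?(ltW al)//.
  rewrite -mulr_sumr (addition_theorem hY).
  rewrite (_ : - (2 * s - d%:R) - 1 = - (2 * s) + d.-1%:R); last first.
    by rewrite -[in LHS](prednK d0) -natr1; ring.
  rewrite powRD; last by rewrite pnatr_eq0 implybT.
  rewrite powR_mulrn ?ler0n//.
  have hz : (Z l)%:R <= 2 * l.+1%:R ^+ d.-1 :> R.
    by rewrite -natrX -natrM ler_nat; exact: (basis_card hY d0).
  rewrite (_ : _ * _ * _ = (c^-1 * l.+1%:R `^ (- (2 * s))) *
    (2 * l.+1%:R ^+ d.-1 / area R d)); last by ring.
  apply: ler_pM => //; first exact: ltW.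
    by rewrite divr_ge0// ltW// area_gt0.
  by rewrite ler_pM2r ?invr_gt0 ?area_gt0.
- apply: ler_sum => l _; have [al _ _ _] := h l.
  rewrite /energy mulr_sumr; apply: ler_sum => k _.
  by rewrite exprMn exprVn sqr_sqrtr ?(ltW al).
Qed.

(** The bound of [expansion_tail] is uniform in M, so [peak_upper] transfers it to f0, once for f
    and once for -f to control both signs. *)
Lemma continuous_expansion_dist (s : R) (a : nat -> R) :
  d%:R / 2 < s -> sobolev_weight d s a ->
  exists2 C : R, 0 < C & forall f f0 N (tau : R) x,
    square_integrable f -> continuous_version f f0 ->
    (forall M, \sum_(N.+1 <= l < M.+1) (a l)^-1 * energy f l <= tau) ->
    (f0 x - expansion Y N (hat Y f) x) ^+ 2 <= C * N.+1%:R `^ (d%:R - 2 * s) * tau.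
Proof.
move=> ds ha; have [C C0 hC] := expansion_tail ds ha; exists C => //.
move=> f f0 N tau x hf [cf0 ff0] htau.
have fi := square_integrable_integrable hf.
set T := _ * tau.
have T0 : 0 <= T.
  rewrite !mulr_ge0 ?powR_ge0 ?(ltW C0)//.
  by apply: le_trans (htau N); rewrite big_geq.
have cauchy M y : (N <= M)%N ->
    `|expansion Y M (hat Y f) y - expansion Y N (hat Y f) y| <= Num.sqrt T.
  move=> NM; rewrite -sqrtr_sqr ler_wsqrtr//; apply: (le_trans (hC f N M y NM)).
  by rewrite ler_pM2l// mulr_gt0// powR_gt0.
(* Pairing f with a polynomial of degree at most M sees only the coefficients of f up to degree
   M. *)
have orth M q : (mpoly.mmeasure mpoly.mdeg q <= M.+1)%N ->
    ip f (eval_sphere q) = ip (expansion Y M (hat Y f)) (eval_sphere q).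
  move=> hq; have hq' : poly_space M (eval_sphere q : S -> R) by exists q.
  rewrite (poly_space_expand hY d0 hq') (ip_expansion_r hY)// (ip_expansion hY d0).
  by apply: eq_bigr => l _; apply: eq_bigr => k _; rewrite mulrC.
rewrite -real_normK ?num_real// -[leRHS]sqr_sqrtr// lerXn2r ?nnegrE ?sqrtr_ge0//.
pose p M := expansion_poly hY M (hat Y f).
have pE M : expansion Y M (hat Y f) = eval_sphere (p M) by exact: expansionE.
rewrite ler_norml; apply/andP; split; last first.
  rewrite pE; apply: (@peak_upper _ _ f f0 p N) => //.
    by move=> M q hq; rewrite -pE; exact: orth.
  by move=> M y NM; rewrite -!pE; exact: cauchy.
have pN M y : eval_sphere (- p M) y = - eval_sphere (p M) y.
  by rewrite -[- p M]scaleN1r eval_sphereZ mulN1r.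
rewrite lerNl opprB pE.
rewrite (_ : eval_sphere _ x - f0 x = (\- f0) x - eval_sphere (- p N) x).
  apply: (@peak_upper _ _ (\- f) (\- f0) (fun M => - p M) N) => //.
  - by rewrite (_ : _ \o _ = (-%E \o (EFin \o f))); first exact: integrableN.
  - by apply: filterS ff0 => y /= ->.
  - by move=> y; exact: (@cvgN _ _ _ (nbhs y) (nbhs_filter y) _ _ (cf0 y)).
  - move=> M q hq; rewrite ip_oppl// (orth M q hq) pE -ip_oppl.
      by congr ip; apply/funext => y; rewrite pN.
    exact: integrable_eval_sphere.
  - by move=> M y NM; rewrite !pN -opprD normrN -!pE; exact: cauchy.
by rewrite pN opprK addrC.
Qed.

End Pointwise.

(** * Sobolev norms through partial sums *)

Section WeightedSums.
Variables (R : realType) (d : nat).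
Local Notation S := (set_type (sphere R d)).
Local Notation omega := (surface_measure R d).
Variables (Z : nat -> nat) (Y : forall l, 'I_(Z l) -> S -> R).
Implicit Types (f g : S -> R) (a b : nat -> R).

Lemma weighted_sumE b f :
  weighted_sum Y b f = (\sum_(0 <= l <oo) (b l * energy Y f l)%:E)%E.
Proof.
apply: eq_eseriesr => l _; rewrite sumEFin /energy mulr_sumr.
by congr EFin; apply: eq_bigr => k _; rewrite real_normK ?num_real.
Qed.

Section NonnegativeWeights.
Variables (b : nat -> R) (f : S -> R).
Hypothesis b0 : forall l, 0 <= b l.

Let term_ge0 l : 0 <= b l * energy Y f l.
Proof. by rewrite mulr_ge0// energy_ge0. Qed.

Lemma weighted_sum_ge0 : (0 <= weighted_sum Y b f)%E.
Proof. by rewrite weighted_sumE; apply: nneseries_ge0 => l _; rewrite lee_fin. Qed.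

Lemma partial_le_weighted_sum M :
  ((\sum_(0 <= l < M) b l * energy Y f l)%:E <= weighted_sum Y b f)%E.
Proof.
rewrite weighted_sumE -sumEFin; apply: nneseries_lim_ge => l _ _.
by rewrite lee_fin.
Qed.

Lemma weighted_sum_le K : (forall M, \sum_(0 <= l < M) b l * energy Y f l <= K) ->
  (weighted_sum Y b f <= K%:E)%E.
Proof.
move=> hK; rewrite weighted_sumE; apply: lime_le.
  by apply: is_cvg_nneseries => l _ _; rewrite lee_fin.
by apply: nearW => M; rewrite sumEFin lee_fin.
Qed.

Lemma weighted_sum_fin : (weighted_sum Y b f < +oo)%E ->
  weighted_sum Y b f = (fine (weighted_sum Y b f))%:E.
Proof. by move=> h; rewrite fineK// ge0_fin_numE// weighted_sum_ge0. Qed.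

Lemma partial_le_fine M : (weighted_sum Y b f < +oo)%E ->
  \sum_(0 <= l < M) b l * energy Y f l <= fine (weighted_sum Y b f).
Proof.
by move=> h; rewrite -lee_fin -weighted_sum_fin// partial_le_weighted_sum.
Qed.

End NonnegativeWeights.

Lemma weighted_sum_lty_le b b' K f : 0 <= K -> (forall l, 0 <= b l) ->
  (forall l, 0 <= b' l <= K * b l) ->
  (weighted_sum Y b f < +oo)%E -> (weighted_sum Y b' f < +oo)%E.
Proof.
move=> K0 b0 bb h.
apply: (@le_lt_trans _ _ (K * fine (weighted_sum Y b f))%:E); last exact: ltry.
apply: weighted_sum_le => [l|M]; first by case/andP: (bb l).
apply: (@le_trans _ _ (K * \sum_(0 <= l < M) b l * energy Y f l)).
  rewrite mulr_sumr; apply: ler_sum => l _; rewrite mulrA ler_wpM2r ?energy_ge0//.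
  by case/andP: (bb l).
by rewrite ler_wpM2l// partial_le_fine.
Qed.

(** Passes from the extended-real norm to real partial sums, on which the estimates are made. *)
Lemma sobolev_norm_le a f K : (forall l, 0 < a l) -> 0 <= K ->
  (forall M, \sum_(0 <= l < M) (a l)^-1 * energy Y f l <= K ^+ 2) ->
  (sobolev_norm Y a f <= K%:E)%E.
Proof.
move=> a0 K0 h.
have a1 l : 0 <= (a l)^-1 by rewrite invr_ge0 ltW.
have := weighted_sum_le a1 h; have := weighted_sum_ge0 f a1.
rewrite /sobolev_norm; case: (weighted_sum _ _ _) => [r| |]//=.
rewrite !lee_fin => r0 rK; rewrite powR12_sqrt//.
by rewrite -[leRHS]ger0_norm// -sqrtr_sqr ler_wsqrtr.
Qed.

Lemma sobolev_norm_fin a f : (forall l, 0 < a l) ->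
  (weighted_sum Y (fun l => (a l)^-1)%R f < +oo)%E ->
  sobolev_norm Y a f = (Num.sqrt (fine (weighted_sum Y (fun l => (a l)^-1)%R f)))%:E.
Proof.
move=> a0; have a1 l : 0 <= (a l)^-1 by rewrite invr_ge0 ltW.
have := weighted_sum_ge0 f a1; rewrite /sobolev_norm.
by case: (weighted_sum _ _ _) => [r| |]//=; rewrite lee_fin => r0 _; rewrite powR12_sqrt.
Qed.

Hypothesis hY : forall l, orthonormal_basis (spherical_harmonics l) (@Y l).
Hypothesis d0 : (0 < d)%N.

Lemma hat_sub f g l (k : 'I_(Z l)) : omega.-integrable setT (EFin \o f) ->
  omega.-integrable setT (EFin \o g) ->
  hat Y (f \- g) k = hat Y f k - hat Y g k.
Proof. by move=> fi gi; rewrite /hat (basis_polyE hY) ip_subl. Qed.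

Lemma integrable_expansion n c : omega.-integrable setT (EFin \o expansion Y n c).
Proof. by rewrite (expansionE hY); exact: integrable_eval_sphere. Qed.

(** Subtracting a polynomial of degree at most n alters no coefficient of higher degree, so the tail
    of f beyond n survives in every competitor. *)
Lemma best_approx_ge a n f : (forall l, 0 < a l) -> square_integrable f ->
  (weighted_sum Y (fun l => (a l)^-1)%R f < +oo)%E ->
  ((Num.sqrt (fine (weighted_sum Y (fun l => (a l)^-1)%R f) -
     \sum_(0 <= l < n.+1) (a l)^-1 * energy Y f l))%:E <= best_approx Y a n f)%E.
Proof.
move=> a0 hf fin; have a1 l : 0 <= (a l)^-1 by rewrite invr_ge0 ltW.
have fi := square_integrable_integrable hf.
apply: le_ereal_inf_tmp => _ [chi hchi <-].
set g := f \- chi.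
have ge l : (n < l)%N -> energy Y g l = energy Y f l.
  move=> nl; apply: eq_bigr => k _; rewrite /g.
  rewrite (poly_space_expand hY d0 hchi) hat_sub//; last exact: integrable_expansion.
  by rewrite (hat_expansion hY d0) leqNgt nl subr0.
have [ginf|gfin] := eqVneq (weighted_sum Y (fun l => (a l)^-1)%R g) +oo%E.
  by rewrite /sobolev_norm ginf/= invr_eq0 pnatr_eq0 leey.
have {}gfin : (weighted_sum Y (fun l => (a l)^-1)%R g < +oo)%E by rewrite ltey.
rewrite sobolev_norm_fin// lee_fin ler_wsqrtr// lerBlDr -lee_fin -weighted_sum_fin//.
apply: weighted_sum_le => // M.
(* Sums are extended to max(n + 1, M) so that they can be split at degree n. *)
have mono (F : nat -> R) : (forall l, 0 <= F l) ->
    \sum_(0 <= l < M) F l <= \sum_(0 <= l < maxn n.+1 M) F l.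
  move=> F0; rewrite [leRHS](big_cat_nat (n := M)) ?leq_maxr//= lerDl.
  by apply: sumr_ge0.
apply: (@le_trans _ _ (\sum_(0 <= l < maxn n.+1 M) (a l)^-1 * energy Y f l)).
  by apply: (mono (fun l => (a l)^-1 * energy Y f l)) => l; rewrite mulr_ge0// energy_ge0.
rewrite (big_cat_nat (n := n.+1)) ?leq_maxl//= addrC lerD2r.
apply: le_trans (partial_le_fine a1 (maxn n.+1 M) gfin).
rewrite [leRHS](big_cat_nat (n := n.+1)) ?leq_maxl//= ler_wpDl//.
  by apply: sumr_ge0 => l _; rewrite mulr_ge0// energy_ge0.
rewrite big_nat [leRHS]big_nat; apply: ler_sum => l /andP[nl _].
by rewrite ge.
Qed.

End WeightedSums.

(** * Hyperinterpolation *)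

(** Subtracting the lower error bound at -r from the upper one at r cancels the diagonal terms and
    leaves 4 r (I - D) <= 2 eta (F + r^2 V). *)
Lemma polarization (R : realType) (eta F V D I a b r : R) :
  - (eta * (F + 2 * - r * D + (- r) ^+ 2 * V)) <=
    a + 2 * - r * I + (- r) ^+ 2 * b - (F + 2 * - r * D + (- r) ^+ 2 * V) ->
  a + 2 * r * I + r ^+ 2 * b - (F + 2 * r * D + r ^+ 2 * V) <=
    eta * (F + 2 * r * D + r ^+ 2 * V) ->
  2 * r * (I - D) <= eta * (F + r ^+ 2 * V).
Proof. lra. Qed.

Section Quadrature.
Variables (R : realType) (d : nat).
Local Notation S := (set_type (sphere R d)).
Local Notation omega := (surface_measure R d).
Variables (Z : nat -> nat) (Y : forall l, 'I_(Z l) -> S -> R).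
Hypothesis hY : forall l, orthonormal_basis (spherical_harmonics l) (@Y l).
Hypothesis d0 : (0 < d)%N.
Variables (n m : nat) (x : 'I_m -> S) (w : 'I_m -> R) (eta : R).
Hypothesis w0 : forall j, 0 < w j.
Hypothesis eta0 : 0 <= eta.
Hypothesis MZ : forall chi : S -> R, poly_space n chi ->
  `| \sum_(j < m) w j * chi (x j) ^+ 2 - \int[omega]_y (chi y ^+ 2) |
  <= eta * \int[omega]_y (chi y ^+ 2).
Local Notation coeffs := (forall l, 'I_(Z l) -> R).
Implicit Types (c b : coeffs) (f g : S -> R).

Definition sqnorm c := \sum_(l < n.+1) \sum_(k < Z l) c l k ^+ 2.

Lemma sqnorm_ge0 c : 0 <= sqnorm c.
Proof. by apply: sumr_ge0 => l _; apply: sumr_ge0 => k _; exact: sqr_ge0. Qed.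

Lemma parseval c : \int[omega]_y (expansion Y n c y ^+ 2) = sqnorm c.
Proof.
rewrite (_ : (fun _ => _) = (fun y => expansion Y n c y * expansion Y n c y)).
  rewrite -/(ip _ _) (ip_expansion hY d0).
  by apply: eq_bigr => l _; apply: eq_bigr => k _; rewrite expr2.
by apply/funext => y; rewrite expr2.
Qed.

Lemma quadrature_error c :
  `| \sum_(j < m) w j * expansion Y n c (x j) ^+ 2 - sqnorm c | <= eta * sqnorm c.
Proof. by rewrite -parseval; apply: MZ; exact: expansion_poly_space. Qed.

Lemma sum_ip_discrete f c :
  \sum_(l < n.+1) \sum_(k < Z l) ip_discrete x w f (@Y l k) * c l k =
  ip_discrete x w f (expansion Y n c).
Proof.
rewrite /ip_discrete; under eq_bigr => l _ do under eq_bigr => k _ do rewrite mulr_suml.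
under eq_bigr => l _ do rewrite exchange_big/=.
rewrite exchange_big/=; apply: eq_bigr => j _.
rewrite /expansion mulr_sumr; apply: eq_bigr => l _; rewrite mulr_sumr.
by apply: eq_bigr => k _; ring.
Qed.

Lemma sqnorm_ip_discrete g (Q : R) : (forall j, g (x j) ^+ 2 <= Q) ->
  sqnorm (fun l k => ip_discrete x w g (@Y l k)) <= (1 + eta) * (\sum_j w j) * Q.
Proof.
move=> hQ; set u := (fun _ => _); set U := sqnorm u.
have U0 : 0 <= U := sqnorm_ge0 u.
have UE : U = ip_discrete x w g (expansion Y n u).
  by rewrite -sum_ip_discrete; apply: eq_bigr => l _; apply: eq_bigr => k _; rewrite expr2.
have h1 : \sum_j w j * g (x j) ^+ 2 <= (\sum_j w j) * Q.
  by rewrite mulr_suml; apply: ler_sum => j _; rewrite ler_pM2l.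
have h2 : \sum_j w j * expansion Y n u (x j) ^+ 2 <= (1 + eta) * U.
  by have := quadrature_error u; rewrite ler_norml => /andP[_]; rewrite -/U; lra.
have cs : U ^+ 2 <= (\sum_j w j * g (x j) ^+ 2) * \sum_j w j * expansion Y n u (x j) ^+ 2.
  rewrite {1}UE /ip_discrete.
  have := cauchy_schwarz_sum (fun j => Num.sqrt (w j) * g (x j))
    (fun j => Num.sqrt (w j) * expansion Y n u (x j)).
  under eq_bigr do rewrite mulrACA -expr2 sqr_sqrtr ?(ltW (w0 _))// mulrA.
  under [X in _ <= X * _]eq_bigr do rewrite exprMn sqr_sqrtr ?(ltW (w0 _))//.
  by under [X in _ <= _ * X]eq_bigr do rewrite exprMn sqr_sqrtr ?(ltW (w0 _))//.
(* U cannot be divided out here, so the right-hand side must be shown nonnegative; the sign of Q is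
   known only if there is a node, and without nodes the sum of weights is 0. *)
have [->|Un0] := eqVneq U 0.
  have [j0|j0] := pselect (exists j : 'I_m, True); last first.
    rewrite big1 ?mulr0 ?mul0r// => j _.
    by case: j0; exists j.
  case: j0 => j _; rewrite !mulr_ge0 ?addr_ge0//.
    by apply: sumr_ge0 => i _; exact: ltW.
  by apply: le_trans (hQ j); exact: sqr_ge0.
have Up : 0 < U by rewrite lt_def Un0.
rewrite -(ler_pM2r Up) -expr2; apply: (le_trans cs).
rewrite (_ : _ * Q * U = ((\sum_j w j) * Q) * ((1 + eta) * U)); last by ring.
apply: ler_pM => //; apply: sumr_ge0 => j _; rewrite mulr_ge0 ?sqr_ge0//; exact: ltW.
Qed.

Lemma expansion_lin c b (r : R) y :
  expansion Y n (fun l k => c l k + r * b l k) y = expansion Y n c y + r * expansion Y n b y.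
Proof.
rewrite /expansion mulr_sumr -big_split; apply: eq_bigr => l _.
rewrite mulr_sumr -big_split; apply: eq_bigr => k _ /=; ring.
Qed.

Lemma sqnorm_lin c b (r : R) : sqnorm (fun l k => c l k + r * b l k) =
  sqnorm c + 2 * r * (\sum_(l < n.+1) \sum_(k < Z l) c l k * b l k) + r ^+ 2 * sqnorm b.
Proof.
rewrite /sqnorm !mulr_sumr -!big_split; apply: eq_bigr => l _.
rewrite !mulr_sumr -!big_split; apply: eq_bigr => k _ /=; ring.
Qed.

(* The error functional is a symmetric bilinear form on the polynomial space
   whose quadratic form is at most eta times the L2 norm; polarization bounds
   its off-diagonal values. *)
Lemma sqnorm_quadrature_defect c :
  sqnorm (fun l k => ip_discrete x w (expansion Y n c) (@Y l k) - c l k)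
  <= eta ^+ 2 * sqnorm c.
Proof.
set v := (fun _ => _); set V := sqnorm v; set F := sqnorm c.
have V0 : 0 <= V := sqnorm_ge0 v.
have F0 : 0 <= F := sqnorm_ge0 c.
pose D := \sum_(l < n.+1) \sum_(k < Z l) c l k * v l k.
pose I := ip_discrete x w (expansion Y n c) (expansion Y n v).
have VE : V = I - D.
  rewrite /I -sum_ip_discrete /D -sumrB; apply: eq_bigr => l _; rewrite -sumrB.
  by apply: eq_bigr => k _; rewrite -mulrBl expr2.
pose q b := \sum_j w j * expansion Y n b (x j) ^+ 2.
have qE r : q (fun l k => c l k + r * v l k) = q c + 2 * r * I + r ^+ 2 * q v.
  rewrite /q /I /ip_discrete !mulr_sumr -!big_split; apply: eq_bigr => j _ /=.
  by rewrite expansion_lin; ring.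
have pol r : 2 * r * V <= eta * (F + r ^+ 2 * V).
  have := quadrature_error (fun l k => c l k + r * v l k).
  have := quadrature_error (fun l k => c l k + (- r) * v l k).
  rewrite -!/(q _) !qE !sqnorm_lin -/V -/F -/D !ler_norml => /andP[h1 h2] /andP[h3 h4].
  by rewrite [X in _ * X <= _]VE; exact: polarization h1 h4.
have [e|en0] := eqVneq eta 0.
  by have := pol 1; rewrite e mul0r mulr1 expr0n/= mul0r pmulr_rle0.
have ep : 0 < eta by rewrite lt_def en0.
(* With r = 1/eta, [pol] reads 2 V/eta <= eta F + V/eta, that is V <= eta^2 F. *)
have h : eta ^+ 2 * (2 * eta^-1 * V) <= eta ^+ 2 * (eta * (F + eta^-1 ^+ 2 * V)).
  by rewrite ler_pM2l ?exprn_gt0//; exact: pol.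
have E1 : eta ^+ 2 * (2 * eta^-1 * V) = 2 * (eta * V) by field.
have E2 : eta ^+ 2 * (eta * (F + eta^-1 ^+ 2 * V)) = eta * (eta ^+ 2 * F + V) by field.
rewrite E1 E2 mulrCA (ler_pM2l ep) in h.
lra.
Qed.

End Quadrature.

Lemma minkowski_dep (R : realType) (Z : nat -> nat)
    (A B : forall l, 'I_(Z l) -> R) n :
  Num.sqrt (\sum_(l < n) \sum_(k < Z l) (A l k + B l k) ^+ 2) <=
  Num.sqrt (\sum_(l < n) \sum_(k < Z l) A l k ^+ 2) +
  Num.sqrt (\sum_(l < n) \sum_(k < Z l) B l k ^+ 2).
Proof. by rewrite !(sig_big_dep xpredT (fun _ _ => true))/=; exact: minkowski_sum. Qed.

Lemma sum_nat_le_of_large (R : realType) (F : nat -> R) N K :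
  (forall l, 0 <= F l) -> (forall M, (N <= M)%N -> \sum_(0 <= l < M) F l <= K) ->
  forall M, \sum_(0 <= l < M) F l <= K.
Proof.
move=> F0 hK M; apply: le_trans (hK (maxn N M) (leq_maxl _ _)).
rewrite [leRHS](big_cat_nat (n := M)) ?leq_maxr//= lerDl.
by apply: sumr_ge0.
Qed.

(** * The error estimate in H^t *)

Section ErrorBounds.
Variables (R : realType) (d : nat).
Local Notation S := (set_type (sphere R d)).
Local Notation omega := (surface_measure R d).
Variables (Z : nat -> nat) (Y : forall l, 'I_(Z l) -> S -> R).
Hypothesis hY : forall l, orthonormal_basis (spherical_harmonics l) (@Y l).
Hypothesis d0 : (0 < d)%N.
Variables (s t : R) (a b : nat -> R).
Hypotheses (t0 : 0 <= t) (ts : t <= s) (ds : d%:R / 2 < s).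
Hypotheses (ha : sobolev_weight d s a) (hb : sobolev_weight d t b).

Let s0 : 0 <= s. Proof. exact: le_trans ts. Qed.

(** Since t <= s, the ratio (l+1)^(2t-2s) is largest at the start l = n of the tail. The case n = 0
    compares the two Sobolev norms themselves. *)
Lemma weight_comparison : exists2 D : R, 0 < D &
  forall n l, (n <= l)%N -> (b l)^-1 <= D * n.+1%:R `^ (2 * t - 2 * s) * (a l)^-1.
Proof.
have [c [C [c0 C0 h]]] := sobolev_weight_inv d0 s0 ha.
have [c' [C' [c'0 C'0 h']]] := sobolev_weight_inv d0 t0 hb.
exists (C' / c); first by rewrite divr_gt0.
move=> n l nl; have [_ h1 _ _] := h l; have [_ _ h2 _] := h' l.
have np : 0 < n.+1%:R :> R by rewrite ltr0n.
have lp : 0 < l.+1%:R :> R by rewrite ltr0n.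
apply: (le_trans h2).
rewrite [X in l.+1%:R `^ X](_ : 2 * t = (2 * t - 2 * s) + 2 * s); last by ring.
rewrite powRD; last by rewrite pnatr_eq0 implybT.
rewrite (_ : C' / c * _ * _ = C' * (n.+1%:R `^ (2 * t - 2 * s) * (c^-1 * (a l)^-1))); last by ring.
rewrite ler_pM2l//; apply: ler_pM; rewrite ?powR_ge0//.
  rewrite -[2 * t - 2 * s]opprB !powRN lef_pV2 ?posrE ?powR_gt0//.
  apply: ge0_ler_powR; rewrite ?nnegrE ?ler_nat//.
  by rewrite subr_ge0 ler_pM2l.
by rewrite ler_pdivlMl.
Qed.

Lemma in_sobolev_lty f : in_sobolev Y s f ->
  square_integrable f /\ (weighted_sum Y (fun l => (a l)^-1)%R f < +oo)%E.
Proof.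
move=> [/Lfun2P hf fin]; split => //.
have [c [C [c0 C0 h]]] := sobolev_weight_inv d0 s0 ha.
have [c' [C' [c'0 C'0 h']]] := sobolev_weight_inv d0 s0 (sobolev_weight_powR d s).
apply: (@weighted_sum_lty_le _ _ _ _ _ _ (C / c')) fin.
- by rewrite divr_ge0// ltW.
- by move=> l; exact: powR_ge0.
move=> l; have [al _ h1 _] := h l; have [_ h2 _ _] := h' l.
rewrite invr_ge0 (ltW al)/=; apply: (le_trans h1).
rewrite powRN invrK in h2.
by rewrite -mulrA ler_pM2l// ler_pdivlMl.
Qed.

Lemma in_sobolev_expansion r n c : in_sobolev Y r (expansion Y n c).
Proof.
split; first by apply/Lfun2P; rewrite (expansionE hY); exact: square_integrable_eval.
set e := (fun l => _).
have e0 l : 0 <= e l by exact: powR_ge0.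
apply: (@le_lt_trans _ _
  (\sum_(0 <= l < n.+1) e l * energy Y (expansion Y n c) l)%:E); last exact: ltry.
apply: weighted_sum_le => //; apply: (@sum_nat_le_of_large _ _ n.+1).
  by move=> l; rewrite mulr_ge0// energy_ge0.
move=> M nM; rewrite (big_cat_nat (n := n.+1))//= gerDl big_nat big1// => l /andP[nl _].
rewrite /energy big1 ?mulr0// => k _.
by rewrite (hat_expansion hY d0) leqNgt nl expr0n.
Qed.

(* tau is the tail of the Sobolev series of f beyond degree n; its square root
   bounds the best approximation error from below ([best_approx_ge]). *)
Lemma hyperinterpolation_error : exists2 K : R, 0 < K &
  forall (n m : nat) (x : 'I_m -> S) (w : 'I_m -> R) (eta : R),
    (forall j, 0 < w j) -> \sum_(j < m) w j = area R d -> 0 <= eta ->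
    (forall chi : S -> R, poly_space n chi ->
      `| \sum_(j < m) w j * chi (x j) ^+ 2 - \int[omega]_y (chi y ^+ 2) |
      <= eta * \int[omega]_y (chi y ^+ 2)) ->
  forall f f0 : S -> R, square_integrable f ->
    (weighted_sum Y (fun l => (a l)^-1)%R f < +oo)%E -> continuous_version f f0 ->
  let tau := fine (weighted_sum Y (fun l => (a l)^-1)%R f) -
     \sum_(0 <= l < n.+1) (a l)^-1 * energy Y f l in
  let A : R := (Num.sqrt (1 + eta) * Num.sqrt (area R d) + 1)
                 * n.+1%:R `^ (d%:R / 2 + t - s) in
  let B : R := n.+1%:R `^ t * Num.sqrt (eta ^+ 2 + 4 * eta) in
  let Q := K * (A * Num.sqrt tau + B * Num.sqrt (\int[omega]_x f x ^+ 2)) in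
  forall M,
   \sum_(l < n.+1) (b l)^-1 *
     \sum_(k < Z l) (ip_discrete x w f0 (@Y l k) - hat Y f k) ^+ 2 +
   \sum_(n.+1 <= l < M) (b l)^-1 * energy Y f l <= Q ^+ 2.
Proof.
have [C C0 hC] := continuous_expansion_dist hY d0 ds ha.
have [D D0 hD] := weight_comparison.
have [c [c' [c0 c'0 hbt]]] := sobolev_weight_inv d0 t0 hb.
have [ca [ca' [_ _ aP]]] := sobolev_weight_inv d0 s0 ha.
(* K dominates the constants of the node term, the quadrature term and the tail separately; the 1
   gives K <= K^2. *)
pose K := 2 * c' * C + 2 * c' + D + 1.
have K1 : 1 <= K by rewrite /K lerDr !addr_ge0 ?mulr_ge0// ltW.
exists K; first exact: lt_le_trans K1.
move=> n m x w eta w0 sumw eta0 MZ f f0 hf fin cont tau A B Q M.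
have a0 l : 0 <= (a l)^-1 by case: (aP l) => al _ _ _; rewrite invr_ge0 ltW.
have np : 0 < n.+1%:R :> R by rewrite ltr0n.
have ar0 := area_gt0 R d.
have fi := square_integrable_integrable hf.
set F := \int[omega]_x f x ^+ 2 in Q *.
have F0 : 0 <= F by apply: Rintegral_ge0 => y _; exact: sqr_ge0.
have tail_tau M' : \sum_(n.+1 <= l < M') (a l)^-1 * energy Y f l <= tau.
  have [nM|Mn] := leqP n.+1 M'; last first.
    by rewrite big_geq ?(ltnW Mn)// subr_ge0 partial_le_fine.
  rewrite lerBrDr addrC -big_cat_nat//; exact: partial_le_fine.
have tau0 : 0 <= tau by have := tail_tau 0; rewrite big_geq.
pose chi := expansion Y n (hat Y f).
pose g := fun y => f0 y - chi y.
pose u : forall l, 'I_(Z l) -> R := fun l k => ip_discrete x w g (@Y l k).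
pose v : forall l, 'I_(Z l) -> R := fun l k => ip_discrete x w chi (@Y l k) - hat Y f k.
have uv l (k : 'I_(Z l)) : ip_discrete x w f0 (@Y l k) - hat Y f k = u l k + v l k.
  rewrite /u /v addrA -[in RHS]/(ip_discrete _ _ _ _); congr (_ - _).
  by rewrite /ip_discrete -big_split; apply: eq_bigr => j _ /=; rewrite /g; ring.
have hU : sqnorm n u <= (1 + eta) * area R d * (C * n.+1%:R `^ (d%:R - 2 * s) * tau).
  rewrite -sumw; apply: (sqnorm_ip_discrete hY d0 w0 eta0 MZ) => j.
  by apply: hC => // M'; exact: tail_tau.
(* Polarization yields the factor eta^2, enlarged here to the eta^2 + 4 eta of the statement. *)
have hV : sqnorm n v <= (eta ^+ 2 + 4 * eta) * F.
  apply: (le_trans (sqnorm_quadrature_defect hY d0 eta0 MZ (hat Y f))).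
  apply: ler_pM; rewrite ?sqr_ge0 ?sqnorm_ge0//; first by rewrite lerDl mulr_ge0.
  exact: bessel.
(* Up to degree n the inverse weights have order at most (n+1)^(2t); the 2 comes from (u + v)^2 <= 2
   (u^2 + v^2). *)
have low : \sum_(l < n.+1) (b l)^-1 *
     \sum_(k < Z l) (ip_discrete x w f0 (@Y l k) - hat Y f k) ^+ 2 <=
     2 * c' * n.+1%:R `^ (2 * t) * (sqnorm n u + sqnorm n v).
  rewrite /sqnorm -big_split mulr_sumr; apply: ler_sum => l _ /=.
  rewrite [leRHS](_ : _ = c' * n.+1%:R `^ (2 * t) *
    (2 * (\sum_(k < Z l) u l k ^+ 2 + \sum_(k < Z l) v l k ^+ 2))); last by ring.
  apply: ler_pM.
  - by case: (hbt l) => bl _ _ _; rewrite invr_ge0 ltW.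
  - by apply: sumr_ge0 => k _; exact: sqr_ge0.
  - case: (hbt l) => _ _ h _; apply: (le_trans h).
    rewrite ler_pM2l// ge0_ler_powR ?nnegrE ?ler_nat//; last by rewrite mulr_ge0.
  - rewrite -big_split mulr_sumr; apply: ler_sum => k _ /=; rewrite uv.
    have := sqr_ge0 (u l k - v l k); lra.
have high : \sum_(n.+1 <= l < M) (b l)^-1 * energy Y f l <=
    D * n.+1%:R `^ (2 * t - 2 * s) * tau.
  apply: (@le_trans _ _ (D * n.+1%:R `^ (2 * t - 2 * s) *
     \sum_(n.+1 <= l < M) (a l)^-1 * energy Y f l)).
    rewrite mulr_sumr big_nat [leRHS]big_nat; apply: ler_sum => l /andP[nl _].
    by rewrite mulrA ler_wpM2r ?energy_ge0// hD// ltnW.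
  by rewrite ler_wpM2l ?mulr_ge0 ?powR_ge0 ?(ltW D0).
pose X : R := n.+1%:R `^ (d%:R / 2 + t - s).
pose T : R := n.+1%:R `^ t.
have X2 : X ^+ 2 = n.+1%:R `^ (2 * t) * n.+1%:R `^ (d%:R - 2 * s).
  rewrite -powRD; last by rewrite pnatr_eq0 implybT.
  by rewrite /X -powR_mulrn ?powR_ge0// -powRrM; congr powR; field.
have T2 : T ^+ 2 = n.+1%:R `^ (2 * t).
  by rewrite /T -powR_mulrn ?powR_ge0// -powRrM mulrC.
(* The tail term carries an exponent smaller by d than that of X^2; the summand 1 in A accounts for
   it. *)
have X2' : n.+1%:R `^ (2 * t - 2 * s) <= X ^+ 2.
  rewrite X2 powRD; last by rewrite pnatr_eq0 implybT.
  rewrite ler_pM2l ?powR_gt0// ler_powR//; first by rewrite ler1n.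
  by rewrite lerDr.
pose E := (eta ^+ 2 + 4 * eta); have E0 : 0 <= E by rewrite addr_ge0 ?sqr_ge0 ?mulr_ge0.
have total : 2 * c' * n.+1%:R `^ (2 * t) * (sqnorm n u + sqnorm n v) +
   D * n.+1%:R `^ (2 * t - 2 * s) * tau <=
   K * (((1 + eta) * area R d + 1) * X ^+ 2 * tau + T ^+ 2 * E * F).
  have Xt0 : 0 <= X ^+ 2 * tau by rewrite mulr_ge0// sqr_ge0.
  have h1 : 2 * c' * n.+1%:R `^ (2 * t) * sqnorm n u <=
      2 * c' * C * ((1 + eta) * area R d * (X ^+ 2 * tau)).
    apply: (@le_trans _ _ (2 * c' * n.+1%:R `^ (2 * t) *
       ((1 + eta) * area R d * (C * n.+1%:R `^ (d%:R - 2 * s) * tau)))).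
      by rewrite ler_pM2l// !mulr_gt0// powR_gt0.
    by rewrite X2 le_eqVlt; apply/orP; left; apply/eqP; ring.
  have h2 : 2 * c' * n.+1%:R `^ (2 * t) * sqnorm n v <= 2 * c' * (T ^+ 2 * E * F).
    by rewrite T2 -[_ * E * F]mulrA mulrA ler_pM2l// !mulr_gt0// powR_gt0.
  have h3 : D * n.+1%:R `^ (2 * t - 2 * s) * tau <= D * (X ^+ 2 * tau).
    by rewrite -mulrA ler_pM2l// ler_wpM2r.
  have q1 : 0 <= (1 + eta) * area R d * (X ^+ 2 * tau).
    by rewrite mulr_ge0// mulr_ge0 ?addr_ge0// ltW.
  have q2 : 0 <= T ^+ 2 * E * F by rewrite mulr_ge0// mulr_ge0// sqr_ge0.
  rewrite mulrDr (_ : K * _ = (2 * c' * C) * ((1 + eta) * area R d * (X ^+ 2 * tau)) +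
     (K - 2 * c' * C) * ((1 + eta) * area R d * (X ^+ 2 * tau)) +
     D * (X ^+ 2 * tau) + (K - D) * (X ^+ 2 * tau) + 2 * c' * (T ^+ 2 * E * F) +
     (K - 2 * c') * (T ^+ 2 * E * F)); last by ring.
  have k1 : 0 <= (K - 2 * c' * C) * ((1 + eta) * area R d * (X ^+ 2 * tau)).
    by rewrite mulr_ge0// /K; have := mulr_gt0 c'0 C0; lra.
  have k2 : 0 <= (K - D) * (X ^+ 2 * tau).
    by rewrite mulr_ge0// /K; have := mulr_gt0 c'0 C0; lra.
  have k3 : 0 <= (K - 2 * c') * (T ^+ 2 * E * F).
    by rewrite mulr_ge0// /K; have := mulr_gt0 c'0 C0; lra.
  lra.
apply: (le_trans (lerD low high)); apply: (le_trans total).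
(* [total] bounds the error by K times a sum of squares; K <= K^2 and the nonnegative cross terms
   turn this into the square of Q. *)
rewrite /Q exprMn; apply: ler_pM.
- by rewrite (le_trans ler01).
- apply: addr_ge0; apply: mulr_ge0 => //; apply: mulr_ge0; rewrite ?sqr_ge0//.
  by rewrite addr_ge0// mulr_ge0 ?addr_ge0// ltW.
- by rewrite ler_eXnr.
have x0 : 0 <= A * Num.sqrt tau.
  by rewrite !mulr_ge0 ?addr_ge0 ?mulr_ge0 ?sqrtr_ge0 ?powR_ge0.
have y0 : 0 <= B * Num.sqrt F by rewrite !mulr_ge0 ?sqrtr_ge0 ?powR_ge0.
rewrite sqrrD -addrA; apply: lerD; last first.
  rewrite ler_wpDl ?mulrn_wge0 ?mulr_ge0//.
  by rewrite /B !exprMn !sqr_sqrtr.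
rewrite /A !exprMn sqr_sqrtr// ler_wpM2r// -/X ler_wpM2r ?sqr_ge0//.
rewrite sqrrD exprMn !sqr_sqrtr ?addr_ge0 ?(ltW ar0)// expr1n lerD2r lerDl.
by rewrite mulrn_wge0// mulr1 mulr_ge0 ?sqrtr_ge0.
Qed.

End ErrorBounds.

(* The premise of the first bound: the trailing term |f|_{H^s} has constant 1,
   so for s - t > d/2 the bound forces |p|_{H^t} <= |p|_{H^s} for polynomials p
   (take eta = 0 and n to infinity), i.e. a^(s) <= a^(t) pointwise. *)
Theorem corollary3p1 (R : realType) (d : nat) (s t : R)
    (Z : nat -> nat) (Y : forall l, 'I_(Z l) -> sphere R d -> R)
    (a : R -> nat -> R) :
  (2 <= d)%N -> 0 <= t -> t <= s -> d%:R / 2 < s ->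
  (forall l, orthonormal_basis (spherical_harmonics l) (Y l)) ->
  (forall r, 0 <= r -> sobolev_weight d r (a r)) ->
  exists c1 c2 : R, [/\ 0 < c1, 0 < c2 &
  forall (n m : nat) (x : 'I_m -> sphere R d) (w : 'I_m -> R) (eta : R),
    (forall j, 0 < w j) ->
    (\sum_(j < m) w j)%:E = surface_measure R d setT ->
    0 <= eta < 1 ->
    (forall chi : sphere R d -> R, poly_space n chi ->
      `| \sum_(j < m) w j * chi (x j) ^+ 2
         - \int[surface_measure R d]_y (chi y ^+ 2) |
      <= eta * \int[surface_measure R d]_y (chi y ^+ 2)) ->
  forall f f0 : sphere R d -> R,
    in_sobolev Y s f -> continuous_version f f0 ->
    let area : R := fine (surface_measure R d setT) in
    let A : R := (Num.sqrt (1 + eta) * Num.sqrt area + 1)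
                 * n.+1%:R `^ (d%:R / 2 + t - s) in
    let B : R := n.+1%:R `^ t * Num.sqrt (eta ^+ 2 + 4 * eta) in
    let Unf : sphere R d -> R := hyperinterpolant Y x w n f0 in
    [/\ in_sobolev Y t Unf,
        (d%:R / 2 < s - t -> forall l, a s l <= a t l) ->
        (sobolev_norm Y (a t) Unf
         <= c1%:E * (A%:E * sobolev_norm Y (a s) f
                     + B%:E * 'N[surface_measure R d]_2%:E[EFin \o f])
            + sobolev_norm Y (a s) f)%E &
        (sobolev_norm Y (a t) (Unf \- f)%R
         <= c2%:E * (A%:E * best_approx Y (a s) n f
                     + B%:E * 'N[surface_measure R d]_2%:E[EFin \o f]))%E]].
Proof.
move=> d2 t0 ts ds hY hw.
have d0 : (0 < d)%N by exact: ltnW.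
have s0 : 0 <= s by exact: le_trans ts.
have hs := hw s s0; have ht := hw t t0.
have [K K0 hK] := hyperinterpolation_error hY d0 t0 ts ds hs ht.
have [D D0 hD] := weight_comparison d0 t0 ts hs ht.
have [? [? [_ _ asP]]] := sobolev_weight_inv d0 s0 hs.
have [? [? [_ _ atP]]] := sobolev_weight_inv d0 t0 ht.
have as0 l : 0 < a s l by case: (asP l).
have at0 l : 0 < a t l by case: (atP l).
(* In the first bound K pays for the error and [Num.sqrt D] for the embedding of H^s into H^t. *)
exists (K + Num.sqrt D), K; split => //.
  by rewrite (lt_le_trans K0)// lerDl sqrtr_ge0.
move=> n m x w eta w0 sumw /andP[eta0 _] MZ f f0 hf cont ar A B Unf.
have [hf2 fin] := in_sobolev_lty d0 t0 ts hs hf.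
have UE : Unf = expansion Y n (fun l k => ip_discrete x w f0 (Y l k)) by [].
have sumw' : \sum_(j < m) w j = area R d by rewrite /area -sumw.
have := hK n m x w eta w0 sumw' eta0 MZ f f0 hf2 fin cont.
rewrite -[area R d]/ar -/A -/B.
set W := fine (weighted_sum Y _ f); set tau := W - _.
set F := \int[_]_x f x ^+ 2 => err.
have as1 l : 0 <= (a s l)^-1 by rewrite invr_ge0 ltW.
have at1 l : 0 <= (a t l)^-1 by rewrite invr_ge0 ltW.
have W0 : 0 <= W by apply: fine_ge0; exact: weighted_sum_ge0.
have tauW : tau <= W.
  by rewrite gerBl sumr_ge0// => l _; rewrite mulr_ge0// energy_ge0.
have A0 : 0 <= A by rewrite mulr_ge0 ?powR_ge0// addr_ge0// mulr_ge0// sqrtr_ge0.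
have B0 : 0 <= B by rewrite mulr_ge0 ?powR_ge0// sqrtr_ge0.
have Q0 : 0 <= A * Num.sqrt tau + B * Num.sqrt F.
  by rewrite addr_ge0// mulr_ge0// sqrtr_ge0.
have fi := square_integrable_integrable hf2.
split.
- by rewrite UE; exact: in_sobolev_expansion.
- move=> hst; rewrite (sobolev_norm_fin as0 fin) (Lnorm2E hf2) -/W -/F.
  rewrite -!EFinM -!EFinD.
  (* H is the H^t norm of the truncated expansion of f; by Minkowski only the error of the
     coefficients has to be added to it. *)
  pose H := Num.sqrt (\sum_(l < n.+1) \sum_(k < Z l)
     (Num.sqrt (a t l)^-1 * hat Y f k) ^+ 2).
  have hH : H ^+ 2 = \sum_(0 <= l < n.+1) (a t l)^-1 * energy Y f l.
    rewrite sqr_sqrtr; last by apply: sumr_ge0 => l _; apply: sumr_ge0 => k _; exact: sqr_ge0.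
    rewrite big_mkord; apply: eq_bigr => l _; rewrite /energy mulr_sumr.
    by apply: eq_bigr => k _; rewrite exprMn sqr_sqrtr.
  apply: (@le_trans _ _ (K * (A * Num.sqrt tau + B * Num.sqrt F) + H)%:E).
    apply: sobolev_norm_le => //.
      by rewrite addr_ge0 ?sqrtr_ge0// mulr_ge0// ltW.
    apply: (@sum_nat_le_of_large _ _ n.+1) => [l|M nM]; first by rewrite mulr_ge0// energy_ge0.
    rewrite (big_cat_nat (n := n.+1))//= [X in _ + X]big_nat [X in _ + X]big1 ?addr0; last first.
      move=> l /andP[nl _]; rewrite /energy big1 ?mulr0// => k _.
      by rewrite UE (hat_expansion hY d0) leqNgt nl expr0n.
    have -> : \sum_(0 <= l < n.+1) (a t l)^-1 * energy Y Unf l =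
        \sum_(l < n.+1) \sum_(k < Z l)
         (Num.sqrt (a t l)^-1 * (ip_discrete x w f0 (Y l k) - hat Y f k) +
          Num.sqrt (a t l)^-1 * hat Y f k) ^+ 2.
      rewrite big_mkord; apply: eq_bigr => l _; rewrite /energy mulr_sumr.
      apply: eq_bigr => k _; rewrite UE (hat_expansion hY d0) -ltnS ltn_ord.
      by rewrite -mulrDr subrK exprMn sqr_sqrtr.
    set T := \sum_(l < n.+1) _.
    have T0 : 0 <= T by apply: sumr_ge0 => l _; apply: sumr_ge0 => k _; exact: sqr_ge0.
    rewrite -(sqr_sqrtr T0) lerXn2r ?nnegrE ?sqrtr_ge0//.
      by rewrite addr_ge0 ?sqrtr_ge0// mulr_ge0// ltW.
    apply: (le_trans (minkowski_dep
      (fun l k => Num.sqrt (a t l)^-1 * (ip_discrete x w f0 (Y l k) - hat Y f k))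
      (fun l k => Num.sqrt (a t l)^-1 * hat Y f k) n.+1)).
    rewrite lerD2r -[leRHS]ger0_norm ?mulr_ge0// ?(ltW K0)// -sqrtr_sqr ler_wsqrtr//.
    (* At M = 0 the tail sum is empty, and only the degrees up to n remain. *)
    have := err 0; rewrite [X in _ + X]big_geq// addr0; apply: le_trans.
    apply: ler_sum => l _; rewrite mulr_sumr; apply: ler_sum => k _.
    by rewrite exprMn sqr_sqrtr.
  rewrite lee_fin mulrDl -addrA; apply: lerD.
    rewrite ler_pM2l// lerD2r ler_wpM2l// ler_wsqrtr//.
  (* If s - t > d/2, the exponent in A is negative and the trailing norm absorbs H with constant 1,
     by the premise on the weights. Otherwise A >= 1, so [Num.sqrt D * A] times the H^s norm absorbs
     H. *)
  have [dst|dst] := ltP (d%:R / 2) (s - t).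
    apply: ler_wpDl.
      by rewrite mulr_ge0 ?sqrtr_ge0// addr_ge0// mulr_ge0// sqrtr_ge0.
    rewrite -[leLHS]ger0_norm ?sqrtr_ge0// -sqrtr_sqr ler_wsqrtr// hH.
    apply: le_trans (partial_le_fine as1 n.+1 fin).
    apply: ler_sum => l _; rewrite ler_wpM2r ?energy_ge0// lef_pV2 ?posrE//.
    exact: hst.
  apply: ler_wpDr; first exact: sqrtr_ge0.
  apply: (@le_trans _ _ (Num.sqrt D * Num.sqrt W)).
    rewrite -sqrtrM ?(ltW D0)// -[leLHS]ger0_norm ?sqrtr_ge0// -sqrtr_sqr ler_wsqrtr// hH.
    apply: (@le_trans _ _ (D * \sum_(0 <= l < n.+1) (a s l)^-1 * energy Y f l)).
      rewrite mulr_sumr; apply: ler_sum => l _; rewrite mulrA ler_wpM2r ?energy_ge0//.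
      by have := hD 0 l isT; rewrite powR1 mulr1.
    by rewrite ler_pM2l// partial_le_fine.
  rewrite ler_wpM2l ?sqrtr_ge0//; apply: ler_wpDr; first by rewrite mulr_ge0// sqrtr_ge0.
  rewrite ler_peMl ?sqrtr_ge0// /A mulr_ege1//.
    by rewrite lerDr mulr_ge0// sqrtr_ge0.
  rewrite -[leLHS](powRr0 n.+1%:R) ler_powR ?ler1n//.
  by rewrite -addrA -[t - s]opprB subr_ge0.
- rewrite (Lnorm2E hf2) -/F.
  apply: (@le_trans _ _ (K * (A * Num.sqrt tau + B * Num.sqrt F))%:E).
    apply: sobolev_norm_le => //; first by rewrite mulr_ge0// ltW.
    apply: (@sum_nat_le_of_large _ _ n.+1) => [l|M nM]; first by rewrite mulr_ge0// energy_ge0.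
    apply: le_trans (err M); rewrite (big_cat_nat (n := n.+1))//= big_mkord.
    have Ui := integrable_expansion hY n (fun l k => ip_discrete x w f0 (Y l k)).
    apply: lerD.
      apply: ler_sum => l _; rewrite ler_wpM2l// /energy; apply: ler_sum => k _.
      by rewrite UE (hat_sub hY)// (hat_expansion hY d0) -ltnS ltn_ord.
    rewrite big_nat [leRHS]big_nat; apply: ler_sum => l /andP[nl _].
    rewrite ler_wpM2l// /energy; apply: ler_sum => k _.
    by rewrite UE (hat_sub hY)// (hat_expansion hY d0) leqNgt nl sub0r sqrrN.
  rewrite EFinM lee_wpmul2l ?lee_fin ?(ltW K0)// EFinD !EFinM leeD2r//.
  by rewrite lee_wpmul2l ?lee_fin//; exact: best_approx_ge.
Qed.
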